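(* Let $(\mathbf{d},\mathbf{D})\in\mathbb{N}^4\times\mathbb{N}^4$ be such that $d_iD_i$ is odd and $d_i\mid D_i$ for $1\le i\le4$. Let $k\in\{0,1,2\}$, $j\in\{*,0,1\}$, and assume that the binary linear forms $L_1,\dots,L_4\in\mathbb{Z}[x_1,x_2]$ and the region $\mathcal{R}\subset\mathbb{R}^2$ satisfy the normalisation hypothesis $\mathsf{NH}_k(\mathbf{d})$. Let $$c=\delta_{j,k}(\mathbf{A},\mathbf{d})\,\frac{\pi^4\,\mathrm{meas}(\mathcal{R})}{\det\mathsf{\Gamma}_{\mathbf{D}}}\prod_{p>2}\sigma_p .$$ Then $$c=\omega_{\mathcal{R}}(\infty)\,\omega_{j,k,\mathbf{d}}(2)\prod_{p>2}\omega_{\boldsymbol\lambda,\boldsymbol\mu}(p),$$ where the products are over odd primes and, for each $p$, $\boldsymbol\lambda=(\nu_p(d_1),\dots,\nu_p(d_4))$ and $\boldsymbol\mu=(\nu_p(D_1),\dots,\nu_p(D_4))$.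
   Context: $\mathbb{N}$ = positive integers; $\nu_p$ is the $p$-adic valuation; $\chi$ is the non-principal Dirichlet character modulo $4$; $[a,b]$ is the least common multiple. Throughout, for $j=*$ the condition $x_2\equiv j\bmod2$ is void. Normalisation hypotheses. Consider the conditions: (i) $\mathcal{R}$ is open, bounded and convex, with piecewise continuously differentiable boundary; (ii) no two of $L_1,\dots,L_4$ are proportional; (iii) $L_i(\mathbf{x})>0$ for all $\mathbf{x}\in\mathcal{R}$ and $1\le i\le4$. Then $L_1,\dots,L_4,\mathcal{R}$ satisfy - $\mathsf{NH}_0(\mathbf{d})$ if (i)–(iii) hold and $L_i(\mathbf{x})\equiv d_ix_1\pmod4$ for all $i$; - $\mathsf{NH}_1(\mathbf{d})$ if (i)–(iii) hold, the coefficients of $L_3,L_4$ are all non-zero, and there are integers $k_1,k_2\ge0$ with $2^{-k_1}L_1(\mathbf{x})\equiv d_1x_1\pmod4$ and $2^{-k_2}L_2(\mathbf{x})\equiv d_2x_1\pmod4$; - $\mathsf{NH}_2(\mathbf{d})$ if (i)–(iii) hold, the coefficients of $L_3,L_4$ are all non-zero, and there are integers $k_1,k_2\ge0$ with $2^{-k_1}L_1(\mathbf{x})\equiv d_1x_1\pmod4$ and $2^{-k_2}L_2(\mathbf{x})\equiv x_2\pmod4$. All these congruences are between linear forms with integer coefficients. For $\mathbf{h}\in\mathbb{N}^4$ write $\mathsf{\Gamma}(\mathbf{h};L_1,\dots,L_4)=\{\mathbf{x}\in\mathbb{Z}^2:h_i\mid L_i(\mathbf{x}),\ 1\le i\le4\}$,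 with $\det$ its determinant (index in $\mathbb{Z}^2$), and $\mathsf{\Gamma}_{\mathbf{D}}=\mathsf{\Gamma}(\mathbf{D};L_1,\dots,L_4)$. Put $$\rho_0(\mathbf{h})=\frac{\det\mathsf{\Gamma}\big(([D_1,d_1h_1],\dots,[D_4,d_4h_4]);L_1,\dots,L_4\big)}{\det\mathsf{\Gamma}_{\mathbf{D}}},\qquad \sigma_p=\Big(1-\frac{\chi(p)}{p}\Big)^4\sum_{a,b,c,d=0}^\infty\frac{\chi(p)^{a+b+c+d}}{\rho_0(p^a,p^b,p^c,p^d)}\quad(p>2).$$ Write $L_3=a_3x_1+b_3x_2$, $L_4=a_4x_1+b_4x_2$ and $\mathbf{A}=\begin{pmatrix} a_3 & b_3 \\ a_4 & b_4 \end{pmatrix}$. For $n\in\mathbb{N}$ let $E_n=\{x\in\mathbb{Z}/2^n\mathbb{Z}:\exists\,\nu\in\mathbb{Z}_{\ge0},\ 2^{-\nu}x\equiv1\bmod4\}$ (the classes of integers $2^{\nu}m$ with $\nu\ge0$, $m\equiv1\bmod4$), and for $L_1,\dots,L_4,\mathcal{R}$ satisfying $\mathsf{NH}_k(\mathbf{d})$ set $$\delta_{j,k}(\mathbf{A},\mathbf{d})=\lim_{n\to\infty}\frac{1}{2^{2n-4}}\#\Big\{\mathbf{x}\in(\mathbb{Z}/2^n\mathbb{Z})^2: x_1\equiv1\bmod4,\ x_2\equiv j\bmod2,\ L_i(\mathbf{x})\in d_iE_n\ (1\le i\le4)\Big\}.$$ Local densities of the variety $L_i(x_1,x_2)=d_i(s_i^2+t_i^2)$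 $(1\le i\le4)$ in $\mathbb{A}^{10}$: For $p>2$ and $\boldsymbol\lambda,\boldsymbol\mu\in\mathbb{Z}_{\ge0}^4$, let $N_{\boldsymbol\lambda,\boldsymbol\mu}(p^n)$ be the number of $(\mathbf{x},\mathbf{s},\mathbf{t})\in(\mathbb{Z}/p^n\mathbb{Z})^{10}$ ($\mathbf{x}$ having 2 coordinates, $\mathbf{s},\mathbf{t}$ having 4 each) with $L_i(x_1,x_2)\equiv p^{\lambda_i}(s_i^2+t_i^2)\bmod p^n$ and $p^{\mu_i}\mid L_i(x_1,x_2)$ for $1\le i\le4$; and $$\omega_{\boldsymbol\lambda,\boldsymbol\mu}(p)=\lim_{n\to\infty}p^{-6n-\lambda_1-\cdots-\lambda_4}N_{\boldsymbol\lambda,\boldsymbol\mu}(p^n).$$ For $p=2$, let $N_{j,k,\mathbf{d}}(2^n)$ be the number of $(\mathbf{x},\mathbf{s},\mathbf{t})\in(\mathbb{Z}/2^n\mathbb{Z})^{10}$ with $L_i(x_1,x_2)\equiv d_i(s_i^2+t_i^2)\bmod2^n$ for $1\le i\le4$, $x_1\equiv1\bmod4$ and $x_2\equiv j\bmod2$ (the subscript $k$ records that $\mathsf{NH}_k(\mathbf{d})$ is assumed); and $\omega_{j,k,\mathbf{d}}(2)=\lim_{n\to\infty}2^{-6n}N_{j,k,\mathbf{d}}(2^n)$. $\omega_{\mathcal{R}}(\infty)$ is the archimedean density of solutions $(\mathbf{x},\mathbf{s},\mathbf{t})\in\mathcal{R}\times\mathbb{R}^8$ of the system $L_i(\mathbf{x})=d_i(s_i^2+t_i^2)$,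 computed with the Leray measure attached to the functions $d_i^{-1}L_i(\mathbf{x})-s_i^2-t_i^2$; that is, the total mass of the solution set with respect to the measure which, parametrising the points with all $t_i\neq0$ by $(\mathbf{x},\mathbf{s})$ (for each choice of signs of the $t_i$), is $(2^4|t_1t_2t_3t_4|)^{-1}\,ds_1\cdots ds_4\,dx_1\,dx_2$. *)

(* Defs.v *)
From HB Require Import structures.
From mathcomp Require Import all_boot all_order all_algebra.
From mathcomp Require Import finmap.
From mathcomp Require Import all_classical all_reals all_analysis.

Set Implicit Arguments.
Unset Strict Implicit.
Unset Printing Implicit Defensive.

Import Order.TTheory GRing.Theory Num.Theory.
Import numFieldNormedType.Exports.

Local Open Scope classical_set_scope.
Local Open Scope ring_scope.

(* Four binary linear forms are the rows of L : 'M[int]_(4, 2); the forms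
   L_1, ..., L_4 have the indices 0, ..., 3 of 'I_4. *)
Definition lform (L : 'M[int]_(4, 2)) (i : 'I_4) (x : int * int) : int :=
  L i 0 * x.1 + L i 1 * x.2.

Definition lformR (R : realType) (L : 'M[int]_(4, 2)) (i : 'I_4)
    (x : R * R) : R :=
  (L i 0)%:~R * x.1 + (L i 1)%:~R * x.2.

Definition proportional (f g : 'rV[int]_2) : Prop :=
  exists u v : int, (u, v) != (0, 0) /\ u *: f = v *: g.

(* [form_eqmod4 f a b] : f = a * x_1 + b * x_2 (mod 4) as linear forms. *)
Definition form_eqmod4 (f : 'rV[int]_2) (a b : int) : Prop :=
  (f 0%R 0%R = a %[mod 4])%Z /\ (f 0%R 1%R = b %[mod 4])%Z.

(* A C^1 arc is the image of [0, 1] under a regular C^1 map; such a map on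
   [0, 1] always extends to a C^1 map on the line, so it is taken there. *)
Definition C1_arc (R : realType) (A : set (R * R)) : Prop :=
  exists f g : R -> R,
    [/\ forall t, derivable f t 1 /\ derivable g t 1,
        continuous (derive1 f) /\ continuous (derive1 g),
        forall t, 0 <= t <= 1 -> (derive1 f t, derive1 g t) != (0, 0) &
        A = [set (f t, g t) | t in `[0, 1]]].

Definition piecewise_C1_boundary (R : realType) (U : set (R * R)) : Prop :=
  exists (m : nat) (arc : 'I_m -> set (R * R)),
    (forall i, C1_arc (arc i)) /\
    closure U `\` interior U = \bigcup_i arc i.

Section normalisation.
Context (R : realType).
Variables (d : 'I_4 -> nat) (L : 'M[int]_(4, 2)) (U : set (R * R)).

Definition NH_common : Prop :=
  [/\ [/\ open U, bounded_set (U : set (R^o * R^o)%type),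
          @convex_set R (R^o * R^o)%type U & piecewise_C1_boundary U],
      forall i j : 'I_4, i != j -> ~ proportional (row i L) (row j L) &
      forall x, U x -> forall i, 0 < lformR L i x].

Definition NH_coeff34 : Prop :=
  forall (i : 'I_4) (j : 'I_2), (2 <= i)%N -> L i j != 0.

Definition NH_dyadic (i : 'I_4) (a b : int) : Prop :=
  exists (k : nat) (f : 'rV[int]_2), row i L = 2 ^+ k *: f /\ form_eqmod4 f a b.

Definition NH0 : Prop :=
  NH_common /\ forall i, form_eqmod4 (row i L) (d i)%:Z 0.

Definition NH1 : Prop :=
  [/\ NH_common, NH_coeff34, NH_dyadic 0 (d 0)%:Z 0 & NH_dyadic 1 (d 1)%:Z 0].

Definition NH2 : Prop :=
  [/\ NH_common, NH_coeff34, NH_dyadic 0 (d 0)%:Z 0 & NH_dyadic 1 0 1].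

Definition NH (k : 'I_3) : Prop :=
  match val k with 0%N => NH0 | 1%N => NH1 | _ => NH2 end.

End normalisation.

Definition Gamma (h : 'I_4 -> nat) (L : 'M[int]_(4, 2)) : set (int * int) :=
  [set x | forall i, (h i %| lform L i x)%Z].

(* The index in Z^2, as the number of cosets (0 if there are infinitely many). *)
Definition lattice_det (G : set (int * int)) : nat :=
  #|` fset_set (range (fun x : int * int => [set y | G (y - x)])) |%fset.

Definition chi4 (n : nat) : int :=
  match (n %% 4)%N with 1%N => 1 | 3%N => -1 | _ => 0 end.

Section densities.
Context (R : realType).
Variables (d D : 'I_4 -> nat) (L : 'M[int]_(4, 2)).

Definition rho0 (h : 'I_4 -> nat) : R :=
  (lattice_det (Gamma (fun i => lcmn (D i) (d i * h i)) L))%:R /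
  (lattice_det (Gamma D L))%:R.

Definition sigma_term (p : nat) (e : nat * nat * nat * nat) : R :=
  let: (a, b, c, f) := e in
  (chi4 p)%:~R ^+ (a + b + c + f) /
  rho0 (fun i => (p ^ nth 0 [:: a; b; c; f] i)%N).

(* The fourfold series is summed along the boxes [0, N)^4. *)
Definition sigma (p : nat) : R :=
  (1 - (chi4 p)%:~R / p%:R) ^+ 4 *
  limn (fun N : nat => \sum_(a < N) \sum_(b < N) \sum_(c < N) \sum_(f < N)
    sigma_term p (val a, val b, val c, val f)).

(* The residue classes modulo q are represented by the elements of 'I_q. *)
Definition vec2 (q : nat) (x : 'I_q * 'I_q) : int * int :=
  ((val x.1)%:Z, (val x.2)%:Z).

(* The union in Z of the classes in E_n. *)
Definition Eset (n : nat) : set int :=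
  [set x | exists (nu : nat) (m : int),
     (m = 1 %[mod 4])%Z /\ (x = 2 ^+ nu * m %[mod 2 ^+ n])%Z].

Definition dEset (c n : nat) : set int :=
  [set y | exists2 x, Eset n x & (y = c%:Z * x %[mod 2 ^+ n])%Z].

(* j = None encodes j = *, for which the condition is void. *)
Definition cond_j (j : option 'I_2) (x2 : int) : Prop :=
  if j is Some j0 then (x2 = (val j0)%:Z %[mod 2])%Z else True.

Definition delta_seq (j : option 'I_2) (n : nat) : R :=
  2 ^+ 4 / 2 ^+ (2 * n) *
  #|[set x : 'I_(2 ^ n) * 'I_(2 ^ n) | `[<
      [/\ ((vec2 x).1 = 1 %[mod 4])%Z, cond_j j (vec2 x).2 &
          forall i, dEset (d i) n (lform L i (vec2 x))] >] ]%SET|%:R.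

Definition delta (j : option 'I_2) : R := limn (delta_seq j).

(* A point (x, s, t) of (Z/q)^10. *)
Definition point10 (q : nat) : finType :=
  (('I_q * 'I_q) * {ffun 'I_4 -> 'I_q} * {ffun 'I_4 -> 'I_q})%type.

Definition sum2sq (q : nat) (s t : {ffun 'I_4 -> 'I_q}) (i : 'I_4) : int :=
  (val (s i))%:Z ^+ 2 + (val (t i))%:Z ^+ 2.

Definition N_odd (lambda mu : 'I_4 -> nat) (p n : nat) : nat :=
  #|[set z : point10 (p ^ n) | let: (x, s, t) := z in `[<
      forall i,
        (lform L i (vec2 x) = p%:Z ^+ lambda i * sum2sq s t i
           %[mod p%:Z ^+ n])%Z /\
        (p%:Z ^+ mu i %| lform L i (vec2 x))%Z >] ]%SET|.

Definition omega_odd_seq (lambda mu : 'I_4 -> nat) (p n : nat) : R :=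
  (N_odd lambda mu p n)%:R / p%:R ^+ (6 * n + \sum_i lambda i).

Definition omega_odd (lambda mu : 'I_4 -> nat) (p : nat) : R :=
  limn (omega_odd_seq lambda mu p).

Definition N_two (j : option 'I_2) (n : nat) : nat :=
  #|[set z : point10 (2 ^ n) | let: (x, s, t) := z in `[<
      [/\ forall i, (lform L i (vec2 x) = (d i)%:Z * sum2sq s t i
                       %[mod 2 ^+ n])%Z,
          ((vec2 x).1 = 1 %[mod 4])%Z & cond_j j (vec2 x).2] >] ]%SET|.

Definition omega_two_seq (j : option 'I_2) (n : nat) : R :=
  (N_two j n)%:R / 2 ^+ (6 * n).

Definition omega_two (j : option 'I_2) : R := limn (omega_two_seq j).

Definition lebesgue2 : set (measurableTypeR R * measurableTypeR R) -> \bar R :=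
  (@lebesgue_measure R \x @lebesgue_measure R)%E.

Definition lebesgue4 :
    set ((measurableTypeR R * measurableTypeR R) *
         (measurableTypeR R * measurableTypeR R)) -> \bar R :=
  (lebesgue2 \x lebesgue2)%E.

Definition coord4 (s : (R * R) * (R * R)) (i : 'I_4) : R :=
  nth 0 [:: s.1.1; s.1.2; s.2.1; s.2.2] i.

Definition t_coord (eps : {ffun 'I_4 -> bool})
    (z : (R * R) * ((R * R) * (R * R))) (i : 'I_4) : R :=
  (-1) ^+ eps i *
  Num.sqrt (lformR L i z.1 / (d i)%:R - coord4 z.2 i ^+ 2).

(* The (x, s) over which there are solutions (x, s, t) with all t_i non-zero;
   there is then exactly one for each choice eps of the signs of the t_i. *)
Definition chart (U : set (R * R)) : set ((R * R) * ((R * R) * (R * R))) :=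
  [set z | U z.1 /\
     forall i, coord4 z.2 i ^+ 2 < lformR L i z.1 / (d i)%:R].

(* The Leray measure of the solution set; z stands for (x, s), with
   s = ((s_1, s_2), (s_3, s_4)). *)
Definition omega_inf (U : set (R * R)) : \bar R :=
  (\sum_(eps : {ffun 'I_4 -> bool})
     \int[lebesgue2 \x lebesgue4]_(z in chart U)
       ((2 ^+ 4 * `|\prod_i t_coord eps z i|)^-1)%:E)%E.

End densities.

Definition odd_prime_product_seq (R : realType) (f : nat -> R) (N : nat) : R :=
  \prod_(0 <= p < N | prime p && (2 < p)%N) f p.

Definition odd_prime_product (R : realType) (f : nat -> R) : R :=
  limn (odd_prime_product_seq f).

Definition valuations (d : 'I_4 -> nat) (p : nat) : 'I_4 -> nat :=
  fun i => logn p (d i).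

(* Main.v *)
(** The identity is proved factor by factor.

    Archimedean place: for fixed x each s_i contributes the integral of
    (2 sqrt (c - s^2))^-1 over s^2 < c, which is pi / 2, and there are 2^4
    choices of signs, so omega_R(oo) = pi^4 meas R.

    Odd p: the number of (s, t) mod p^m with s^2 + t^2 = A is p^m (1 - chi(p)/p)
    times the sum of chi(p)^a over p^a | A, provided p^m does not divide A; the
    x for which this fails for some L_i form a negligible set.  Expanding the
    product over i and averaging over x mod p^n, the conditions
    p^(max(mu_i, lambda_i + a_i)) | L_i(x) have density 1 / det Gamma, whence
    omega(p) = sigma_p / det Gamma(p^mu).  At p = 2 the number of (s, t) is
    2^(n+1) or 0 according to whether A lies in E_n, so omega(2) = delta.

    By the Chinese remainder theorem det Gamma is multiplicative, so that the
    product of det Gamma(p^mu) over the odd primes is det Gamma_D.  All the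
    convergence statements come from the bound
    h_i h_j <= det Gamma(h) (a_i b_j - a_j b_i)^2 for i <> j, which gives
    sigma_p = 1 + O(p^-2). *)

From HB Require Import structures.
Require Import Defs.
From mathcomp Require Import all_boot all_order all_algebra.
From mathcomp Require Import finmap cyclic finfield.
From mathcomp Require Import all_classical all_reals all_analysis.
From mathcomp Require Import measurable_realfun ring lra zify.

Set Implicit Arguments.
Unset Strict Implicit.
Unset Printing Implicit Defensive.

Import Order.TTheory GRing.Theory Num.Theory.
Import numFieldNormedType.Exports.

Local Open Scope classical_set_scope.
Local Open Scope ring_scope.

(** * Sums over residue classes modulo q *)

Section residue_sums.

(** At a finite level n the two sides of each local identity differ: the count of (s, t) has its
    closed form only when no high power of p divides any L_i(x). Every comparison therefore needs
    the rarity of the exceptional x and a uniform bound for the count there. A non-zero minor with a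
    second form makes the exceptional density O(p^-n). The counts may grow like (5/4)^(4 n) at odd
    p, which is still o(p^n), and stay bounded after normalisation at 2. The lower bound for the
    index sees only two of the four moduli. This is enough because the two largest of four exponents
    carry at least half of their sum, which gives geometric decay in all four. The linear term of
    sigma_p cancels: at almost all p the exponents of total size 1 contribute 4 chi(p)/p, and (1 -
    chi(p)/p)^4 contributes the opposite. In the Euler product the indices of Gamma(p^mu) multiply
    to the index of Gamma_D after finitely many primes, so from then on the partial products of
    omega and sigma differ by one fixed factor. *)

Definition periodic2 (V : Type) (q : nat) (F : int * int -> V) :=
  forall x y, (q%:Z %| x.1 - y.1)%Z -> (q%:Z %| x.2 - y.2)%Z -> F x = F y.

(** Functions on (Z/q)^2 are kept as periodic functions on Z^2, so that one function can be summed
    modulo several q without passing between quotient types. *)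
Definition sumZ2 (V : nmodType) (q : nat) (F : int * int -> V) : V :=
  \sum_(x : 'I_q * 'I_q) F (vec2 x).

Lemma dvdzB (a x y : int) : (a %| x)%Z -> (a %| y)%Z -> (a %| x - y)%Z.
Proof. by move=> ax ay; rewrite rpredB. Qed.

Lemma ord_congr_eq (q : nat) (i j : 'I_q) :
  (q%:Z %| (val i)%:Z - (val j)%:Z)%Z -> i = j.
Proof.
rewrite -eqz_mod_dvd !modz_nat !modn_small ?ltn_ord// => /eqP[] ?; exact: val_inj.
Qed.

Lemma periodic2_dvd (V : Type) (q k : nat) (F : int * int -> V) :
  (q %| k)%N -> periodic2 q F -> periodic2 k F.
Proof.
by move=> qk pF x y x1 x2; apply: pF; [exact: dvdz_trans x1|exact: dvdz_trans x2].
Qed.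

(** Reduction modulo q is an injection between sets of the same size q^2, hence a bijection. All
    changes of variables modulo q below are instances. *)
Lemma sum_residues2 (V : nmodType) (T : finType) (phi : T -> int * int)
    (q : nat) (F : int * int -> V) :
  (0 < q)%N -> #|T| = (q * q)%N -> periodic2 q F ->
  (forall s t, (q%:Z %| (phi s).1 - (phi t).1)%Z ->
     (q%:Z %| (phi s).2 - (phi t).2)%Z -> s = t) ->
  \sum_(t : T) F (phi t) = sumZ2 q F.
Proof.
move=> q0 cT pF inj_phi.
have res_subproof (a : int) : (`|(a %% q%:Z)%Z|%N < q)%N.
  rewrite -ltz_nat gez0_abs ?modz_ge0 ?eqz_nat -?lt0n//.
  by rewrite ltz_pmod.
pose res a := Ordinal (res_subproof a).
have resE a : (q%:Z %| a - (val (res a))%:Z)%Z.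
  rewrite /res/= gez0_abs ?modz_ge0 ?eqz_nat -?lt0n//.
  by rewrite -eqz_mod_dvd modz_mod.
pose h t := (res (phi t).1, res (phi t).2).
have h_inj : injective h.
  move=> s t [/(congr1 Posz) e1 /(congr1 Posz) e2]; apply: inj_phi.
  - have := dvdzB (resE (phi s).1) (resE (phi t).1).
    by rewrite /= e1; congr (_ %| _)%Z; ring.
  - have := dvdzB (resE (phi s).2) (resE (phi t).2).
    by rewrite /= e2; congr (_ %| _)%Z; ring.
have h_bij : bijective h by apply: inj_card_bij => //; rewrite card_prod card_ord cT.
rewrite /sumZ2 (reindex h) /=; last exact: onW_bij.
apply: eq_bigr => t _; apply: pF.
  exact: resE.
exact: resE.
Qed.

Lemma sumZ2_scaled (V : nmodType) (q : nat) (c : int) (F : int * int -> V) :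
  (0 < q)%N -> coprimez q c -> periodic2 q F ->
  sumZ2 q (fun x => F (c * x.1, c * x.2)) = sumZ2 q F.
Proof.
move=> q0 qc pF; apply: (sum_residues2 (phi := fun t => (c * _, c * _)) q0) => //.
  by rewrite card_prod card_ord.
move=> s t /=; rewrite -!mulrBr !Gauss_dvdzr// => /ord_congr_eq s1 /ord_congr_eq s2.
by rewrite [s]surjective_pairing s1 s2 -surjective_pairing.
Qed.

Lemma sumZ2_shift (V : nmodType) (q : nat) (c : int * int) (F : int * int -> V) :
  (0 < q)%N -> periodic2 q F ->
  sumZ2 q (fun x => F (x.1 + c.1, x.2 + c.2)) = sumZ2 q F.
Proof.
move=> q0 pF; apply: (sum_residues2 (phi := fun t => (_ + c.1, _ + c.2)) q0) => //.
  by rewrite card_prod card_ord.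
move=> s t /=; rewrite !opprD !(addrACA _ _ (- _)) !subrr !addr0.
move=> /ord_congr_eq s1 /ord_congr_eq s2.
by rewrite [s]surjective_pairing s1 s2 -surjective_pairing.
Qed.

(** The form in which Hensel lifting is used: w is a pair modulo q and w + q u are its lifts modulo
    q k. *)
Lemma sumZ2_split (V : nmodType) (q k : nat) (F : int * int -> V) :
  (0 < q)%N -> (0 < k)%N -> periodic2 (q * k) F ->
  sumZ2 (q * k) F =
  sumZ2 q (fun w => sumZ2 k (fun u => F (w.1 + q%:Z * u.1, w.2 + q%:Z * u.2))).
Proof.
move=> q0 k0 pF; rewrite /sumZ2 pair_bigA /=; apply/esym.
apply: (sum_residues2 (phi := fun t => ((vec2 t.1).1 + q%:Z * (vec2 t.2).1,
  (vec2 t.1).2 + q%:Z * (vec2 t.2).2))) => //.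
- by rewrite muln_gt0 q0.
- by rewrite !card_prod !card_ord mulnACA.
have digit (w w' : 'I_q) (u u' : 'I_k) :
    ((q * k)%N%:Z %| (w%:Z + q%:Z * u%:Z) - (w'%:Z + q%:Z * u'%:Z))%Z ->
    w = w' /\ u = u'.
  rewrite PoszM => qk.
  have ww' : w = w'.
    apply: ord_congr_eq.
    have := dvdzB (dvdz_trans (dvdz_mulr k (dvdzz q)) qk)
      (dvdz_mulr (u%:Z - u'%:Z) (dvdzz q)).
    by congr (_ %| _)%Z; ring.
  split=> //; move: qk; rewrite ww' (_ : _ - _ = q%:Z * (u%:Z - u'%:Z)); last by ring.
  by rewrite dvdz_mul2l ?eqz_nat -?lt0n ?q0//; exact: ord_congr_eq.
case=> [[w1 w2] [u1 u2]] [[w1' w2'] [u1' u2']] /=.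
by move=> /digit[-> ->] /digit[-> ->].
Qed.

Lemma sumZ2_refine (V : nmodType) (q k : nat) (F : int * int -> V) :
  (0 < q)%N -> (0 < k)%N -> periodic2 q F -> sumZ2 (q * k) F = sumZ2 q F *+ k ^ 2.
Proof.
move=> q0 k0 pF; rewrite sumZ2_split//; last first.
  exact: periodic2_dvd (dvdn_mulr _ _) pF.
rewrite -sumrMnl; apply: eq_bigr => w _.
rewrite /sumZ2 (eq_bigr (fun=> F (vec2 w))); last first.
  move=> u _; apply: pF => /=.
    by rewrite addrAC subrr add0r dvdz_mulr.
  by rewrite addrAC subrr add0r dvdz_mulr.
by rewrite sumr_const card_prod card_ord.
Qed.

Lemma sumZ2_crt (V : pzSemiRingType) (M N : nat) (F G : int * int -> V) :
  (0 < M)%N -> (0 < N)%N -> coprime M N -> periodic2 M F -> periodic2 N G ->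
  sumZ2 (M * N) (fun x => F x * G x) = sumZ2 M F * sumZ2 N G.
Proof.
move=> M0 N0 MN pF pG.
(* The Chinese remainder map is taken as N u + M v, which needs no Bezout coefficients. Modulo M it
   is N u and modulo N it is M v, so the two factors are first rescaled by these units. *)
rewrite -(sumZ2_scaled (c := N) M0)// -(sumZ2_scaled (c := M) N0)//; last first.
  by rewrite coprimezE/= coprime_sym.
rewrite [in RHS]/sumZ2 big_distrlr /= pair_bigA /=.
rewrite -[LHS](sum_residues2 (T := (('I_M * 'I_M) * ('I_N * 'I_N))%type) (phi := fun t =>
  (N%:Z * (vec2 t.1).1 + M%:Z * (vec2 t.2).1,
   N%:Z * (vec2 t.1).2 + M%:Z * (vec2 t.2).2)))//.
- apply: eq_bigr => t _; congr (_ * _); [apply: pF|apply: pG] => /=.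
  + by rewrite addrAC subrr add0r dvdz_mulr.
  + by rewrite addrAC subrr add0r dvdz_mulr.
  + by rewrite addrK dvdz_mulr.
  + by rewrite addrK dvdz_mulr.
- by rewrite muln_gt0 M0.
- by rewrite !card_prod !card_ord mulnACA.
- move=> x y xy1 xy2; congr (_ * _).
    exact: (periodic2_dvd (dvdn_mulr N (dvdnn M)) pF xy1 xy2).
  exact: (periodic2_dvd (dvdn_mull M (dvdnn N)) pG xy1 xy2).
have cMN (A B : nat) (u u' : 'I_A) (v v' : 'I_B) : coprime A B ->
    ((A * B)%N%:Z %| (B%:Z * u%:Z + A%:Z * v%:Z) - (B%:Z * u'%:Z + A%:Z * v'%:Z))%Z ->
    u = u'.
  move=> cAB h; apply: ord_congr_eq.
  have := dvdzB (dvdz_trans (dvdz_mulr B (dvdzz A)) h)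
      (dvdz_mulr (v%:Z - v'%:Z) (dvdzz A)).
  rewrite (_ : _ - _ = B%:Z * (u%:Z - u'%:Z)); last by ring.
  by rewrite Gauss_dvdzr.
case=> [[u1 u2] [v1 v2]] [[u1' u2'] [v1' v2']] /= h1 h2.
have -> := cMN _ _ _ _ _ _ MN h1; have -> := cMN _ _ _ _ _ _ MN h2.
have NM : coprime N M by rewrite coprime_sym.
move: h1 h2; rewrite ![N%:Z * _ + _]addrC mulnC => h1 h2.
by have -> := cMN _ _ _ _ _ _ NM h1; have -> := cMN _ _ _ _ _ _ NM h2.
Qed.

End residue_sums.

(** * Indices of the lattices Gamma *)

Section lattice_index.
Variable (L : 'M[int]_(4, 2)).
Implicit Types (h : 'I_4 -> nat) (x y : int * int) (i j : 'I_4).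

Lemma lformB i x y : lform L i (x - y) = lform L i x - lform L i y.
Proof. by rewrite /lform /=; ring. Qed.

Definition in_Gamma h x : bool := [forall i, ((h i)%:Z %| lform L i x)%Z].

Lemma in_GammaP h x : reflect (Gamma h L x) (in_Gamma h x).
Proof. exact: forallP. Qed.

Lemma periodic2_dvd_lform (q : nat) (a : int) i :
  (a %| q%:Z)%Z -> periodic2 q (fun x => (a %| lform L i x)%Z).
Proof.
move=> aq x y xy1 xy2.
have axy : (a %| lform L i x - lform L i y)%Z.
  rewrite -lformB /lform; apply: (dvdz_trans aq).
  by rewrite rpredD// dvdz_mull.
by apply/idP/idP => ay; [have := dvdzB ay axy|have := rpredD ay axy];
  congr (_ %| _)%Z; ring.
Qed.

Lemma periodic2_in_Gamma h (q : nat) :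
  (forall i, (h i %| q)%N) -> periodic2 q (in_Gamma h).
Proof.
move=> hq x y xy1 xy2; apply: eq_forallb => i.
exact: (periodic2_dvd_lform i (a := (h i)%:Z) (hq i) xy1 xy2).
Qed.

Lemma in_GammaB h x y : in_Gamma h y -> in_Gamma h (x - y) = in_Gamma h x.
Proof.
move=> /forallP hy; apply/forallP/forallP => hx i.
  have := rpredD (hx i) (hy i); rewrite lformB.
  by congr (_ %| _)%Z; ring.
by rewrite lformB; exact: dvdzB.
Qed.

Lemma in_GammaN h x : in_Gamma h (- x) = in_Gamma h x.
Proof.
apply: eq_forallb => i.
by rewrite -[- x]sub0r lformB [lform L i 0]/lform/= !mulr0 addr0 sub0r rpredN.
Qed.

Definition Gamma_coset h x : set (int * int) := [set y | Gamma h L (y - x)].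

Lemma Gamma_cosetP h x y : Gamma_coset h x = Gamma_coset h y <-> Gamma h L (x - y).
Proof.
split=> [xy|/in_GammaP xy].
  have : Gamma_coset h x x.
    by rewrite /Gamma_coset/= subrr; apply/in_GammaP/forallP => i;
       rewrite /lform/= !mulr0 addr0 dvdz0.
  by rewrite xy.
apply/seteqP; split=> z /in_GammaP zx; apply/in_GammaP.
  have : z - y = (z - x) - (y - x) by rewrite opprB addrA subrK.
  by move=> ->; rewrite in_GammaB// -in_GammaN opprB.
have : z - x = (z - y) - (x - y) by rewrite opprB addrA subrK.
by move=> ->; rewrite in_GammaB.
Qed.

Definition Gamma_count (R : numDomainType) h (M : nat) : R :=
  sumZ2 M (fun x => (in_Gamma h x)%:R).

Lemma Gamma_count_gt0 (R : numDomainType) h M : (0 < M)%N -> 0 < Gamma_count R h M.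
Proof.
move=> M0; rewrite /Gamma_count /sumZ2 (bigD1 (Ordinal M0, Ordinal M0))//=.
rewrite (_ : in_Gamma h _ = true); last first.
  by apply/forallP => i; rewrite /lform/= !mulr0 addr0 dvdz0.
by rewrite ltr_pwDl//; apply: sumr_ge0 => x _; rewrite ler0n.
Qed.

Lemma finite_Gamma_cosets h (M : nat) : (0 < M)%N -> (forall i, (h i %| M)%N) ->
  finite_set (range (Gamma_coset h)).
Proof.
move=> M0 hM.
apply: (@sub_finite_set _ _ [set Gamma_coset h (vec2 t) | t in [set: 'I_M * 'I_M]]).
  move=> _ [x _ <-] /=.
  have res (a : int) : exists t : 'I_M, (M%:Z %| (val t)%:Z - a)%Z.
    have lt : (`|(a %% M%:Z)%Z| < M)%N.
      rewrite -ltz_nat gez0_abs ?modz_ge0 ?eqz_nat -?lt0n//.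
      by rewrite ltz_pmod.
    exists (Ordinal lt) => /=; rewrite gez0_abs ?modz_ge0 ?eqz_nat -?lt0n//.
    by rewrite -eqz_mod_dvd modz_mod.
  have [t1 xt1] := res x.1; have [t2 xt2] := res x.2.
  exists (t1, t2) => //; apply/Gamma_cosetP/in_GammaP.
  rewrite (periodic2_in_Gamma hM (y := 0)) ?subr0//.
  by apply/forallP => i; rewrite /lform/= !mulr0 addr0 dvdz0.
by apply: finite_image; exact: finite_finset.
Qed.

(** Double counting of the pairs (coset, point of the box): by translation every coset has as many
    points modulo M as the lattice, and every point lies in exactly one coset. Indices thus become
    counts modulo M. *)
Lemma lattice_det_count (R : numDomainType) h (M : nat) :
  (0 < M)%N -> (forall i, (h i %| M)%N) ->
  (lattice_det (Gamma h L))%:R * Gamma_count R h M = (M * M)%:R.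
Proof.
move=> M0 hM; have finC := finite_Gamma_cosets M0 hM.
rewrite /lattice_det -/(Gamma_coset h); set F := fset_set _.
have inF x : Gamma_coset h x \in F.
  by rewrite in_fset_set// inE; exists x.
transitivity (\sum_(C <- F) \sum_(t : 'I_M * 'I_M)
    ((Gamma_coset h (vec2 t) == C)%:R : R)).
  transitivity (\sum_(C <- F) Gamma_count R h M).
    by rewrite big_const_seq count_predT iter_addr_0 mulr_natl.
  apply: eq_big_seq => C; rewrite in_fset_set// inE => -[x _ <-].
  rewrite /Gamma_count -(sumZ2_shift (- x) M0); last first.
    move=> y z yz1 yz2; congr (_%:R); congr nat_of_bool.
    exact: (periodic2_in_Gamma hM).
  apply: eq_bigr => t _; congr (_%:R); congr nat_of_bool.
  by apply/in_GammaP/eqP => /Gamma_cosetP.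
rewrite exchange_big/=.
transitivity (\sum_(t : 'I_M * 'I_M) (1 : R)); last first.
  by rewrite sumr_const card_prod !card_ord.
apply: eq_bigr => t _; rewrite (big_rem _ (inF (vec2 t)))/= eqxx big_seq big1 ?addr0//.
by move=> C; rewrite mem_rem_uniq ?fset_uniq// inE eq_sym => /andP[/negbTE-> _].
Qed.

Lemma lattice_det_ge_card h (M : nat) (T : finType) (phi : T -> int * int) :
  (0 < M)%N -> (forall i, (h i %| M)%N) ->
  (forall s t, Gamma h L (phi s - phi t) -> s = t) ->
  (#|T| <= lattice_det (Gamma h L))%N.
Proof.
move=> M0 hM inj; have finC := finite_Gamma_cosets M0 hM.
rewrite /lattice_det -/(Gamma_coset h); set F := fset_set _.
rewrite cardE -(size_map (fun t => Gamma_coset h (phi t))).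
apply: uniq_leq_size => [|C /mapP[t _ ->]].
  rewrite map_inj_uniq ?enum_uniq// => s t /Gamma_cosetP; exact: inj.
by rewrite in_fset_set// inE; exists (phi t).
Qed.

Definition minor2 i j : int := L i 0 * L j 1 - L i 1 * L j 0.

(** A crude common bound for the squares of all minors, so that later constants do not depend on the
    pair of forms chosen. *)
Definition minors_bound : nat := (\sum_i \sum_j `|minor2 i j| ^ 2)%N.

Lemma leq_minors_bound i j : (`|minor2 i j| ^ 2 <= minors_bound)%N.
Proof. by rewrite /minors_bound (bigD1 i)//= (bigD1 j)//= -addnA leq_addr. Qed.

(* By Cramer's rule, [(u, v)] is mapped by the adjugate of the matrix of
   [(L_i, L_j)] to a point where these forms are [minor2 i j * u] and
   [minor2 i j * v]; small [u, v] thus give points in different cosets. *)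
Lemma lattice_det_ge h i j : (forall i, 0 < h i)%N -> i != j -> minor2 i j != 0 ->
  (h i * h j <= lattice_det (Gamma h L) * `|minor2 i j| ^ 2)%N.
Proof.
move=> h0 ij m0; set m := `|minor2 i j|%N.
have m_gt0 : (0 < m)%N by rewrite absz_gt0.
(* This is the ceiling of h_a / m: large enough for h_a <= c_a m, small enough that m |u - v| < h_a
   for u, v below c_a. *)
pose c a := ((h a).-1 %/ m).+1.
have c_ge a : (h a <= c a * m)%N.
  by rewrite -[X in (X <= _)%N](prednK (h0 a)) ltn_ceil.
have c_small a (u v : 'I_(c a)) : ((h a)%:Z %| minor2 i j * (u%:Z - v%:Z))%Z -> u = v.
  rewrite dvdzE abszM/= -/m => hd; apply: val_inj => /=.
  have lt : (m * `|u%:Z - v%:Z| < h a)%N.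
    rewrite -(prednK (h0 a)) ltnS mulnC -leq_divRL//.
    have := ltn_ord u; have := ltn_ord v; rewrite /c !ltnS; lia.
  have : (m * `|u%:Z - v%:Z|)%N == 0%N.
    by apply: contraTT lt; rewrite -lt0n -leqNgt => gt0; exact: dvdn_leq.
  rewrite muln_eq0 (gtn_eqF m_gt0)/=; lia.
pose phi (t : 'I_(c i) * 'I_(c j)) : int * int :=
  (L j 1 * t.1%:Z - L i 1 * t.2%:Z, L i 0 * t.2%:Z - L j 0 * t.1%:Z).
pose M := (\prod_a h a)%N.
have M0 : (0 < M)%N by apply: prodn_gt0.
have hM a : (h a %| M)%N by rewrite /M (bigD1 a)//= dvdn_mulr.
have := lattice_det_ge_card (phi := phi) M0 hM.
rewrite card_prod !card_ord => le.
apply: (@leq_trans (c i * c j * m ^ 2)); last by rewrite leq_mul2r le ?orbT//;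
  move=> s t st; have := st i; have := st j;
  rewrite [s]surjective_pairing [t]surjective_pairing => sj si;
  congr (_, _); apply: c_small; [move: si|move: sj]; congr (_ %| _)%Z;
  rewrite /lform/phi/minor2/=; ring.
by rewrite -mulnn mulnACA leq_mul.
Qed.

Lemma lattice_det_gt0 h (M : nat) : (0 < M)%N -> (forall i, (h i %| M)%N) ->
  (0 < lattice_det (Gamma h L))%N.
Proof.
move=> M0 hM; have := @lattice_det_ge_card h M unit (fun=> 0) M0 hM.
by rewrite card_unit; apply=> [] [] [].
Qed.

(** The point counts factor by the Chinese remainder theorem, and so do the box sizes; cancelling
    the positive counts leaves the indices. *)
Lemma lattice_det_mul h h1 h2 (M N : nat) :
  (0 < M)%N -> (0 < N)%N -> coprime M N ->
  (forall i, (h1 i %| M)%N) -> (forall i, (h2 i %| N)%N) ->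
  (forall i, h i = (h1 i * h2 i)%N) ->
  lattice_det (Gamma h L) =
  (lattice_det (Gamma h1 L) * lattice_det (Gamma h2 L))%N.
Proof.
move=> M0 N0 MN h1M h2N hE.
have MN0 : (0 < M * N)%N by rewrite muln_gt0 M0.
have hMN i : (h i %| M * N)%N by rewrite hE dvdn_mul.
have cE : Gamma_count int h (M * N) = Gamma_count int h1 M * Gamma_count int h2 N.
  rewrite /Gamma_count -sumZ2_crt//.
  - apply: eq_bigr => t _; rewrite -natrM mulnb; congr (_%:R); congr nat_of_bool.
    rewrite /in_Gamma -[LHS]andbb.
    apply/andP/andP => [[/forallP hx _]|[/forallP hx1 /forallP hx2]].
      split; apply/forallP => i; apply: dvdz_trans (hx i); rewrite hE PoszM.
        by rewrite dvdz_mulr.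
      by rewrite dvdz_mull.
    have hx : [forall i, ((h i)%:Z %| lform L i (vec2 t))%Z].
      apply/forallP => i; rewrite hE PoszM Gauss_dvdz ?hx1 ?hx2//.
      by rewrite coprimezE/=; apply: coprime_dvdl (h1M i) (coprime_dvdr (h2N i) MN).
    by split.
  - move=> x y xy1 xy2; congr (_%:R); congr nat_of_bool.
    exact: (periodic2_in_Gamma h1M).
  - move=> x y xy1 xy2; congr (_%:R); congr nat_of_bool.
    exact: (periodic2_in_Gamma h2N).
have K1 := Gamma_count_gt0 int h1 M0; have K2 := Gamma_count_gt0 int h2 N0.
have D := lattice_det_count int MN0 hMN.
have D1 := lattice_det_count int M0 h1M; have D2 := lattice_det_count int N0 h2N.
have : (lattice_det (Gamma h L))%:R * (Gamma_count int h1 M * Gamma_count int h2 N) =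
  (lattice_det (Gamma h1 L) * lattice_det (Gamma h2 L))%:R *
  (Gamma_count int h1 M * Gamma_count int h2 N).
  by rewrite -cE D mulnACA natrM -D1 -D2 [in RHS]natrM mulrACA cE.
move/mulIf => /(_ _)/eqP; rewrite eqr_nat => H; apply/eqP/H.
by rewrite mulf_neq0// gt_eqF.
Qed.

(** By multiplicativity with trivial moduli the index equals its own square, and it is positive. *)
Lemma lattice_det_one h : (forall i, h i = 1%N) -> lattice_det (Gamma h L) = 1%N.
Proof.
move=> h1; apply/eqP; have := lattice_det_mul (h := h) (h1 := h) (h2 := h)
  (M := 1) (N := 1) isT isT isT _ _ _.
have d1 i : (h i %| 1)%N by rewrite h1.
move=> /(_ d1 d1) E; have gt0 := lattice_det_gt0 (M := 1) isT d1.
have /E : forall i, h i = (h i * h i)%N by move=> i; rewrite h1.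
by move/eqP; rewrite -{1}[lattice_det (Gamma h L)]muln1 eqn_pmul2l// eq_sym.
Qed.

End lattice_index.

Lemma exists_neq_ord4 (i : 'I_4) : exists j, i != j.
Proof.
exists (inord (i.+1 %% 4)); rewrite -val_eqE/= inordK ?ltn_pmod//.
by case: i => -[|[|[|[|]]]].
Qed.

(** * Linear congruences modulo a prime *)

Section linear_congruence.

Lemma sumZ2_dvd_fst (R : pzSemiRingType) (p : nat) : (0 < p)%N ->
  sumZ2 p (fun x => (p%:Z %| x.1)%Z%:R) = p%:R :> R.
Proof.
move=> p0; rewrite /sumZ2 -(pair_bigA _ (fun a b => (p%:Z %| (vec2 (a, b)).1)%Z%:R))/=.
rewrite (bigD1 (Ordinal p0))//= dvdz0 sumr_const card_ord.
rewrite big1 ?addr0// => a a0; rewrite big1// => b _.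
rewrite dvdzE/= /dvdn modn_small// (_ : _ == 0%N = false)//.
by apply/negbTE; apply: contraNN a0 => /eqP a0; apply/eqP/val_inj.
Qed.

(** A coefficient prime to p lets the affine form replace the corresponding coordinate, which
    reduces the count to p | x_1. This counts Hensel lifts and evaluates the index in
    [lattice_det_single]. *)
Lemma sumZ2_dvd_linear (R : pzSemiRingType) (p : nat) (a b c : int) : prime p ->
  ~~ ((p%:Z %| a)%Z && (p%:Z %| b)%Z) ->
  sumZ2 p (fun x => (p%:Z %| c + a * x.1 + b * x.2)%Z%:R) = p%:R :> R.
Proof.
move=> pp pab; have p0 := prime_gt0 pp.
rewrite -[RHS](sumZ2_dvd_fst R p0).
have per : periodic2 p (fun x => (p%:Z %| x.1)%Z%:R : R).
  move=> x y xy1 _; congr (_%:R); congr nat_of_bool.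
  apply/idP/idP => ay; [have := dvdzB ay xy1|have := rpredD ay xy1];
  congr (_ %| _)%Z; ring.
have cop e : ~~ (p%:Z %| e)%Z -> coprimez p e.
  by rewrite coprimezE/= prime_coprime// dvdzE.
have [pa|pa] := boolP (p%:Z %| a)%Z.
  have pb : ~~ (p%:Z %| b)%Z by move: pab; rewrite pa.
  apply: (sum_residues2 (phi := fun t : 'I_p * 'I_p =>
    (c + a * (vec2 t).1 + b * (vec2 t).2, (vec2 t).1)) p0) => //.
    by rewrite card_prod card_ord.
  move=> [s1 s2] [t1 t2] /= h1 /ord_congr_eq st1; rewrite st1 in h1 *.
  congr (_, _); apply: ord_congr_eq; rewrite -(Gauss_dvdzr _ (cop _ pb)).
  by move: h1; congr (_ %| _)%Z; rewrite /vec2/=; ring.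
apply: (sum_residues2 (phi := fun t : 'I_p * 'I_p =>
    (c + a * (vec2 t).1 + b * (vec2 t).2, (vec2 t).2)) p0) => //.
  by rewrite card_prod card_ord.
move=> [s1 s2] [t1 t2] /= h1 /ord_congr_eq st1; rewrite st1 in h1 *.
congr (_, _); apply: ord_congr_eq; rewrite -(Gauss_dvdzr _ (cop _ pa)).
by move: h1; congr (_ %| _)%Z; rewrite /vec2/=; ring.
Qed.

Lemma lattice_det_single (L : 'M[int]_(4, 2)) (h : 'I_4 -> nat) i (p : nat) :
  prime p -> ~~ ((p%:Z %| L i 0%R)%Z && (p%:Z %| L i 1%R)%Z) ->
  h i = p -> (forall i', i' != i -> h i' = 1%N) ->
  lattice_det (Gamma h L) = p.
Proof.
move=> pp pL hi h1; have p0 := prime_gt0 pp.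
have hp i' : (h i' %| p)%N.
  by have [->|/h1->] := eqVneq i' i; rewrite ?hi ?dvd1n.
have := lattice_det_count L int p0 hp.
rewrite (_ : Gamma_count L int h p = p%:R); last first.
  rewrite -(@sumZ2_dvd_linear _ _ _ _ 0 pp pL); apply: eq_bigr => t _.
  congr (_%:R); congr nat_of_bool; rewrite add0r.
  apply/forallP/idP => [/(_ i)|pt i']; first by rewrite hi.
  by have [->|/h1->] := eqVneq i' i; rewrite ?hi ?dvd1n// dvdzE dvd1n.
move=> /eqP; rewrite natrM => /eqP/mulIf => /(_ _)/eqP; rewrite eqr_nat => H.
by apply/eqP/H; rewrite pnatr_eq0 -lt0n.
Qed.

End linear_congruence.

(** * Sums of two squares modulo prime powers *)

Section circle_mod_p.
Variables (R : numDomainType) (p : nat).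
Hypotheses (pp : prime p) (p2 : (2 < p)%N).
Notation F := 'F_p.

Let chi : R := (chi4 p)%:~R.

Let card_F : #|F| = p. Proof. exact: card_Fp. Qed.

Let two_neq0 : 2 != 0 :> F.
Proof.
rewrite -[2]/(2%:R) -(dvdn_pcharf (pchar_Fp pp)).
by apply/negP => /(dvdn_leq (m := 2) isT); rewrite leqNgt p2.
Qed.

Let p_odd : odd p.
Proof. by move: pp => /even_prime[p_eq|//]; move: p2; rewrite p_eq. Qed.

(** If p = 3 mod 4, then i^2 = -1 would give i^(p-1) = -1, as (p-1)/2 is odd, against Fermat. If p =
    1 mod 4, a power of a primitive root has order 4. *)
Let chi4_sqrt : (exists i : F, i ^+ 2 = -1) <-> (p %% 4 = 1)%N.
Proof.
have p0 := prime_gt0 pp.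
have fermat (x : F) : x != 0 -> x ^+ p.-1 = 1.
  move=> x0; apply: (mulIf x0); rewrite -exprSr prednK// mul1r.
  by rewrite -{2}[x](expf_card x) card_F.
split=> [[i i2]|p1].
  have i0 : i != 0.
    by apply/eqP => i0; move/eqP: i2; rewrite i0 expr0n/= eq_sym oppr_eq0 oner_eq0.
  have /orP[/eqP//|/eqP p3] : ((p %% 4 == 1) || (p %% 4 == 3))%N by lia.
  have : i ^+ p.-1 = -1.
    rewrite (_ : p.-1 = 2 * (2 * (p %/ 4)).+1)%N; last by lia.
    by rewrite exprM i2 exprS exprM sqrrN !expr1n mulr1.
  rewrite fermat// => /eqP; rewrite -subr_eq0 opprK -mulr2n => /eqP/eqP h.
  by move: two_neq0; rewrite h.
have prim : has (p.-1).-primitive_root (enum (predC1 (0 : F))).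
  apply: has_prim_root; first by lia.
  - apply/allP => x; rewrite mem_enum inE => x0.
    by apply/unity_rootP; exact: fermat.
  - exact: enum_uniq.
  - by rewrite -cardE cardC1 card_F.
have /hasP[z _ zp] := prim.
have d4 : (4 %| p.-1)%N by lia.
have := dvdn_prim_root zp d4; set i := z ^+ _ => i4.
exists i; apply/eqP; rewrite -addr_eq0.
have : (i ^+ 2 - 1) * (i ^+ 2 + 1) == 0.
  by rewrite -subr_sqr -exprM (prim_expr_order i4) expr1n subrr.
by rewrite mulf_eq0 subr_eq0 -(prim_order_dvd i4).
Qed.

Let sum_sqrtN1 : \sum_(i : F) (i ^+ 2 == -1)%:R = 1 + chi.
Proof.
rewrite /chi /chi4.
have /orP[/eqP p1|/eqP p3] : ((p %% 4 == 1) || (p %% 4 == 3))%N by lia.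
  rewrite p1; have [i i2] := chi4_sqrt.2 p1.
  have i0 : i != 0.
    by apply/eqP => i0; move/eqP: i2; rewrite i0 expr0n/= eq_sym oppr_eq0 oner_eq0.
  rewrite (bigD1 i)//= i2 eqxx (bigD1 (- i))/=; last first.
    by rewrite eq_sym -addr_eq0 -mulr2n -mulr_natl mulf_neq0.
  rewrite sqrrN i2 eqxx big1 ?addr0// => k /andP[ki kni].
  by rewrite -i2 eqf_sqr (negbTE ki) (negbTE kni).
rewrite p3 big1 ?subrr// => i _; case: eqP => // i2.
by have := chi4_sqrt.1 (ex_intro _ i i2); rewrite p3.
Qed.

Let N (A : F) : R := \sum_(z : F * F) (z.1 ^+ 2 + z.2 ^+ 2 == A)%:R.

Let N0 : N 0 = 1 + (1 + chi) * (p.-1)%:R.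
Proof.
rewrite /N -(pair_bigA _ (fun s t : F => (s ^+ 2 + t ^+ 2 == 0)%:R))/= exchange_big/=.
rewrite (bigD1 0)//=; congr (_ + _).
  have sq0 : 0 ^+ 2 = 0 :> F by rewrite expr0n.
  rewrite (bigD1 0)//= sq0 big1 ?addr0// => s s0.
  by rewrite addr0 sqrf_eq0 (negbTE s0).
rewrite (eq_bigr (fun=> 1 + chi)); last first.
  move=> t t0; rewrite -sum_sqrtN1 (reindex (fun i => i * t))/=; last first.
    by exists (fun i => i / t) => i _; rewrite ?mulfK ?divfK.
  apply: eq_bigr => i _; congr (_%:R); congr nat_of_bool.
  rewrite exprMn -{2}[t ^+ 2]mul1r -mulrDl mulf_eq0 sqrf_eq0 (negbTE t0) orbF.
  by rewrite addr_eq0.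
by rewrite sumr_const cardC1 card_F mulr_natr.
Qed.

(* Pigeonhole: the squares and the elements [A - t^2] are (p + 1) / 2 each. *)
Let two_squares (A : F) : exists a b : F, a ^+ 2 + b ^+ 2 = A.
Proof.
pose k := p./2.+1; pose T := ('I_k + 'I_k)%type.
pose g (t : T) : F :=
  match t with inl s => s%:R ^+ 2 | inr s => A - s%:R ^+ 2 end.
have sq_inj (s t : 'I_k) : s%:R ^+ 2 = t%:R ^+ 2 :> F -> s = t.
  move=> st; apply: val_inj => /=.
  wlog le_st : s t st / (s <= t)%N.
    by move=> H; case/orP: (leq_total s t) => ?; [|apply/esym]; apply: H.
  have : (t - s)%:R * (t + s)%:R == 0 :> F.
    by rewrite natrB// natrD -subr_sqr st subrr.
  have := ltn_ord s; have := ltn_ord t; rewrite /k => ht hs.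
  rewrite mulf_eq0 -!(dvdn_pcharf (pchar_Fp pp)); move: p_odd le_st ht hs.
  move: (nat_of_ord s) (nat_of_ord t) => s' t' po le_st ht hs /orP[].
    by case: (posnP (t' - s')) => [|gt0 /(dvdn_leq gt0)]; lia.
  by case: (posnP (t' + s')) => [|gt0 /(dvdn_leq gt0)]; lia.
have /injectivePn[x [y xy gxy]] : ~~ injectiveb g.
  apply/negP => /injectiveP/leq_card.
  by rewrite card_F card_sum !card_ord /k; move: p_odd; lia.
case: x y xy gxy => [s|s] [t|t] /= xy.
- by move=> /sq_inj st; rewrite st eqxx in xy.
- by move=> /eqP; rewrite eq_sym subr_eq => /eqP ->; exists s%:R, t%:R.
- by move=> /eqP; rewrite subr_eq => /eqP ->; exists t%:R, s%:R.
- by move=> /addrI/oppr_inj/sq_inj st; rewrite st eqxx in xy.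
Qed.

(** Multiplication by the Gaussian number a + b i with a^2 + b^2 = A permutes the pairs and
    multiplies the norm by A. *)
Let N_const (A : F) : A != 0 -> N A = N 1.
Proof.
move=> A0; have [a [b abA]] := two_squares A.
rewrite /N (reindex (fun z : F * F => (a * z.1 - b * z.2, b * z.1 + a * z.2)))/=.
  apply: eq_bigr => z _; congr (_%:R); congr nat_of_bool.
  rewrite (_ : _ + _ = A * (z.1 ^+ 2 + z.2 ^+ 2)); last by rewrite -abA; ring.
  by rewrite -{2}[A]mulr1 (inj_eq (mulfI A0)).
exists (fun z : F * F => ((a * z.1 + b * z.2) / A, (a * z.2 - b * z.1) / A)).
  move=> [s t] _ /=; have -> : s = A * s / A by rewrite mulrC mulKf.
  have -> : t = A * t / A by rewrite mulrC mulKf.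
  rewrite -abA in A0 *.
  by congr (_, _); field.
move=> [s t] _ /=; rewrite -abA in A0 *; by congr (_, _); field.
Qed.

(** The counts N B add up to p^2 and agree for all p - 1 non-zero B, so N 0 determines them. *)
Lemma circle_Fp (A : F) :
  \sum_(z : F * F) (z.1 ^+ 2 + z.2 ^+ 2 == A)%:R =
  if A == 0 then 1 + (1 + chi) * (p.-1)%:R else p%:R - chi.
Proof.
rewrite -/(N A); case: eqVneq => [->//|A0]; rewrite N_const//.
have p10 : (p.-1)%:R != 0 :> R by rewrite pnatr_eq0 -lt0n; lia.
apply: (mulIf p10).
have : \sum_(B : F) N B = p%:R * p%:R.
  have -> : p%:R * p%:R = \sum_(z : F * F) 1 :> R.
    by rewrite sumr_const card_prod card_F natrM.
  rewrite /N exchange_big/=.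
  apply: eq_bigr => z _; rewrite (bigD1 (z.1 ^+ 2 + z.2 ^+ 2))//= eqxx big1 ?addr0//.
  by move=> B; rewrite eq_sym => /negbTE->.
rewrite (bigD1 0)//= (eq_bigr _ N_const) sumr_const cardC1 card_F N0 => h.
have this : N 1 * (p.-1)%:R = p%:R * p%:R - (1 + (1 + chi) * (p.-1)%:R).
  by rewrite -h -mulr_natr; ring.
have pE : p%:R = (p.-1)%:R + 1 :> R by rewrite natr1 prednK// prime_gt0.
by rewrite this pE; ring.
Qed.

End circle_mod_p.

(** * Lifting to powers of an odd prime *)

Section sums_of_two_squares.
Variable (R : realFieldType).

Definition sq2 (z : int * int) : int := z.1 ^+ 2 + z.2 ^+ 2.

Lemma dvdz_sub_congr (q a b : int) : (q %| a - b)%Z -> (q %| a)%Z = (q %| b)%Z.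
Proof.
move=> ab; apply/idP/idP => h; [have := dvdzB h ab|have := rpredD h ab];
  by congr (_ %| _)%Z; ring.
Qed.

Lemma dvdz_sq2_congr (q : int) (A : int) (x y : int * int) :
  (q %| x.1 - y.1)%Z -> (q %| x.2 - y.2)%Z ->
  (q %| sq2 x - A)%Z = (q %| sq2 y - A)%Z.
Proof.
move=> xy1 xy2; apply: dvdz_sub_congr.
rewrite (_ : _ - _ = (x.1 + y.1) * (x.1 - y.1) + (x.2 + y.2) * (x.2 - y.2)).
  by rewrite rpredD// dvdz_mull.
by rewrite /sq2; ring.
Qed.

Definition circle_count (q : nat) (A : int) : R :=
  sumZ2 q (fun z => (q%:Z %| sq2 z - A)%Z%:R).

Lemma periodic2_circle (q : nat) (A : int) :
  periodic2 q (fun z => (q%:Z %| sq2 z - A)%Z%:R : R).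
Proof. by move=> x y xy1 xy2; rewrite (dvdz_sq2_congr A xy1 xy2). Qed.

Lemma circle_count_ge0 (q : nat) (A : int) : 0 <= circle_count q A.
Proof. by apply: sumr_ge0 => z _; rewrite ler0n. Qed.

Section odd_prime.
Variable (p : nat).
Hypotheses (pp : prime p) (p2 : (2 < p)%N).
Let chi : R := (chi4 p)%:~R.
Let p0 : (0 < p)%N := prime_gt0 pp.
Let pn0 : p%:R != 0 :> R. Proof. by rewrite pnatr_eq0 -lt0n. Qed.

Let p_odd : odd p.
Proof. by move: pp => /even_prime[p_eq|//]; move: p2; rewrite p_eq. Qed.

Lemma chi4_sqr1 : ((chi4 p)%:~R : R) ^+ 2 = 1.
Proof.
rewrite /chi4; have /orP[/eqP->|/eqP->] : ((p %% 4 == 1) || (p %% 4 == 3))%N.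
  by move: p_odd; lia.
by rewrite expr1n.
by rewrite mulrNz sqrrN expr1n.
Qed.

Let imprimitive (z : int * int) : bool := (p%:Z %| z.1)%Z && (p%:Z %| z.2)%Z.

Let imprimitive_congr x y : (p%:Z %| x.1 - y.1)%Z -> (p%:Z %| x.2 - y.2)%Z ->
  imprimitive x = imprimitive y.
Proof. by move=> h1 h2; rewrite /imprimitive (dvdz_sub_congr h1) (dvdz_sub_congr h2). Qed.

Let prim_count (m : nat) (A : int) : R :=
  sumZ2 (p ^ m) (fun z => (~~ imprimitive z && ((p ^ m)%:Z %| sq2 z - A)%Z)%:R).

Let imprim_count (m : nat) (A : int) : R :=
  sumZ2 (p ^ m) (fun z => (imprimitive z && ((p ^ m)%:Z %| sq2 z - A)%Z)%:R).

Let count_split m A : circle_count (p ^ m) A = prim_count m A + imprim_count m A.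
Proof.
rewrite /circle_count /prim_count /imprim_count /sumZ2 -big_split/=.
by apply: eq_bigr => z _; case: imprimitive => /=; rewrite ?add0r ?addr0.
Qed.

Let count1 A : circle_count p A =
  if (p%:Z %| A)%Z then 1 + (1 + chi) * (p.-1)%:R else p%:R - chi.
Proof.
have intFp (a : int) : (p%:Z %| a)%Z = (a%:~R == 0 :> 'F_p).
  by rewrite (dvdz_pcharf (pchar_Fp pp)).
rewrite intFp -(circle_Fp R pp p2) /circle_count.
rewrite -(@sum_residues2 _ ('F_p * 'F_p)%type (fun z => ((val z.1)%:Z, (val z.2)%:Z)) p)//.
- apply: eq_bigr => z _; congr (_%:R); congr nat_of_bool.
  rewrite intFp /sq2/= !rmorphB !rmorphD !rmorphXn/= subr_eq0.
  by rewrite -!pmulrn !natr_Zp.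
- by rewrite card_prod !card_Fp.
- exact: periodic2_circle.
- have inj (s t : 'F_p) : (p%:Z %| (val s)%:Z - (val t)%:Z)%Z -> s = t.
    by rewrite intFp rmorphB subr_eq0/= -!pmulrn !natr_Zp => /eqP.
  by move=> [s1 s2] [t1 t2] /= /inj-> /inj->.
Qed.

Let imprim1 A : imprim_count 1 A = (p%:Z %| A)%Z%:R.
Proof.
rewrite /imprim_count expn1 /sumZ2 (bigD1 (Ordinal p0, Ordinal p0))//= big1 ?addr0.
  by rewrite /imprimitive/= dvdz0/= /sq2/= expr0n/= addr0 sub0r rpredN.
move=> [a b] ab; rewrite (_ : imprimitive _ = false)//.
apply/negbTE; apply: contraNN ab => /andP[/=]; rewrite !dvdzE/= => pa pb.
by rewrite xpair_eqE -!val_eqE/=; apply/andP; split;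
  rewrite -leqn0 leqNgt; apply/negP => gt0;
  [have := dvdn_leq gt0 pa|have := dvdn_leq gt0 pb]; rewrite leqNgt ltn_ord.
Qed.

Let prim1 A : prim_count 1 A =
  if (p%:Z %| A)%Z then (1 + chi) * (p.-1)%:R else p%:R - chi.
Proof.
have E := count_split 1 A; rewrite imprim1 expn1 count1 in E.
apply: (addIr (p%:Z %| A)%Z%:R); rewrite -E.
by case: ifP => _; rewrite ?mulr1n ?mulr0n; ring.
Qed.

(** Over a primitive solution w modulo q, the lift w + q u is a solution modulo p q exactly when an
    affine form in u with linear part 2 w_1 u_1 + 2 w_2 u_2 vanishes modulo p. This holds for p of
    the p^2 values of u. *)
Let primS m A : prim_count m.+2 A = p%:R * prim_count m.+1 A.
Proof.
set q := (p ^ m.+1)%N; have q0 : (0 < q)%N by rewrite expn_gt0 p0.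
have pq : (p%:Z %| q%:Z)%Z by rewrite dvdzE/= /q expnS dvdn_mulr.
rewrite /prim_count expnSr -/q sumZ2_split//; last first.
  move=> x y xy1 xy2; congr (_%:R); congr nat_of_bool; congr (~~ _ && _).
    apply: imprimitive_congr; [apply: dvdz_trans xy1|apply: dvdz_trans xy2];
    by rewrite PoszM dvdz_mull.
  exact: dvdz_sq2_congr.
rewrite /sumZ2 big_distrr; apply: eq_bigr => w _; move: (vec2 w) => {}w.
have impE a b : imprimitive (w.1 + q%:Z * a, w.2 + q%:Z * b) = imprimitive w.
  by apply: imprimitive_congr; rewrite /= addrAC subrr add0r dvdz_mulr.
have sqE a b : sq2 (w.1 + q%:Z * a, w.2 + q%:Z * b) - A =
    (sq2 w - A) + q%:Z * (2 * w.1 * a + 2 * w.2 * b + q%:Z * sq2 (a, b)).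
  by rewrite /sq2/=; ring.
have [wi|wi] := boolP (imprimitive w).
  by rewrite /= mulr0 big1// => u _; rewrite impE wi.
have [/dvdzP[c cE]|nq] := boolP (q%:Z %| sq2 w - A)%Z; last first.
  rewrite /= mulr0 big1// => u _; rewrite impE (negbTE wi) sqE.
  rewrite (_ : (_ %| _)%Z = false)//; apply/negbTE; apply: contraNN nq => h.
  have : (q%:Z %| (q * p)%N%:Z)%Z by rewrite PoszM dvdz_mulr.
  move=> /dvdz_trans/(_ h); rewrite (dvdz_sub_congr (b := sq2 w - A))//.
  by rewrite addrAC subrr add0r dvdz_mulr.
rewrite /= mulr1.
have lin : ~~ ((p%:Z %| 2 * w.1)%Z && (p%:Z %| 2 * w.2)%Z).
  have c2 : coprimez p 2 by rewrite coprimezE/= coprimen2.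
  by rewrite !Gauss_dvdzr.
have fact a b : c * q%:Z + q%:Z * (2 * w.1 * a + 2 * w.2 * b + q%:Z * sq2 (a, b)) =
    q%:Z * (c + 2 * w.1 * a + 2 * w.2 * b + q%:Z * sq2 (a, b)) by ring.
rewrite -(sumZ2_dvd_linear R c pp lin); apply: eq_bigr => u _.
rewrite impE (negbTE wi) sqE cE /=; congr (_%:R); congr nat_of_bool.
rewrite fact PoszM dvdz_mul2l ?eqz_nat -?lt0n//; apply: dvdz_sub_congr.
by rewrite addrAC subrr add0r dvdz_mulr.
Qed.

Let primE m A : prim_count m.+1 A = p%:R ^+ m * prim_count 1 A.
Proof. by elim: m => [|m IH]; rewrite ?mul1r// primS IH mulrA -exprS. Qed.

(** Write z = p u with u modulo p^(m+1). After division by p^2 the condition only sees u modulo p^m,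
    whence the factor p^2. *)
Let imprimSS m A : imprim_count m.+2 A =
  if (p%:Z ^+ 2 %| A)%Z then p%:R ^+ 2 * circle_count (p ^ m) (A %/ p%:Z ^+ 2)%Z
  else 0.
Proof.
set q := (p ^ m.+1)%N; have q0 : (0 < q)%N by rewrite expn_gt0 p0.
have pz0 : p%:Z ^+ 2 != 0 by rewrite expf_neq0// eqz_nat -lt0n.
rewrite /imprim_count expnS -/q sumZ2_split//; last first.
  move=> x y xy1 xy2; congr (_%:R); congr nat_of_bool; congr (_ && _).
    apply: imprimitive_congr; [apply: dvdz_trans xy1|apply: dvdz_trans xy2];
    by rewrite PoszM dvdz_mulr.
  exact: dvdz_sq2_congr.
have pqE : (p * q)%N%:Z = p%:Z ^+ 2 * (p ^ m)%N%:Z.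
  by rewrite /q expnS !PoszM; ring.
rewrite {1}/sumZ2 (bigD1 (Ordinal p0, Ordinal p0))//= big1 ?addr0; last first.
  move=> [a b] ab; rewrite /sumZ2 big1// => u _.
  rewrite (_ : imprimitive _ = imprimitive (vec2 (a, b))); last first.
    by apply: imprimitive_congr; rewrite /= addrAC subrr add0r dvdz_mulr.
  rewrite (_ : imprimitive _ = false)//.
  apply/negbTE; apply: contraNN ab => /andP[/=]; rewrite !dvdzE/= => pa pb.
  by rewrite xpair_eqE -!val_eqE/=; apply/andP; split;
    rewrite -leqn0 leqNgt; apply/negP => gt0;
    [have := dvdn_leq gt0 pa|have := dvdn_leq gt0 pb]; rewrite leqNgt ltn_ord.
have sqE a b : sq2 (0 + p%:Z * a, 0 + p%:Z * b) = p%:Z ^+ 2 * sq2 (a, b).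
  by rewrite /sq2/=; ring.
have impE a b : imprimitive (0 + p%:Z * a, 0 + p%:Z * b).
  by rewrite /imprimitive/= !add0r !dvdz_mulr.
case: ifPn => [/dvdzP[B AE]|nA]; last first.
  rewrite /sumZ2 big1// => u _; rewrite impE sqE (_ : (_ %| _)%Z = false)//.
  apply/negbTE; apply: contraNN nA => h.
  have : (p%:Z ^+ 2 %| (p * q)%N%:Z)%Z by rewrite pqE dvdz_mulr.
  move=> /dvdz_trans/(_ h) h2.
  have := dvdzB (dvdz_mulr (sq2 (vec2 u)) (dvdzz (p%:Z ^+ 2))) h2.
  by congr (_ %| _)%Z; ring.
rewrite AE mulzK// /circle_count.
have := @sumZ2_refine R (p ^ m) p (fun z => ((p ^ m)%N%:Z %| sq2 z - B)%Z%:R).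
rewrite -expnSr -/q expn_gt0 p0 => /(_ isT isT (@periodic2_circle _ _)).
rewrite -natrX mulr_natl => <-; apply: eq_bigr => u _.
rewrite impE sqE pqE (_ : _ - _ = p%:Z ^+ 2 * (sq2 (vec2 u) - B)); last by ring.
by rewrite dvdz_mul2l.
Qed.

(** The divisor p^m is the average of the count over all A modulo p^m. *)
Definition circle_ratio m A : R := circle_count (p ^ m) A / p%:R ^+ m.

Let ratio0 A : circle_ratio 0 A = 1.
Proof.
rewrite /circle_ratio /circle_count expn0 divr1 /sumZ2.
rewrite (eq_bigr (fun=> 1)) ?sumr_const ?card_prod ?card_ord//.
by move=> z _; rewrite dvdzE dvd1n.
Qed.

Let ratio1 A : circle_ratio 1 A = (prim_count 1 A + (p%:Z %| A)%Z%:R) / p%:R.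
Proof. by rewrite /circle_ratio count_split imprim1 expr1. Qed.

(* Solutions prime to p are lifted by Hensel's lemma; the other ones are p times
   the solutions for A / p^2. *)
Let ratioSS m A : circle_ratio m.+2 A = prim_count 1 A / p%:R +
  if (p%:Z ^+ 2 %| A)%Z then circle_ratio m (A %/ p%:Z ^+ 2)%Z else 0.
Proof.
rewrite /circle_ratio count_split primE imprimSS !exprS expr0 !mulr1.
have qn0 : p%:R ^+ m != 0 :> R by rewrite expf_neq0.
rewrite mulrDl; congr (_ + _); first by field; rewrite pn0.
by case: ifP => _; rewrite ?mul0r//; field; rewrite pn0 qn0.
Qed.

(** A local form of the divisor sum of chi that counts representations by two squares; the cut at N
    loses nothing when p^N does not divide A. *)
Definition circle_series N A : R :=
  (1 - chi / p%:R) * \sum_(a < N) (p%:Z ^+ a %| A)%Z%:R * chi ^+ a.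

Let chi2 : chi ^+ 2 = 1 := chi4_sqr1.

Let pred_p : (p.-1)%:R = p%:R - 1 :> R.
Proof. by rewrite -{2}(prednK p0) -natr1 addrK. Qed.

(** The induction descends by two in m and replaces A by A / p^2. Since chi^2 = 1, the terms a >= 2
    of the series form the series of A / p^2, and the terms a = 0, 1 account for the primitive
    solutions. *)
Lemma circle_ratioE N m A : (N <= m)%N -> ~~ (p%:Z ^+ N %| A)%Z ->
  circle_ratio m A = circle_series N A.
Proof.
have series_pn N' A' : (0 < N')%N -> ~~ (p%:Z %| A')%Z ->
    circle_series N' A' = 1 - chi / p%:R.
  case: N' => // N' _ pA; rewrite /circle_series big_ord_recl /= expr0 dvdzE dvd1n mulr1.
  rewrite big1 ?addr0 ?mulr1// => a _.
  rewrite (_ : (_ %| _)%Z = false) ?mul0r//; apply/negbTE; apply: contraNN pA.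
  by apply: dvdz_trans; rewrite exprS dvdz_mulr.
elim/ltn_ind: m N A => -[|[|m]] IH N A Nm pNA.
- by move: Nm pNA; rewrite leqn0 => /eqP->; rewrite expr0 dvdzE dvd1n.
- case: N Nm pNA => [|[|//]] _; first by rewrite expr0 dvdzE dvd1n.
  rewrite expr1 => pA; rewrite series_pn// ratio1 prim1 (negbTE pA) addr0.
  by field.
case: N Nm pNA => [|N] Nm; first by rewrite expr0 dvdzE dvd1n.
move=> pNA; rewrite ratioSS prim1.
have [pA|pA] := boolP (p%:Z %| A)%Z; last first.
  rewrite series_pn// (_ : (_ %| _)%Z = false) ?addr0; first by field.
  by apply/negbTE; apply: contraNN pA; apply: dvdz_trans; rewrite expr2 dvdz_mulr.
case: N Nm pNA => [|N] Nm pNA; first by rewrite expr1 pA in pNA.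
(* The difference of the two sides is (chi^2 - 1) / p. *)
have chi1 : (1 + chi) * (p.-1)%:R / p%:R = (1 - chi / p%:R) * (1 + chi).
  apply/eqP; rewrite -subr_eq0 pred_p; apply/eqP.
  rewrite (_ : _ - _ = (chi ^+ 2 - 1) / p%:R); last by field.
  by rewrite chi2 subrr mul0r.
have dA0 : (p%:Z ^+ 0 %| A)%Z by rewrite dvdzE dvd1n.
have dA1 : (p%:Z ^+ 1 %| A)%Z by rewrite expr1.
rewrite chi1 /circle_series !big_ord_recl /bump /= dA0 dA1 !mul1r expr1 expr0 addrA !mulrDr.
congr (_ + _).
case: ifPn => [/dvdzP[B AE]|p2A]; last first.
  rewrite big1 ?mulr0// => a _; rewrite (_ : (_ %| _)%Z = false) ?mul0r//.
  apply/negbTE; apply: contraNN p2A; apply: dvdz_trans.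
  by apply: dvdz_exp2l; rewrite /bump !leq0n !add1n.
have pz0 : p%:Z ^+ 2 != 0 by rewrite expf_neq0// eqz_nat -lt0n.
rewrite AE mulzK// (IH m _ N)//.
  rewrite /circle_series; congr (_ * _); apply: eq_bigr => a _.
  rewrite /bump !leq0n !add1n -(addn2 a) !exprD chi2 mulr1; congr (_%:R * _).
  by rewrite dvdz_mul2r.
by move: pNA; rewrite AE -(addn2 N) exprD dvdz_mul2r.
Qed.

Let chi_norm : `|chi| = 1.
Proof.
by apply/eqP; rewrite -(@eqrXn2 _ 2)// -normrX chi2 normr1 expr1n.
Qed.

Lemma circle_ratio_ge0 m A : 0 <= circle_ratio m A.
Proof. by rewrite divr_ge0 ?circle_count_ge0 ?exprn_ge0 ?ler0n. Qed.

(* The base 5/4 is chosen so that (5/4)^4 < 3 <= p: the product of four such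
   bounds is then o(p^n). *)
Lemma circle_ratio_le m A : circle_ratio m A <= 4 * (5 / 4) ^+ m.
Proof.
have p3 : 3 <= p%:R :> R by rewrite (ler_nat _ 3).
have prim_le A' : prim_count 1 A' / p%:R <= 2.
  have : -1 <= chi <= 1 by rewrite -ler_norml chi_norm.
  move=> /andP[c1 c2]; rewrite ler_pdivrMr ?ltr0n// prim1 pred_p.
  by case: ifP => _; nra.
elim/ltn_ind: m A => -[|[|m]] IH A.
- by rewrite ratio0; lra.
- rewrite ratio1 mulrDl.
  have : (p%:Z %| A)%Z%:R / p%:R <= 1 :> R.
    rewrite ler_pdivrMr ?ltr0n// mul1r (@le_trans _ _ 1)//; last by lra.
    by case: (_ %| _)%Z.
  by have := prim_le A; lra.
have b0 : 1 <= (5 / 4) ^+ m :> R by rewrite exprn_ege1//; lra.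
rewrite ratioSS !(exprS (5 / 4)); have := prim_le A.
case: ifP => _; last by nra.
by have := IH m (leqW (ltnSn _)) (A %/ p%:Z ^+ 2)%Z; nra.
Qed.

(** The series grows at most linearly in N; the base 5/4 is that of [circle_ratio_le], so that both
    enter one error estimate. *)
Lemma circle_series_norm_le N A : `|circle_series N A| <= 8 * (5 / 4) ^+ N.
Proof.
have p3 : 3 <= p%:R :> R by rewrite (ler_nat _ 3).
have N_le : N%:R <= 4 * (5 / 4) ^+ N :> R.
  elim: N => [|N IH]; first by rewrite mulr1; lra.
  have b0 : 1 <= (5 / 4) ^+ N :> R by rewrite exprn_ege1//; lra.
  by rewrite exprS -natr1; nra.
rewrite normrM (_ : 8 * _ = 2 * (4 * (5 / 4) ^+ N)); last by ring.
apply: ler_pM => //.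
  apply: (le_trans (ler_normB _ _)); rewrite normrM chi_norm normr1 mul1r normfV.
  have : p%:R^-1 <= 1 :> R by rewrite invf_le1 ?ltr0n//; lra.
  by rewrite gtr0_norm ?ltr0n//; lra.
apply: le_trans N_le; apply: (le_trans (ler_norm_sum _ _ _)).
rewrite -[X in _ <= X%:R]card_ord -sumr_const; apply: ler_sum => a _.
by rewrite normrM normrX chi_norm expr1n mulr1; case: (_ %| _)%Z; rewrite ?normr1 ?normr0.
Qed.

End odd_prime.
End sums_of_two_squares.

(** * Sums of two squares modulo powers of 2 *)

Section two_squares_dyadic.
Variable (R : realFieldType).

(** For even q, an integer known modulo q has its square known modulo 2 q. This extra bit makes up
    for the even derivative of the square in Hensel's lemma. *)
Lemma periodic2_circle_double (q : nat) (A : int) : (2 %| q)%N ->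
  periodic2 q (fun z => ((q * 2)%N%:Z %| sq2 z - A)%Z%:R : R).
Proof.
move=> q2 x y xy1 xy2; congr (_%:R); congr nat_of_bool; apply: dvdz_sub_congr.
have sqr_congr (a b : int) : (q%:Z %| a - b)%Z -> ((q * 2)%N%:Z %| a ^+ 2 - b ^+ 2)%Z.
  move=> qab; rewrite subr_sqr PoszM; apply: dvdz_mul => //.
  rewrite (_ : a + b = (a - b) + 2 * b); last by ring.
  by rewrite rpredD ?dvdz_mulr//; apply: dvdz_trans qab.
rewrite (_ : _ - _ = (x.1 ^+ 2 - y.1 ^+ 2) + (x.2 ^+ 2 - y.2 ^+ 2)).
  by rewrite rpredD// sqr_congr.
by rewrite /sq2; ring.
Qed.

(** Pairs modulo 2^m are tested modulo 2^(m+1), which is meaningful for m >= 1 by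
    [periodic2_circle_double]. *)
Let T (m : nat) (A : int) : R :=
  sumZ2 (2 ^ m) (fun z => ((2 ^ m * 2)%N%:Z %| sq2 z - A)%Z%:R).

(** As 4 | q, passing from w to w + q u changes s^2 + t^2 by 2 q (w_1 u_1 + w_2 u_2) modulo 4 q. For
    odd A one of w_1, w_2 is odd, so 2 of the 4 lifts survive. *)
Let TS m A : (2 <= m)%N -> ~~ (2 %| A)%Z -> T m.+1 A = 2 * T m A.
Proof.
move=> m2 oA; set q := (2 ^ m)%N; have q0 : (0 < q)%N by rewrite expn_gt0.
have q4 : (4 %| q)%N by rewrite /q -(subnKC m2) expnD dvdn_mulr.
have q2 : (2 %| q)%N by apply: dvdn_trans q4.
rewrite /T expnSr -/q sumZ2_split//; last first.
  by apply: periodic2_circle_double; rewrite dvdn_mull.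
rewrite {1 3}/sumZ2 big_distrr; apply: eq_bigr => w _ /=.
have sqE a b : sq2 ((val w.1)%:Z + q%:Z * a, (val w.2)%:Z + q%:Z * b) - A =
    (sq2 (vec2 w) - A) +
    (q * 2)%N%:Z * ((val w.1)%:Z * a + (val w.2)%:Z * b) + q%:Z * q%:Z * sq2 (a, b).
  by rewrite PoszM /sq2/=; ring.
have qq : ((q * 2 * 2)%N%:Z %| q%:Z * q%:Z)%Z.
  by rewrite -PoszM dvdzE/= -mulnA dvdn_mul.
have [/dvdzP[c cE]|nq] := boolP ((q * 2)%N%:Z %| sq2 (vec2 w) - A)%Z; last first.
  rewrite mulr0 /sumZ2 big1// => u _; rewrite sqE.
  rewrite (_ : (_ %| _)%Z = false)//; apply/negbTE; apply: contraNN nq => h.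
  have : ((q * 2)%N%:Z %| (q * 2 * 2)%N%:Z)%Z.
    by rewrite [in X in (_ %| X)%Z]PoszM dvdz_mulr.
  move=> d1; have := dvdz_trans d1 h; rewrite (dvdz_sub_congr (b := sq2 (vec2 w) - A))//.
  rewrite -[X in X - _]addrA addrAC subrr add0r; apply: rpredD.
    exact: dvdz_mulr (dvdzz _).
  by apply: dvdz_mulr; exact: dvdz_trans d1 qq.
rewrite mulr1.
have lin : ~~ ((2 %| (val w.1)%:Z)%Z && (2 %| (val w.2)%:Z)%Z).
  apply: contraNN oA => /andP[w1 w2].
  rewrite (_ : A = sq2 (vec2 w) - c * (q * 2)%N%:Z); last by rewrite -cE; ring.
  by rewrite PoszM mulrA dvdzB ?dvdz_mull// /sq2 rpredD// dvdz_exp.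
rewrite -[RHS](sumZ2_dvd_linear R c (isT : prime 2) lin); apply: eq_bigr => u _.
rewrite sqE cE; congr (_%:R); congr nat_of_bool => /=.
rewrite (dvdz_sub_congr (b := (q * 2)%N%:Z *
  (c + (val w.1)%:Z * (val u.1)%:Z + (val w.2)%:Z * (val u.2)%:Z))).
  by rewrite (PoszM (q * 2)) dvdz_mul2l// eqz_nat -lt0n muln_gt0 q0.
rewrite (_ : _ - _ = q%:Z * q%:Z * sq2 ((val u.1)%:Z, (val u.2)%:Z)); last by ring.
by rewrite dvdz_mulr.
Qed.

(** The 16 pairs modulo 4 are checked for each odd residue of A modulo 8. *)
Let T2 A : ~~ (2 %| A)%Z -> T 2 A = if (A == 1 %[mod 4])%Z then 4 else 0.
Proof.
move=> oA; have [r [r8 Ar]] : exists r, (r \in [:: 1%N; 3; 5; 7]) /\ (8 %| A - r%:Z)%Z.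
  have A8 : (8 %| A - (A %% 8)%Z)%Z by rewrite -eqz_mod_dvd modz_mod.
  have := ltz_pmod A (isT : 0 < 8 :> int); have := modz_ge0 A (isT : 8 != 0 :> int).
  case: (A %% 8)%Z A8 => // r A8 _ r8; exists r; split=> //.
  have : ~~ (2 %| r)%N.
    apply: contraNN oA => r2; rewrite (_ : A = (A - r%:Z) + r%:Z); last by ring.
    by rewrite rpredD//; apply: dvdz_trans A8.
  by move: r8; rewrite ltz_nat; do 8 case: r A8 => [|r] A8 //=.
have -> : (A == 1 %[mod 4])%Z = (r == 1 %[mod 4])%N.
  rewrite eqz_mod_dvd (dvdz_sub_congr (b := r%:Z - 1)); last first.
    by rewrite opprB addrA subrK; apply: dvdz_trans Ar.
  by rewrite -eqz_mod_dvd !modz_nat.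
rewrite /T (_ : sumZ2 _ _ = \sum_(a < 4) \sum_(b < 4)
    ((8 %| sq2 ((val a)%:Z, (val b)%:Z) - r%:Z)%Z%:R)); last first.
  rewrite pair_bigA; apply: eq_bigr => z _; congr (_%:R); congr nat_of_bool.
  apply: dvdz_sub_congr; rewrite (_ : _ - _ = - (A - r%:Z)) ?rpredN//.
  by rewrite /vec2/=; ring.
rewrite !big_ord_recr !big_ord0 /=.
by move: r8; rewrite !inE => /or4P[]/eqP-> /=; ring.
Qed.

Let TE m A : (2 <= m)%N -> ~~ (2 %| A)%Z ->
  T m A = if (A == 1 %[mod 4])%Z then 2 ^+ m else 0.
Proof.
move=> m2 oA; rewrite -(subnKC m2); elim: (m - 2)%N => [|k IH].
  by rewrite addn0 T2//; case: ifP => _; ring.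
rewrite addnS TS// ?IH ?leq_addr//; case: ifP => _; rewrite ?mulr0//.
Qed.

Lemma circle_count2_odd n A : (3 <= n)%N -> ~~ (2 %| A)%Z ->
  circle_count R (2 ^ n) A = if (A == 1 %[mod 4])%Z then 2 ^+ n.+1 else 0.
Proof.
case: n => // n n3 oA; rewrite /circle_count expnSr sumZ2_refine//; last first.
- apply: periodic2_circle_double; rewrite -(subnKC (_ : 1 <= n)%N)//; last by lia.
  by rewrite expnS dvdn_mulr.
- by rewrite expn_gt0.
rewrite -/(T n A) TE//; case: ifP => _; rewrite ?mul0rn// !exprS -mulr_natl; ring.
Qed.

(** The Gaussian integers of even norm are the multiples of 1 + i, whose norm is 2. *)
Lemma circle_count2_double m B :
  circle_count R (2 ^ m.+1) (2 * B) = 2 * circle_count R (2 ^ m) B.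
Proof.
rewrite /circle_count; set q := (2 ^ m)%N; have q0 : (0 < q)%N by rewrite expn_gt0.
rewrite expnS -/q.
(* Modulo 2q, each (s, t) is (u + v + e, u - v) with e = 0 or 1, and only e = 0
   gives an even s^2 + t^2, namely 2 (u^2 + v^2). *)
pose phi (t : ('I_q * 'I_q) * ('I_2 * 'I_2)) : int * int :=
  (let u := (val t.1.1)%:Z + q%:Z * (val t.2.1)%:Z in let v := (val t.1.2)%:Z in
   (u + v + (val t.2.2)%:Z, u - v)).
rewrite -(sum_residues2 (phi := phi)); last first.
- move=> [[u v] [a e]] [[u' v'] [a' e']]; rewrite /phi/= => h1 h2.
  have ee : e = e'.
    apply: ord_congr_eq.
    have d2 : (2%:Z %| (2 * q)%N%:Z)%Z by rewrite PoszM dvdz_mulr.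
    have := dvdzB (dvdz_trans d2 (rpredD h1 h2))
      (dvdz_mulr (u%:Z + q%:Z * a%:Z - u'%:Z - q%:Z * a'%:Z) (dvdzz 2)).
    by congr (_ %| _)%Z; ring.
  have vv : v = v'.
    apply: ord_congr_eq.
    have := dvdzB h1 h2; rewrite ee (_ : _ - _ = 2 * (v%:Z - v'%:Z)); last by ring.
    by rewrite PoszM dvdz_mul2l.
  move: h2; rewrite vv.
  rewrite (_ : _ - _ = (u%:Z + q%:Z * a%:Z) - (u'%:Z + q%:Z * a'%:Z)); last by ring.
  rewrite PoszM => h2.
  have uu : u = u'.
    apply: ord_congr_eq.
    have := dvdzB (dvdz_trans (dvdz_mull 2 (dvdzz q)) h2)
      (dvdz_mulr (a%:Z - a'%:Z) (dvdzz q)).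
    by congr (_ %| _)%Z; ring.
  move: h2; rewrite uu (_ : _ - _ = (a%:Z - a'%:Z) * q%:Z); last by ring.
  rewrite dvdz_mul2r ?eqz_nat -?lt0n// => /ord_congr_eq aa.
  by rewrite ee aa.
- exact: periodic2_circle.
- by rewrite !card_prod !card_ord; ring.
- by rewrite muln_gt0 q0.
rewrite -(pair_bigA _ (fun u ae => ((2 * q)%N%:Z %| sq2 (phi (u, ae)) - 2 * B)%Z%:R)) /=.
rewrite /sumZ2 big_distrr; apply: eq_bigr => -[u v] _.
rewrite -(pair_bigA _ (fun a e =>
  ((2 * q)%N%:Z %| sq2 (phi ((u, v), (a, e))) - 2 * B)%Z%:R)) /=.
have d0 (a : 'I_2) : ((2 * q)%N%:Z %| sq2 (phi ((u, v), (a, 0%R))) - 2 * B)%Z =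
    (q%:Z %| sq2 (vec2 (u, v)) - B)%Z.
  rewrite (_ : sq2 _ - _ =
    2 * (sq2 (u%:Z + q%:Z * a%:Z, v%:Z) - B)); last by rewrite /phi /sq2/=; ring.
  rewrite PoszM dvdz_mul2l//; apply: dvdz_sq2_congr => /=.
    by rewrite addrAC subrr add0r dvdz_mulr.
  by rewrite subrr dvdz0.
have d1 (a : 'I_2) : ((2 * q)%N%:Z %| sq2 (phi ((u, v), (a, 1%R))) - 2 * B)%Z = false.
  rewrite (_ : phi _ = (u%:Z + q%:Z * a%:Z + v%:Z + 1, u%:Z + q%:Z * a%:Z - v%:Z))//.
  apply/negbTE/negP => h.
  have d2 : (2%:Z %| (2 * q)%N%:Z)%Z by rewrite PoszM dvdz_mulr.
  have := dvdzB (dvdz_trans d2 h) (dvdz_mulr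
    ((u%:Z + q%:Z * a%:Z) ^+ 2 + v%:Z ^+ 2 + (u%:Z + q%:Z * a%:Z) + v%:Z - B) (dvdzz 2)).
  by rewrite (_ : _ - _ = 1)//; rewrite /sq2/=; ring.
rewrite (eq_bigr (fun=> (q%:Z %| sq2 (vec2 (u, v)) - B)%Z%:R)); last first.
  move=> a _; rewrite big_ord_recl big_ord1 d0 (_ : lift _ _ = 1) ?d1 ?addr0//.
  exact: val_inj.
by rewrite sumr_const card_ord mulr_natl.
Qed.

(** Needed also where A is highly divisible by 2. Halving A leads either to an odd number or down to
    n = 3, where the trivial bound 64 = 8 * 2^3 explains the constant. *)
Lemma circle_count2_le n A : (3 <= n)%N -> circle_count R (2 ^ n) A <= 8 * 2 ^+ n.
Proof.
move=> n3; rewrite -(subnKC n3); elim: (n - 3)%N A => [|k IH] A.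
  apply: (@le_trans _ _ (\sum_(z : 'I_8 * 'I_8) 1)).
    by apply: ler_sum => z _; case: (_ %| _)%Z.
  by rewrite sumr_const card_prod !card_ord addn0 -natrX -natrM ler_nat.
have [/dvdzP[B ->]|oA] := boolP (2 %| A)%Z.
  by rewrite addnS mulrC circle_count2_double exprS; have := IH B; lra.
rewrite circle_count2_odd ?leq_addr//; case: ifP => _; last first.
  by rewrite mulr_ge0// exprn_ge0.
by rewrite exprS ler_wpM2r ?exprn_ge0//; lra.
Qed.

Lemma Eset_double n B : Eset n.+1 (2 * B) <-> Eset n B.
Proof.
have two0 : 2 != 0 :> int by [].
split=> [[[|nu] [m [m1 e]]]|[nu [m [m1 e]]]].
- case: n e => [|n] e; first by exists 0%N, 1; rewrite !modz1.
  have h : (2 ^+ n.+2 %| 2 * B - m)%Z by rewrite -eqz_mod_dvd e expr0 mul1r.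
  have := dvdzB (dvdz_mulr B (dvdzz 2)) (dvdz_trans (dvdz_exp2l 2 (isT : 1 <= n.+2)%N) h).
  rewrite (_ : _ - _ = m); last by ring.
  have : (4 %| m - 1)%Z by rewrite -eqz_mod_dvd m1.
  move=> m4 m2; have := dvdzB m2 (dvdz_trans (isT : (2 %| 4)%Z) m4).
  by rewrite (_ : _ - _ = 1)//; ring.
- exists nu, m; split=> //; apply/eqP; rewrite eqz_mod_dvd.
  have : (2 ^+ n.+1 %| 2 * B - 2 ^+ nu.+1 * m)%Z by rewrite -eqz_mod_dvd e.
  by rewrite !exprS -mulrA -mulrBr dvdz_mul2l.
- exists nu.+1, m; split=> //; apply/eqP; rewrite eqz_mod_dvd !exprS -mulrA -mulrBr.
  by rewrite dvdz_mul2l// -eqz_mod_dvd e.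
Qed.

Lemma Eset_odd n A : (2 <= n)%N -> ~~ (2 %| A)%Z -> Eset n A <-> (A = 1 %[mod 4])%Z.
Proof.
move=> n2 oA; have four : (4 %| 2 ^+ n)%Z by apply: (dvdz_exp2l 2 n2).
split=> [[[|nu] [m [m1 e]]]|A1]; last by exists 0%N, A; rewrite expr0 mul1r.
  apply/eqP; rewrite -m1 eqz_mod_dvd; apply: dvdz_trans four _.
  by rewrite -eqz_mod_dvd e expr0 mul1r.
have h : (2 ^+ n %| A - 2 ^+ nu.+1 * m)%Z by rewrite -eqz_mod_dvd e.
case/negP: oA; have d2 := dvdz_trans (isT : (2 %| 4)%Z) (dvdz_trans four h).
rewrite (_ : A = (A - 2 ^+ nu.+1 * m) + 2 * (2 ^+ nu * m)); last by rewrite exprS; ring.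
by rewrite rpredD// dvdz_mulr.
Qed.

(** Factors 2 are removed by [circle_count2_double] and [Eset_double] in parallel. As 2^(n-2) does
    not divide A, the odd part is reached at a modulus of at least 8, where [circle_count2_odd]
    applies. *)
Lemma circle_count2E n A : (3 <= n)%N -> ~~ (2 ^+ (n - 2) %| A)%Z ->
  circle_count R (2 ^ n) A = 2 ^+ n.+1 * `[< Eset n A >]%:R.
Proof.
move=> n3; rewrite -(subnKC n3); elim: (n - 3)%N A => [|k IH] A.
  rewrite addn0 expr1 => oA; rewrite circle_count2_odd//; case: eqP => A1.
    by rewrite asboolT ?mulr1//; apply/Eset_odd.
  by rewrite asboolF ?mulr0// => /(Eset_odd (isT : (2 <= 3)%N) oA).
move=> dA; have [/dvdzP[B AE]|oA] := boolP (2 %| A)%Z.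
  rewrite AE mulrC addnS circle_count2_double IH; last first.
    by apply: contraNN dA => h; rewrite AE mulrC addnS subSn// exprS dvdz_mul2l.
  by rewrite mulrA -exprS (asbool_equiv_eq (Eset_double _ _)).
have n2 : (2 <= 3 + k.+1)%N by [].
rewrite circle_count2_odd//; case: eqP => A1.
  by rewrite asboolT ?mulr1//; apply/Eset_odd.
by rewrite asboolF ?mulr0// => /(Eset_odd n2 oA).
Qed.

End two_squares_dyadic.

(** * Fourfold series and Euler products *)

Section infinite_products.
Variable (R : realType).
Implicit Types (u : nat -> R).

Lemma cvgn_sum_norm_bounded u (B : R) :
  (forall N, \sum_(n < N) `|u n| <= B) -> cvgn (fun N => \sum_(n < N) u n).
Proof.
move=> uB.
have -> : (fun N => \sum_(n < N) u n) = series u.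
  by apply/funext => N; rewrite /series/= big_mkord.
apply: normed_cvg; apply: nondecreasing_is_cvgn.
  by apply: nondecreasing_series => n _ _; rewrite /= normr_ge0.
by exists B => _ [N _ <-]; rewrite /normed_series_of seriesEord; exact: uB.
Qed.

(** The partial products are bounded by exp B, so their increments are at most exp B times |u_n|;
    the product is then the sum of an absolutely convergent telescoping series. *)
Lemma cvgn_prod1D u (B : R) :
  (forall N, \sum_(n < N) `|u n| <= B) -> cvgn (fun N => \prod_(n < N) (1 + u n)).
Proof.
move=> uB; pose P N := \prod_(n < N) (1 + u n).
have PB N : `|P N| <= expR B.
  apply: (@le_trans _ _ (expR (\sum_(n < N) `|u n|))); last by rewrite ler_expR.
  rewrite expR_sum normr_prod; apply: ler_prod => n _; rewrite normr_ge0/=.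
  by apply: le_trans (expR_ge1Dx _); apply: (le_trans (ler_normD _ _)); rewrite normr1.
have : cvgn (fun N => \sum_(n < N) (P n.+1 - P n)).
  apply: (@cvgn_sum_norm_bounded (fun n => P n.+1 - P n) (expR B * B)) => N.
  apply: (@le_trans _ _ (\sum_(n < N) (expR B * `|u n|))).
    apply: ler_sum => n _; rewrite {1}/P big_ord_recr/= -/(P n).
    by rewrite mulrDr mulr1 addrAC subrr add0r normrM ler_wpM2r.
  by rewrite -mulr_sumr ler_wpM2l// expR_ge0.
move=> /cvg_ex[l Hl]; apply/cvg_ex; exists (l + 1).
rewrite -[X in X @ _]/P; have -> : P = (fun N => \sum_(n < N) (P n.+1 - P n) + 1).
  apply/funext => N; rewrite -(big_mkord xpredT (fun n => P n.+1 - P n)).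
  by rewrite telescope_sumr// {3}/P big_ord0 subrK.
by apply: cvgD => //; exact: cvg_cst.
Qed.

(** Beyond the first M terms the sum telescopes through 1/(a+1)^2 <= 1/a - 1/(a+1). *)
Lemma sum_norm_bounded_inv_sqr u (K : R) (N0 : nat) : 0 <= K ->
  (forall n, (N0 <= n)%N -> `|u n| <= K / n%:R ^+ 2) ->
  exists B : R, forall N, \sum_(n < N) `|u n| <= B.
Proof.
move=> K0 uK; pose M := N0.+2; pose S0 := \sum_(n < M) `|u n|.
have S_le N : \sum_(n < M + N) `|u n| <= S0 + K * ((N0.+1)%:R^-1 - (N0 + N).+1%:R^-1).
  elim: N => [|N IH]; first by rewrite !addn0 subrr mulr0 addr0.
  rewrite addnS big_ord_recr/=; set x := `|u _|.
  set a : R := (N0 + N).+1%:R in IH *.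
  have a0 : 0 < a by rewrite ltr0n.
  have -> : (N0 + N.+1).+1%:R = a + 1 :> R by rewrite /a natr1 addnS.
  have xK : x <= K * (a^-1 - (a + 1)^-1).
    apply: (@le_trans _ _ (K / (a + 1) ^+ 2)).
      rewrite (_ : a + 1 = (M + N)%:R); last by rewrite /a natr1 /M !addSn.
      by apply: uK; rewrite /M !addSn -addnS -addnS leq_addr.
    rewrite ler_wpM2l// (_ : a^-1 - _ = (a * (a + 1))^-1); last by field; lra.
    by rewrite lef_pV2 ?posrE ?exprn_gt0 ?mulr_gt0//; nra.
  by apply: (le_trans (lerD IH xK)); rewrite -addrA -mulrDr addrA subrK.
exists (S0 + K) => N; apply: (@le_trans _ _ (\sum_(n < M + N) `|u n|)).
  by rewrite addnC big_split_ord/= lerDl sumr_ge0.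
apply: (le_trans (S_le N)); rewrite lerD2l -[leRHS]mulr1 ler_wpM2l//.
have h1 : N0.+1%:R^-1 <= 1 :> R by rewrite invf_le1// ler1n.
have h2 : 0 <= (N0 + N).+1%:R^-1 :> R by rewrite invr_ge0.
by rewrite lerBlDr (le_trans h1)// lerDl.
Qed.

End infinite_products.

(** * Fourfold sums along boxes *)

Section box_sums.
Variable (R : realType).
Notation nat4 := (nat * nat * nat * nat)%type.
Implicit Types (f g : nat4 -> R) (N : nat) (e : nat4).

Definition box_sum N f : R := \sum_(a < N) \sum_(b < N) \sum_(c < N) \sum_(d < N)
  f (val a, val b, val c, val d).

Definition esize (e : nat4) : nat := (e.1.1.1 + e.1.1.2 + e.1.2 + e.2)%N.

Lemma box_sumD N f g : box_sum N (fun e => f e + g e) = box_sum N f + box_sum N g.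
Proof.
rewrite /box_sum -big_split/=; apply: eq_bigr => a _.
rewrite -big_split/=; apply: eq_bigr => b _.
rewrite -big_split/=; apply: eq_bigr => c _.
by rewrite -big_split.
Qed.

Lemma box_sumZ N (x : R) f : box_sum N (fun e => x * f e) = x * box_sum N f.
Proof. by rewrite /box_sum; do !(rewrite mulr_sumr; apply: eq_bigr => ? _). Qed.

Lemma eq_box_sum N f g : (forall e, f e = g e) -> box_sum N f = box_sum N g.
Proof. by move=> fg; do !(apply: eq_bigr => ? _); exact: fg. Qed.

Lemma ler_box_sum N f g : (forall e, f e <= g e) -> box_sum N f <= box_sum N g.
Proof. by move=> fg; do !(apply: ler_sum => ? _); exact: fg. Qed.

Lemma ler_norm_box_sum N f : `|box_sum N f| <= box_sum N (fun e => `|f e|).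
Proof. by do !(apply: (le_trans (ler_norm_sum _ _ _)); apply: ler_sum => ? _). Qed.

Lemma box_sum_nondecreasing f : (forall e, 0 <= f e) ->
  nondecreasing_seq (fun N => box_sum N f).
Proof.
move=> f0.
have widen (F G : nat -> R) M N : (M <= N)%N -> (forall n, 0 <= G n) ->
    (forall n, F n <= G n) -> \sum_(n < M) F n <= \sum_(n < N) G n.
  move=> MN G0 FG; apply: (@le_trans _ _ (\sum_(n < M) G n)); first exact: ler_sum.
  by rewrite -(subnKC MN) big_split_ord/= lerDl sumr_ge0.
move=> M N MN; rewrite /box_sum.
apply: (widen (fun a => \sum_(b < M) \sum_(c < M) \sum_(d < M) f (a, val b, val c, val d))
  (fun a => \sum_(b < N) \sum_(c < N) \sum_(d < N) f (a, val b, val c, val d))) => // a.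
  by do !(apply: sumr_ge0 => ? _).
apply: (widen (fun b => \sum_(c < M) \sum_(d < M) f (a, b, val c, val d))
  (fun b => \sum_(c < N) \sum_(d < N) f (a, b, val c, val d))) => // b.
  by do !(apply: sumr_ge0 => ? _).
apply: (widen (fun c => \sum_(d < M) f (a, b, c, val d))
  (fun c => \sum_(d < N) f (a, b, c, val d))) => // c.
  by do !(apply: sumr_ge0 => ? _).
exact: (widen (fun d => f (a, b, c, d)) (fun d => f (a, b, c, d))).
Qed.

Lemma box_sum_geometric_le N (q : R) : 0 <= q < 1 ->
  box_sum N (fun e => q ^+ esize e) <= (1 - q)^-1 ^+ 4.
Proof.
move=> /andP[q0 q1].
have -> : box_sum N (fun e => q ^+ esize e) = (\sum_(n < N) q ^+ n) ^+ 4.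
  rewrite !exprS expr0 mulr1 /box_sum /esize mulr_suml; apply: eq_bigr => a _.
  rewrite mulr_suml mulr_sumr; apply: eq_bigr => b _.
  rewrite mulr_suml !mulr_sumr; apply: eq_bigr => c _.
  by rewrite !mulr_sumr; apply: eq_bigr => d _; rewrite /= !exprD !mulrA.
have sum_le : \sum_(n < N) q ^+ n <= (1 - q)^-1.
  have q10 : 0 < 1 - q by rewrite subr_gt0.
  rewrite -[leRHS]mul1r ler_pdivlMr// mulrC.
  rewrite (_ : (1 - q) * _ = 1 - q ^+ N); last first.
    by rewrite -(opprB q) mulNr -subrX1 opprB.
  by rewrite gerBl exprn_ge0.
by apply: lerXn2r; rewrite ?nnegrE// ?(le_trans _ sum_le)//;
  apply: sumr_ge0 => n _; rewrite exprn_ge0.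
Qed.

Section dominated.
Variables (f : nat4 -> R) (C q : R).
Hypotheses (q01 : 0 <= q < 1) (C0 : 0 <= C).
Hypothesis fC : forall e, `|f e| <= C * q ^+ esize e.

Let bound N : box_sum N (fun e => C * q ^+ esize e) <= C * (1 - q)^-1 ^+ 4.
Proof. by rewrite box_sumZ ler_wpM2l// box_sum_geometric_le. Qed.

(** The dominating term G and G - f are non-negative, so their box sums are monotone and bounded; f
    is the difference of the two. *)
Lemma box_sum_cvg : cvgn (fun N => box_sum N f).
Proof.
pose G e := C * q ^+ esize e.
have G0 e : 0 <= G e by case/andP: q01 => q0 _; rewrite mulr_ge0 ?exprn_ge0.
have Gf0 e : 0 <= G e - f e by rewrite subr_ge0 (le_trans (ler_norm _) (fC e)).
have cG : cvgn (fun N => box_sum N G).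
  apply: nondecreasing_is_cvgn; first exact: box_sum_nondecreasing.
  by exists (C * (1 - q)^-1 ^+ 4) => _ [N _ <-]; exact: bound.
have cGf : cvgn (fun N => box_sum N (fun e => G e - f e)).
  apply: nondecreasing_is_cvgn; first exact: box_sum_nondecreasing.
  exists (2 * (C * (1 - q)^-1 ^+ 4)) => _ [N _ <-].
  apply: (@le_trans _ _ (box_sum N (fun e => 2 * G e))).
    apply: ler_box_sum => e; have := fC e; rewrite -/(G e) ler_norml => /andP[].
    by lra.
  by rewrite box_sumZ ler_wpM2l//; exact: bound.
have -> : (fun N => box_sum N f) =
    (fun N => box_sum N G) - (fun N => box_sum N (fun e => G e - f e)).
  apply/funext => N; rewrite !fctE box_sumD.
  rewrite (_ : (fun e => - f e) = (fun e => -1 * f e)).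
    by rewrite (box_sumZ N (-1)); ring.
  by apply/funext => e; rewrite mulN1r.
exact: is_cvgB.
Qed.

(** Every finite set of exponents lies in some box, so the bound for boxes controls all finite
    partial sums. *)
Lemma box_summable : summable [set: nat4] (fun e => (f e)%:E).
Proof.
rewrite /summable; apply: (@le_lt_trans _ _ (C * (1 - q)^-1 ^+ 4)%:E); last exact: ltry.
apply: ge_ereal_sup => _ [A [finA _] <-].
rewrite fsbig_finite//=.
under eq_bigr do rewrite -abse_EFin.
rewrite sumEFin lee_fin; set s := fset_set A.
pose N := (\max_(e <- s) esize e).+1.
pose phi (t : 'I_N * 'I_N * 'I_N * 'I_N) : nat4 :=
  (val t.1.1.1, val t.1.1.2, val t.1.2, val t.2).
apply: le_trans (bound N).
have -> : box_sum N (fun e => C * q ^+ esize e) =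
    \sum_t C * q ^+ esize (phi t).
  by rewrite /box_sum !pair_bigA; apply: eq_bigr => -[[[a b] c] d].
have G0 e : 0 <= C * q ^+ esize e by case/andP: q01 => q0 _; rewrite mulr_ge0 ?exprn_ge0.
apply: (@le_trans _ _ (\sum_(e <- s) \sum_t (phi t == e)%:R * (C * q ^+ esize (phi t)))).
  rewrite big_seq [leRHS]big_seq; apply: ler_sum => e es.
  have eN : (esize e < N)%N by rewrite ltnS; apply: leq_bigmax_seq.
  have [t te] : exists t, phi t = e.
    case: e eN {es} => [[[a b] c] d]; rewrite /esize/= => eN.
    have aN : (a < N)%N by apply: leq_ltn_trans eN; lia.
    have bN : (b < N)%N by apply: leq_ltn_trans eN; lia.
    have cN : (c < N)%N by apply: leq_ltn_trans eN; lia.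
    have dN : (d < N)%N by apply: leq_ltn_trans eN; lia.
    by exists (Ordinal aN, Ordinal bN, Ordinal cN, Ordinal dN).
  rewrite (bigD1 t)//= te eqxx mul1r (le_trans (fC e))// lerDl.
  by apply: sumr_ge0 => t' _; rewrite mulr_ge0.
rewrite exchange_big/=; apply: ler_sum => t _.
rewrite -mulr_suml -[leRHS]mul1r ler_wpM2r//.
have [ts|ts] := boolP (phi t \in s).
  rewrite (big_rem _ ts)/= eqxx big_seq big1 ?addr0// => e.
  by rewrite mem_rem_uniq ?fset_uniq// inE eq_sym => /andP[/negbTE-> _].
by rewrite big_seq big1// => e es; case: eqP => // te; rewrite te es in ts.
Qed.

End dominated.

(** Isolates the one exponent of size 0 and the four of size 1, all contained in a box of side at
    least 2. Summing out one coordinate at a time produces binomial coefficients. *)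
Lemma box_sum_small N (m : nat -> R) : (forall n, (2 <= n)%N -> m n = 0) ->
  box_sum N.+2 (fun e => m (esize e)) = m 0%N + 4 * m 1%N.
Proof.
move=> m0.
have two (G : nat -> R) : (forall n, (2 <= n)%N -> G n = 0) ->
    \sum_(n < N.+2) G (val n) = G 0%N + G 1%N.
  move=> G0; rewrite !big_ord_recl/= big1 ?addr0// => i _.
  by apply: G0; rewrite /bump/= !add1n.
have D s : \sum_(d < N.+2) m (s + val d)%N = m s + m s.+1.
  by rewrite (two (fun d => m (s + d)%N)) ?addn0 ?addn1// => n n2; apply: m0; lia.
have CD s : \sum_(c < N.+2) \sum_(d < N.+2) m (s + val c + val d)%N =
    m s + 2 * m s.+1 + m s.+2.
  under eq_bigr do rewrite D.
  rewrite (two (fun c => m (s + c)%N + m (s + c).+1)) ?addn0 ?addn1; first by ring.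
  by move=> n n2; rewrite !m0 ?addr0//; lia.
have BCD s : \sum_(b < N.+2) \sum_(c < N.+2) \sum_(d < N.+2)
    m (s + val b + val c + val d)%N = m s + 3 * m s.+1 + 3 * m s.+2 + m s.+3.
  under eq_bigr do rewrite CD.
  rewrite (two (fun c => m (s + c)%N + 2 * m (s + c).+1 + m (s + c).+2)) ?addn0 ?addn1.
    by ring.
  by move=> n n2; rewrite !m0 ?addr0 ?mulr0 ?addr0//; lia.
rewrite /box_sum /esize.
under eq_bigr do rewrite BCD.
rewrite (two (fun s => m s + 3 * m s.+1 + 3 * m s.+2 + m s.+3)).
  by rewrite (m0 2)// (m0 3)// (m0 4)//; ring.
by move=> n n2; rewrite !m0 ?addr0 ?mulr0 ?addr0//; lia.
Qed.

End box_sums.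

(** * The factors sigma_p and the convergence of their product *)

Section local_factors.
Context (R : realType).
Variables (d D : 'I_4 -> nat) (L : 'M[int]_(4, 2)).
Hypotheses (d0 : forall i, (0 < d i)%N) (D0 : forall i, (0 < D i)%N).
Hypothesis (dD : forall i, (d i %| D i)%N).
Hypothesis (indep : forall i j, i != j -> minor2 L i j != 0).
Notation det h := (lattice_det (Gamma h L)).
Notation nat4 := (nat * nat * nat * nat)%type.
Implicit Types (p : nat) (e : nat4).

Definition expo e : 'I_4 -> nat := fun i => nth 0%N [:: e.1.1.1; e.1.1.2; e.1.2; e.2] i.

(* The exponent of p in [D_i, d_i p^(e_i)]. *)
Definition lcm_expo p e : 'I_4 -> nat :=
  fun i => maxn (valuations D p i) (valuations d p i + expo e i).

(** Away from p the least common multiple is that of D_i and d_i, hence D_i; only the exponent at p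
    changes. *)
Lemma lcm_p_split p e i : prime p ->
  lcmn (D i) (d i * p ^ expo e i) = ((D i)`_p^' * p ^ lcm_expo p e i)%N.
Proof.
move=> pp; have p0 := prime_gt0 pp.
have e0 : (0 < d i * p ^ expo e i)%N by rewrite muln_gt0 d0 expn_gt0 p0.
apply: eqn_from_log.
- by rewrite lcmn_gt0 D0.
- by rewrite muln_gt0 part_gt0 expn_gt0 p0.
move=> q; have [pq|npq] := boolP (prime q); last first.
  by rewrite [LHS]lognE [RHS]lognE (negbTE npq).
rewrite logn_lcm// !lognM// ?part_gt0// ?expn_gt0 ?p0// !lognX (logn_prime _ pp).
have := congr1 (logn q) (partnC p (D0 i)).
rewrite lognM ?part_gt0// p_part lognX (logn_prime _ pp).
have [->|qp] := eqVneq q p; last first.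
  rewrite !muln0 !addn0 add0n => ->.
  by apply/maxn_idPl; apply: dvdn_leq_log.
by rewrite !muln1 -{2}[logn p (D i)]addn0 => /addnI ->.
Qed.

Lemma D_p_split p i : prime p -> D i = ((D i)`_p^' * p ^ valuations D p i)%N.
Proof. by move=> pp; rewrite -p_part mulnC partnC. Qed.

Lemma coprime_p'part_prod p (f : 'I_4 -> nat) : prime p ->
  coprime (\prod_i (D i)`_p^') (\prod_i p ^ f i).
Proof.
move=> pp; apply: (big_ind (fun m => coprime m _)) => [|x y hx hy|i _].
- exact: coprime1n.
- by rewrite coprimeMl hx.
apply: (big_ind (fun m => coprime _ m)) => [|x y hx hy|k _].
- exact: coprimen1.
- by rewrite coprimeMr hx.
by apply: coprimeXr; rewrite coprime_sym prime_coprime// -p'natE// part_pnat.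
Qed.

Lemma det_p_split p e : prime p ->
  det (fun i => lcmn (D i) (d i * p ^ expo e i)) =
  (det (fun i => (D i)`_p^') * det (fun i => p ^ lcm_expo p e i))%N.
Proof.
move=> pp; have p0 := prime_gt0 pp.
apply: (@lattice_det_mul _ _ _ _ (\prod_i (D i)`_p^') (\prod_i p ^ lcm_expo p e i)).
- by apply: prodn_gt0 => i; rewrite part_gt0.
- by apply: prodn_gt0 => i; rewrite expn_gt0 p0.
- exact: coprime_p'part_prod.
- by move=> i; rewrite (bigD1 i)//= dvdn_mulr.
- by move=> i; rewrite (bigD1 i)//= dvdn_mulr.
- by move=> i; exact: lcm_p_split.
Qed.

Lemma det_D_split p : prime p ->
  det D = (det (fun i => (D i)`_p^') * det (fun i => p ^ valuations D p i))%N.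
Proof.
move=> pp; have p0 := prime_gt0 pp.
apply: (@lattice_det_mul _ _ _ _ (\prod_i (D i)`_p^') (\prod_i p ^ valuations D p i)).
- by apply: prodn_gt0 => i; rewrite part_gt0.
- by apply: prodn_gt0 => i; rewrite expn_gt0 p0.
- exact: coprime_p'part_prod.
- by move=> i; rewrite (bigD1 i)//= dvdn_mulr.
- by move=> i; rewrite (bigD1 i)//= dvdn_mulr.
- by move=> i; exact: D_p_split.
Qed.

Lemma det_gt0 (h : 'I_4 -> nat) : (forall i, (0 < h i)%N) -> (0 < det h)%N.
Proof.
move=> h0; apply: (@lattice_det_gt0 _ _ (\prod_i h i)).
  by apply: prodn_gt0 => i; exact: h0.
by move=> i; rewrite (bigD1 i)//= dvdn_mulr.
Qed.

(** The index belonging to the parts of the D_i prime to p occurs in numerator and denominator and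
    cancels. *)
Lemma rho0_expo p e : prime p -> rho0 R d D L (fun i => (p ^ expo e i)%N) =
  (det (fun i => p ^ lcm_expo p e i)%N)%:R / (det (fun i => p ^ valuations D p i)%N)%:R.
Proof.
move=> pp; have p0 := prime_gt0 pp.
rewrite /rho0 det_p_split// (det_D_split pp) !natrM.
have h1 : (det (fun i => (D i)`_p^')%N)%:R != 0 :> R.
  by rewrite pnatr_eq0 -lt0n det_gt0// => i; rewrite part_gt0.
have h2 : (det (fun i => (p ^ valuations D p i)%N))%:R != 0 :> R.
  by rewrite pnatr_eq0 -lt0n det_gt0// => i; rewrite expn_gt0 p0.
by field; rewrite h1 h2.
Qed.

Lemma sigma_termE p e : sigma_term R d D L p e =
  (chi4 p)%:~R ^+ esize e / rho0 R d D L (fun i => (p ^ expo e i)%N).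
Proof. by case: e => [[[a b] c] f]. Qed.

Lemma sigma_term_expo p e : prime p -> sigma_term R d D L p e =
  (chi4 p)%:~R ^+ esize e * (det (fun i => p ^ valuations D p i)%N)%:R /
  (det (fun i => p ^ lcm_expo p e i)%N)%:R.
Proof. by move=> pp; rewrite sigma_termE rho0_expo// invf_div mulrA. Qed.

Let C : R := (det D)%:R * (minors_bound L)%:R.

Let C_ge0 : 0 <= C. Proof. by rewrite mulr_ge0. Qed.

Lemma chi4_norm_le p : `|(chi4 p)%:~R : R| <= 1.
Proof.
rewrite /chi4; case: (p %% 4)%N => [|[|[|[|n]]]]; rewrite ?normr0 ?normr1//.
by rewrite mulrNz normrN normr1.
Qed.

(** With h_i = [D_i, d_i p^(e_i)], the power p^(e_i + e_j) divides h_i h_j, which [lattice_det_ge]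
    bounds by a constant times the index. *)
Lemma sigma_term_le p e i j : prime p -> i != j ->
  `|sigma_term R d D L p e| <= C / p%:R ^+ (expo e i + expo e j).
Proof.
move=> pp ij; have p0 := prime_gt0 pp.
have pn0 : 0 < p%:R :> R by rewrite ltr0n.
rewrite sigma_termE /rho0 invf_div normrM normrX.
set h := fun i => _.
have h_gt0 i' : (0 < h i')%N by rewrite /h lcmn_gt0 D0 muln_gt0 d0 expn_gt0 p0.
have detn0 : 0 < (det h)%:R :> R by rewrite ltr0n det_gt0.
have ge : p%:R ^+ (expo e i + expo e j) <= (det h)%:R * (minors_bound L)%:R :> R.
  rewrite -natrX -natrM ler_nat.
  apply: (@leq_trans (h i * h j)).
    rewrite expnD leq_mul// dvdn_leq//; apply: dvdn_trans (dvdn_lcmr _ _);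
    exact: dvdn_mull.
  apply: leq_trans (lattice_det_ge h_gt0 ij (indep ij)) _.
  by rewrite leq_mul2l leq_minors_bound orbT.
apply: (@le_trans _ _ (1 * `|(det D)%:R / (det h)%:R|)).
  by rewrite ler_wpM2r// exprn_ile1 ?chi4_norm_le.
rewrite mul1r ger0_norm ?divr_ge0// /C -mulrA ler_wpM2l//.
by rewrite ler_pdivlMr ?exprn_gt0// mulrC ler_pdivrMr// mulrC.
Qed.

(** The pair sought consists of the two largest of the four exponents. *)
Let pick_pair e : exists i j, [/\ i != j, (esize e <= 2 * (expo e i + expo e j))%N &
  (2 <= esize e)%N -> (2 <= expo e i + expo e j)%N].
Proof.
case: e => [[[a b] c] f]; rewrite /esize/=.
pose i0 : 'I_4 := 0; pose i1 : 'I_4 := inord 1.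
pose i2 : 'I_4 := inord 2; pose i3 : 'I_4 := inord 3.
have e0 : expo (a, b, c, f) i0 = a by [].
have e1 : expo (a, b, c, f) i1 = b by rewrite /expo /i1 inordK.
have e2 : expo (a, b, c, f) i2 = c by rewrite /expo /i2 inordK.
have e3 : expo (a, b, c, f) i3 = f by rewrite /expo /i3 inordK.
have i01 : i0 != i1 by rewrite -val_eqE /= inordK.
have i02 : i0 != i2 by rewrite -val_eqE /= inordK.
have i03 : i0 != i3 by rewrite -val_eqE /= inordK.
have i12 : i1 != i2 by rewrite -val_eqE /= !inordK.
have i13 : i1 != i3 by rewrite -val_eqE /= !inordK.
have i23 : i2 != i3 by rewrite -val_eqE /= !inordK.
pose ok x y := ((a + b + c + f <= 2 * (x + y))%N /\
  ((2 <= a + b + c + f)%N -> (2 <= x + y)%N)).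
have : ok a b \/ ok a c \/ ok a f \/ ok b c \/ ok b f \/ ok c f.
  by rewrite /ok; clear; lia.
case=> [[h1 h2]|[[h1 h2]|[[h1 h2]|[[h1 h2]|[[h1 h2]|[h1 h2]]]]]].
- by exists i0, i1; rewrite e0 e1.
- by exists i0, i2; rewrite e0 e2.
- by exists i0, i3; rewrite e0 e3.
- by exists i1, i2; rewrite e1 e2.
- by exists i1, i3; rewrite e1 e3.
- by exists i2, i3; rewrite e2 e3.
Qed.

(* 1 / p <= 1 / 3 <= (3 / 5)^2 *)
Let geom p (T S : nat) : (2 < p)%N -> (S <= 2 * T)%N ->
  (p%:R ^+ T)^-1 <= (3 / 5) ^+ S :> R.
Proof.
move=> p2 ST; have p3 : 3 <= p%:R :> R by rewrite (ler_nat _ 3).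
apply: (@le_trans _ _ ((3 / 5) ^+ (2 * T))); last by apply: ler_wiXn2l => //; lra.
have p0 : 0 < p%:R :> R by lra.
rewrite exprM -exprVn lerXn2r ?nnegrE ?invr_ge0 ?sqr_ge0//.
by rewrite -[leLHS]mul1r ler_pdivrMr//; nra.
Qed.

Lemma sigma_term_geometric p e : prime p -> (2 < p)%N ->
  `|sigma_term R d D L p e| <= C * (3 / 5) ^+ esize e.
Proof.
move=> pp p2; have [i [j [ij eT _]]] := pick_pair e.
by apply: (le_trans (sigma_term_le e pp ij)); apply: (ler_wpM2l C_ge0); exact: geom.
Qed.

(** With T = e_i + e_j >= 2, the factor p^-2 is kept and the rest is bounded by 3^-(T-2) = 9 * 3^-T.
    This is the origin of the 9, and the remaining decay is uniform in p. *)
Lemma sigma_term_tail p e : prime p -> (2 < p)%N -> (2 <= esize e)%N ->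
  `|sigma_term R d D L p e| <= 9 * C / p%:R ^+ 2 * (3 / 5) ^+ esize e.
Proof.
move=> pp p2 e2; have [i [j [ij eT /(_ e2) T2]]] := pick_pair e.
apply: (le_trans (sigma_term_le e pp ij)).
rewrite (_ : 9 * C / p%:R ^+ 2 * (3 / 5) ^+ esize e =
  C * (9 * ((p%:R ^+ 2)^-1 * (3 / 5) ^+ esize e))); last by ring.
apply: (ler_wpM2l C_ge0).
set T := (expo e i + expo e j)%N in eT T2 *.
have p3 : 3 <= p%:R :> R by rewrite (ler_nat _ 3).
have p0 : 0 < p%:R :> R by lra.
have [k Tk] : exists k, T = (2 + k)%N by exists (T - 2)%N; rewrite subnKC.
rewrite {1}Tk exprD invfM mulrCA ler_wpM2l ?invr_ge0 ?exprn_ge0 ?(ltW p0)//.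
have three : (3%:R ^+ T)^-1 <= (3 / 5) ^+ esize e :> R by apply: geom.
apply: (@le_trans _ _ (9 * (3%:R ^+ T)^-1)); last by rewrite ler_wpM2l.
rewrite Tk exprD invfM mulrA (_ : 9 * _ = 1) ?mul1r; last by field.
by rewrite lef_pV2 ?posrE ?exprn_gt0// lerXn2r ?nnegrE// ltW.
Qed.

Lemma sigma_summable p : prime p -> (2 < p)%N ->
  summable [set: nat * nat * nat * nat] (fun e => (sigma_term R d D L p e)%:E).
Proof.
move=> pp p2; apply: (@box_summable _ _ C (3 / 5)) => //; first by lra.
by move=> e; exact: sigma_term_geometric.
Qed.

Definition sigma_series p : R := limn (fun N => box_sum N (sigma_term R d D L p)).

Lemma sigma_seriesE p :
  sigma R d D L p = (1 - (chi4 p)%:~R / p%:R) ^+ 4 * sigma_series p.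
Proof. by []. Qed.

Lemma sigma_series_cvg p : prime p -> (2 < p)%N ->
  box_sum N (sigma_term R d D L p) @[N --> \oo] --> sigma_series p.
Proof.
move=> pp p2; apply: (@box_sum_cvg _ _ C (3 / 5)) => //; first by lra.
by move=> e; exact: sigma_term_geometric.
Qed.

(** At these primes the terms of size 0 and 1 are exactly 1 and chi(p)/p. *)
Definition good_prime p := (forall i, ~~ (p %| D i)%N) /\
  forall i, ~~ ((p%:Z %| L i 0%R)%Z && (p%:Z %| L i 1%R)%Z).

Let val0 p (h : 'I_4 -> nat) i : prime p -> ~~ (p %| h i)%N -> valuations h p i = 0%N.
Proof. by move=> pp ph; rewrite /valuations lognE pp (negbTE ph) andbF. Qed.

Lemma sigma_term_size0 p e : prime p -> good_prime p -> esize e = 0%N ->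
  sigma_term R d D L p e = 1.
Proof.
move=> pp [pD _] e0; rewrite sigma_term_expo// e0 mul1r.
have -> : (fun i => p ^ lcm_expo p e i)%N = (fun i => p ^ valuations D p i)%N.
  apply/funext => i; rewrite /lcm_expo val0// val0//; last first.
    by apply: contraNN (pD i) => /dvdn_trans; apply.
  case: e e0 => [[[a b] c] f]; rewrite /esize/= => e0.
  have [-> -> -> ->] : [/\ a = 0%N, b = 0%N, c = 0%N & f = 0%N] by split; lia.
  by case: i => -[|[|[|[|]]]].
rewrite divff// pnatr_eq0 -lt0n det_gt0// => i.
by rewrite expn_gt0 prime_gt0.
Qed.

Lemma sigma_term_size1 p e : prime p -> good_prime p -> esize e = 1%N ->
  sigma_term R d D L p e = (chi4 p)%:~R / p%:R.
Proof.
move=> pp [pD pL] e1; rewrite sigma_term_expo// e1 expr1.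
rewrite (_ : det (fun i => p ^ valuations D p i)%N = 1%N) ?mulr1; last first.
  by apply: lattice_det_one => i; rewrite val0.
have [i [ei e0]] : exists i, expo e i = 1%N /\ forall j, j != i -> expo e j = 0%N.
  case: e e1 => [[[a b] c] f]; rewrite /esize/= => e1.
  have : (a = 1 /\ b = 0 /\ c = 0 /\ f = 0) \/ (a = 0 /\ b = 1 /\ c = 0 /\ f = 0) \/
    (a = 0 /\ b = 0 /\ c = 1 /\ f = 0) \/ (a = 0 /\ b = 0 /\ c = 0 /\ f = 1)%N by lia.
  case=> [[-> [-> [-> ->]]]|[[-> [-> [-> ->]]]|[[-> [-> [-> ->]]]|[-> [-> [-> ->]]]]]].
  - by exists (inord 0); split=> [|[[|[|[|[|]]]] ?]]; rewrite -?val_eqE /expo/= ?inordK.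
  - by exists (inord 1); split=> [|[[|[|[|[|]]]] ?]]; rewrite -?val_eqE /expo/= ?inordK.
  - by exists (inord 2); split=> [|[[|[|[|[|]]]] ?]]; rewrite -?val_eqE /expo/= ?inordK.
  - by exists (inord 3); split=> [|[[|[|[|[|]]]] ?]]; rewrite -?val_eqE /expo/= ?inordK.
rewrite (@lattice_det_single _ _ i p)//.
  by rewrite /lcm_expo ei !val0 ?expn1//; apply: contraNN (pD i) => /dvdn_trans; apply.
move=> j ji; rewrite /lcm_expo e0// !val0//.
by apply: contraNN (pD j) => /dvdn_trans; apply.
Qed.

(** The 20 bounds the polynomial factor of y^2 in [sigma_near1] for |y| <= 1/3. The second summand
    is the tail bound 9 C (1 - 3/5)^-4 times 4, which exceeds (4/3)^4 >= (1 - y)^4. *)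
Let K : R := 20 + 36 * C * (5 / 2) ^+ 4.

Lemma sigma_near1 p : prime p -> (2 < p)%N -> good_prime p ->
  `|sigma R d D L p - 1| <= K / p%:R ^+ 2.
Proof.
move=> pp p2 gp; set y : R := (chi4 p)%:~R / p%:R.
have p3 : 3 <= p%:R :> R by rewrite (ler_nat _ 3).
have p0 : 0 < p%:R :> R by lra.
set z := p%:R^-1 in y *; have z0 : 0 < z by rewrite invr_gt0.
have z3 : z <= 1 / 3 by rewrite -[leLHS]mul1r ler_pdivrMr//; lra.
have yz : `|y| <= z by rewrite normrM (gtr0_norm z0) ler_piMl ?(ltW z0)// chi4_norm_le.
(* The terms of size 0 and 1 are subtracted; they sum to 1 + 4 y over the box. *)
pose tail e := sigma_term R d D L p e -
  (fun n => match n with 0%N => 1 | 1%N => y | _ => 0 end) (esize e).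
have tail_le e : `|tail e| <= 9 * C * z ^+ 2 * (3 / 5) ^+ esize e.
  rewrite /tail; case: (esize e) (@sigma_term_size0 p e) (@sigma_term_size1 p e)
    (@sigma_term_tail p e) => [|[|n]] s0 s1 s2.
  - by rewrite s0// subrr normr0 !mulr_ge0// ?exprn_ge0//; lra.
  - by rewrite s1// subrr normr0 !mulr_ge0// ?exprn_ge0//; lra.
  - by rewrite subr0 exprVn s2.
have boxE N : box_sum N.+2 (sigma_term R d D L p) = 1 + 4 * y + box_sum N.+2 tail.
  rewrite -(@box_sum_small _ N (fun n => match n with 0%N => 1 | 1%N => y | _ => 0 end)).
    by rewrite -box_sumD; apply: eq_box_sum => e; rewrite /tail addrC subrK.
  by move=> [|[|n]].
have box_le N : `|box_sum N.+2 (sigma_term R d D L p) - (1 + 4 * y)| <=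
    9 * C * z ^+ 2 * (5 / 2) ^+ 4.
  rewrite boxE addrAC subrr add0r; apply: (le_trans (ler_norm_box_sum _ _)).
  apply: (le_trans (ler_box_sum _ tail_le)); rewrite box_sumZ.
  rewrite ler_wpM2l ?mulr_ge0 ?exprn_ge0 ?(ltW z0)//.
  apply: (le_trans (box_sum_geometric_le _ _)); first by lra.
  by have -> : (1 - 3 / 5)^-1 = 5 / 2 :> R by field.
have S_le : `|sigma_series p - (1 + 4 * y)| <= 9 * C * z ^+ 2 * (5 / 2) ^+ 4.
  have cv : `|box_sum N.+2 (sigma_term R d D L p) - (1 + 4 * y)| @[N --> \oo] -->
      `|sigma_series p - (1 + 4 * y)|.
    apply: cvg_norm; apply: cvgB; last exact: cvg_cst.
    have := sigma_series_cvg pp p2.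
    rewrite -(cvg_shiftn 2) /= (_ : (fun n => _) =
      (fun N => box_sum N.+2 (sigma_term R d D L p)))//.
    by apply/funext => N; rewrite addn2.
  rewrite -(cvg_lim _ cv)//; apply: limr_le; first by apply/cvg_ex; eexists; exact: cv.
  by near=> N; exact: box_le.
rewrite sigma_seriesE -/y.
set t := sigma_series p - (1 + 4 * y) in S_le.
have -> : sigma_series p = 1 + 4 * y + t by rewrite /t; ring.
(* The product (1 - y)^4 (1 + 4 y) has no linear term in y, so every remaining term is O(p^-2). *)
rewrite (_ : (1 - y) ^+ 4 * _ - 1 =
  y ^+ 2 * (- 10 + 20 * y - 15 * y ^+ 2 + 4 * y ^+ 3) + (1 - y) ^+ 4 * t); last by ring.
have y1 : `|y| <= 1 / 3 by lra.
have y2 : y ^+ 2 <= z ^+ 2.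
  by rewrite -[y ^+ 2]real_normK ?num_real// lerXn2r ?nnegrE// ltW.
have [yl yu] : - (1 / 3) <= y /\ y <= 1 / 3 by apply/andP; rewrite -ler_norml.
have -> : K / p%:R ^+ 2 = 20 * z ^+ 2 + 4 * (9 * C * z ^+ 2 * (5 / 2) ^+ 4).
  by rewrite /K /z exprVn; ring.
apply: (le_trans (ler_normD _ _)); apply: lerD.
  rewrite normrM [ `|y ^+ 2| ]ger0_norm ?sqr_ge0// mulrC.
  apply: ler_pM; rewrite ?sqr_ge0 ?normr_ge0//.
  by rewrite ler_norml; apply/andP; split; nra.
rewrite normrM; apply: ler_pM => //; rewrite normrX.
have a1 : `|1 - y| <= 4 / 3 by rewrite ler_norml; apply/andP; split; lra.
apply: (@le_trans _ _ ((4 / 3) ^+ 4)); first by rewrite lerXn2r ?nnegrE//; lra.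
by lra.
Unshelve. all: by end_near. Qed.

(** A prime larger than all D_i and all coefficients divides both coefficients of L_i only if L_i =
    0, which a non-zero minor excludes. *)
Lemma good_prime_eventually : exists P0 : nat, forall p, (P0 <= p)%N -> good_prime p.
Proof.
exists (\sum_i D i + \sum_i (`|L i 0%R| + `|L i 1%R|)).+1%N => p pP.
split=> i.
  apply/negP => /(dvdn_leq (D0 i)); rewrite leqNgt; apply/negP; rewrite negbK.
  apply: leq_trans pP; rewrite ltnS (bigD1 i)//=; lia.
apply/negP => /andP[p0 p1].
have LP : (`|L i 0%R| + `|L i 1%R| < p)%N.
  by apply: leq_trans pP; rewrite ltnS [X in (_ <= _ + X)%N](bigD1 i)//=; lia.
have z0 : L i 0 = 0.
  apply/eqP; rewrite -absz_eq0 -leqn0 leqNgt; apply/negP => gt0.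
  by have := dvdn_leq gt0 p0; rewrite /=; lia.
have z1 : L i 1 = 0.
  apply/eqP; rewrite -absz_eq0 -leqn0 leqNgt; apply/negP => gt0.
  by have := dvdn_leq gt0 p1; rewrite /=; lia.
have [j ij] := exists_neq_ord4 i.
by have := indep ij; rewrite /minor2 z0 z1 !mul0r subrr.
Qed.

Lemma sigma_product_cvg : cvgn (odd_prime_product_seq (sigma R d D L)).
Proof.
have [P0 goodP] := good_prime_eventually.
pose u n : R := if prime n && (2 < n)%N then sigma R d D L n - 1 else 0.
have K0 : 0 <= K by rewrite addr_ge0// !mulr_ge0// exprn_ge0//; lra.
have [B uB] : exists B, forall N, \sum_(n < N) `|u n| <= B.
  apply: (@sum_norm_bounded_inv_sqr _ u K P0) => // n nP; rewrite /u.
  case: ifPn => [/andP[pn n2]|_]; first by apply: sigma_near1 => //; exact: goodP.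
  by rewrite normr0 divr_ge0// exprn_ge0.
have := cvgn_prod1D uB.
rewrite (_ : (fun N => _) = odd_prime_product_seq (sigma R d D L))//.
apply/funext => N; rewrite /odd_prime_product_seq [RHS]big_mkcond [RHS]big_mkord.
by apply: eq_bigr => n _; rewrite /u; case: ifP => _; rewrite ?addr0// addrC subrK.
Qed.

End local_factors.

(** * Local densities at the primes *)

Section solution_counts.
Variable (R : realType).

Lemma natr_forall (I : finType) (P : pred I) :
  [forall i, P i]%:R = \prod_i (P i)%:R :> R.
Proof.
have [/forallP h|/forallPn[i ni]] := boolP [forall i, P i].
  by rewrite big1// => i _; rewrite h.
by rewrite (bigD1 i)//= (negbTE ni) mul0r.
Qed.

(** For fixed x the four conditions involve disjoint variables (s_i, t_i), so the count of (s, t) is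
    a product of four counts. *)
Lemma card_point10 (q : nat)
    (Q : 'I_q * 'I_q -> {ffun 'I_4 -> 'I_q} -> {ffun 'I_4 -> 'I_q} -> Prop)
    (c : 'I_q * 'I_q -> bool) (A : 'I_4 -> 'I_q * 'I_q -> 'I_q -> 'I_q -> bool) :
  (forall x s t, Q x s t <-> (c x /\ forall i, A i x (s i) (t i))) ->
  (#|[set z : point10 q | let: (x, s, t) := z in `[< Q x s t >] ]%SET|)%:R =
  \sum_(x : 'I_q * 'I_q) (c x)%:R *
    \prod_(i < 4) \sum_(z : 'I_q * 'I_q) (A i x z.1 z.2)%:R :> R.
Proof.
move=> QE; rewrite -sum1_card natr_sum big_mkcond /=.
transitivity (\sum_(x : 'I_q * 'I_q) \sum_(s : {ffun 'I_4 -> 'I_q})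
    \sum_(t : {ffun 'I_4 -> 'I_q}) (c x)%:R * \prod_i (A i x (s i) (t i))%:R : R).
  rewrite !pair_bigA; apply: eq_bigr => -[[x s] t] _ /=.
  rewrite inE; case: asboolP => [/QE[-> h]|nQ].
    by rewrite mul1r big1// => i _; rewrite h.
  case: (c x) (QE x s t) => [E|]; last by rewrite mul0r.
  have [/forallP h|/forallPn[i ni]] := boolP [forall i, A i x (s i) (t i)].
    by case: nQ; apply/E.
  by rewrite (bigD1 i)//= (negbTE ni) mul0r mulr0.
apply: eq_bigr => x _.
rewrite (eq_bigr (fun i => \sum_(a : 'I_q) \sum_(b : 'I_q) (A i x a b)%:R)); last first.
  by move=> i _; rewrite pair_bigA.
rewrite bigA_distr_bigA mulr_sumr; apply: eq_bigr => s _.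
by rewrite -mulr_sumr bigA_distr_bigA.
Qed.

Lemma cvgn_geometric_close (u v : nat -> R) (l K r : R) (n0 : nat) : `|r| < 1 ->
  (forall n, (n0 <= n)%N -> `|u n - v n| <= K * r ^+ n) ->
  v n @[n --> \oo] --> l -> u n @[n --> \oo] --> l.
Proof.
move=> r1 err vl; have -> : u = v + (u - v) by rewrite addrC subrK.
rewrite -[X in _ --> X]addr0; apply: cvgD => //.
apply/cvgr0Pnorm_lt => eps eps0.
have := cvg_geometric K r1 => /cvgr0Pnorm_lt/(_ _ eps0) H.
near=> n; apply: (@le_lt_trans _ _ `|geometric K r n|); last by near: n.
apply: le_trans (err n _) _; first by near: n; exact: nbhs_infty_ge.
exact: ler_norm.
Unshelve. all: by end_near. Qed.

Lemma prod4_diff_le (f g : 'I_4 -> R) (B : R) : 0 <= B ->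
  (forall i, `|f i| <= B) -> (forall i, `|g i| <= B) ->
  `|\prod_i f i - \prod_i g i| <= 2 * B ^+ 4.
Proof.
move=> B0 fB gB.
have prod_le (h : 'I_4 -> R) : (forall i, `|h i| <= B) -> `|\prod_i h i| <= B ^+ 4.
  move=> hB; rewrite normr_prod -[in leRHS](card_ord 4) -prodr_const.
  by apply: ler_prod => i _; rewrite normr_ge0 hB.
by apply: (le_trans (ler_normB _ _)); have := prod_le f fB; have := prod_le g gB; lra.
Qed.

(** Only the x that are bad for some i contribute, each at most 2 B^4, and their number is estimated
    by the union bound. *)
Lemma sum_prod4_diff_le (q : nat) (w : int * int -> bool) (bad : 'I_4 -> int * int -> bool)
    (f g : 'I_4 -> int * int -> R) (B : R) : 0 <= B ->
  (forall i x, `|f i x| <= B) -> (forall i x, `|g i x| <= B) ->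
  (forall i x, w x -> ~~ bad i x -> f i x = g i x) ->
  `|sumZ2 q (fun x => (w x)%:R * \prod_i f i x) -
    sumZ2 q (fun x => (w x)%:R * \prod_i g i x)| <=
  2 * B ^+ 4 * \sum_i sumZ2 q (fun x => (bad i x)%:R).
Proof.
move=> B0 fB gB fg; rewrite /sumZ2 exchange_big/= mulr_sumr -sumrB.
apply: (le_trans (ler_norm_sum _ _ _)); apply: ler_sum => x _.
have bad0 : 0 <= \sum_i (bad i (vec2 x))%:R :> R by apply: sumr_ge0 => i _; rewrite ler0n.
have B4 : 0 <= 2 * B ^+ 4 by rewrite mulr_ge0// exprn_ge0.
case wx : (w (vec2 x)); last by rewrite !mul0r subrr normr0 mulr_ge0.
rewrite !mul1r; have [/existsP[i bi]|/existsPn nb] := boolP [exists i, bad i (vec2 x)].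
  apply: le_trans (prod4_diff_le B0 (fB^~ _) (gB^~ _)) _.
  rewrite ler_peMr// (bigD1 i)//= bi lerDl.
  by apply: sumr_ge0 => k _; rewrite ler0n.
rewrite (eq_bigr (g^~ (vec2 x))) ?subrr ?normr0 ?mulr_ge0// => i _.
by rewrite fg.
Qed.

Variable (L : 'M[int]_(4, 2)).
Hypothesis (indep : forall i j, i != j -> minor2 L i j != 0).

(** The case h_i = p^N, all other moduli 1, of [lattice_det_ge]: any second form serves as partner.
    It shows that the exceptional x are rare. *)
Lemma count_dvd_lform_le (p N n : nat) i : (0 < p)%N -> (N <= n)%N ->
  sumZ2 (p ^ n) (fun x => ((p ^ N)%N%:Z %| lform L i x)%Z%:R) <=
  (minors_bound L)%:R * p%:R ^+ (2 * n) / p%:R ^+ N :> R.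
Proof.
move=> p0 Nn; pose h k := if k == i then (p ^ N)%N else 1%N.
have hM k : (h k %| p ^ n)%N by rewrite /h; case: ifP => _; rewrite ?dvd1n// dvdn_exp2l.
have pn0 : (0 < p ^ n)%N by rewrite expn_gt0 p0.
have h0 k : (0 < h k)%N by rewrite /h; case: ifP => _; rewrite ?expn_gt0 ?p0.
have -> : sumZ2 (p ^ n) (fun x => ((p ^ N)%N%:Z %| lform L i x)%Z%:R) =
    Gamma_count L R h (p ^ n).
  apply: eq_bigr => x _; congr (_%:R); congr nat_of_bool.
  apply/idP/forallP => [px k|/(_ i)]; last by rewrite /h eqxx.
  by rewrite /h; case: eqP => [->//|_]; rewrite dvdzE dvd1n.
have [j ij] := exists_neq_ord4 i.
have detE := lattice_det_count L R pn0 hM.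
have det_ge : (p ^ N <= lattice_det (Gamma h L) * minors_bound L)%N.
  have := lattice_det_ge h0 ij (indep ij).
  rewrite {1 2}/h eqxx eq_sym (negbTE ij) muln1 => /leq_trans; apply.
  by rewrite leq_mul2l leq_minors_bound orbT.
have pN0 : 0 < p%:R ^+ N :> R by rewrite exprn_gt0// ltr0n.
have cnt0 := Gamma_count_gt0 L R h pn0.
have -> : p%:R ^+ (2 * n) = (p ^ n * p ^ n)%:R :> R.
  by rewrite natrM natrX -exprD addnn mul2n.
rewrite ler_pdivlMr// -detE mulrA mulrC ler_wpM2r ?(ltW cnt0)//.
by rewrite mulrC -natrM -natrX ler_nat.
Qed.

End solution_counts.

Lemma Posz_exp (a k : nat) : (a ^ k)%N%:Z = a%:Z ^+ k.
Proof. by rewrite -!natz natrX. Qed.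

(** * The density at an odd prime *)

Section odd_local_density.
Context (R : realType).
Variables (d D : 'I_4 -> nat) (L : 'M[int]_(4, 2)).
Hypotheses (d0 : forall i, (0 < d i)%N) (D0 : forall i, (0 < D i)%N).
Hypothesis (dD : forall i, (d i %| D i)%N).
Hypothesis (indep : forall i j, i != j -> minor2 L i j != 0).
Variable (p : nat).
Hypotheses (pp : prime p) (p2 : (2 < p)%N).
Notation det h := (lattice_det (Gamma h L)).
Notation lam := (valuations d p).
Notation mu := (valuations D p).
Notation chi := ((chi4 p)%:~R : R).

Let p0 : (0 < p)%N := prime_gt0 pp.
Let pR0 : 0 < p%:R :> R. Proof. by rewrite ltr0n. Qed.

Let lam_le_mu i : (lam i <= mu i)%N.
Proof. exact: dvdn_leq_log. Qed.

(** A common bound for all mu_i and lambda_i. Cutting the series at n - m0 makes every modulus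
    p^(max(mu_i, lambda_i + e_i)) that occurs a divisor of p^n. *)
Let m0 : nat := (\sum_i mu i)%N.
Let mu_le i : (mu i <= m0)%N.
Proof. by rewrite /m0 (bigD1 i)//= leq_addr. Qed.
Let lam_le i : (lam i <= m0)%N := leq_trans (lam_le_mu i) (mu_le i).

(** After division by p^l the condition only sees z modulo p^(n-l), and each such class has p^(2 l)
    lifts. The surplus p^l is what the factor p^-lambda_i in the density removes. *)
Lemma count_scaled_circle (n l : nat) (B : int) : (l <= n)%N -> (p%:Z ^+ l %| B)%Z ->
  sumZ2 (p ^ n) (fun z => (p%:Z ^+ n %| B - p%:Z ^+ l * sq2 z)%Z%:R) =
  p%:R ^+ (n + l) * circle_ratio R p (n - l) (B %/ p%:Z ^+ l)%Z.
Proof.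
move=> ln /dvdzP[A BE].
have pl0 : p%:Z ^+ l != 0 by rewrite expf_neq0// eqz_nat -lt0n.
have cntE : sumZ2 (p ^ n) (fun z => (p%:Z ^+ n %| B - p%:Z ^+ l * sq2 z)%Z%:R) =
    sumZ2 (p ^ (n - l) * p ^ l) (fun z => ((p ^ (n - l))%N%:Z %| sq2 z - A)%Z%:R) :> R.
  rewrite -expnD subnK//; apply: eq_bigr => z _; congr (_%:R); congr nat_of_bool.
  have -> : p%:Z ^+ n = p%:Z ^+ l * p%:Z ^+ (n - l) by rewrite -exprD subnKC.
  rewrite BE (_ : _ - _ = p%:Z ^+ l * - (sq2 (vec2 z) - A)); last by ring.
  by rewrite dvdz_mul2l// rpredN Posz_exp.
rewrite cntE sumZ2_refine ?expn_gt0 ?p0//; last exact: periodic2_circle.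
rewrite BE mulzK// /circle_ratio /circle_count.
rewrite -[LHS]mulr_natl !natrX -exprM (_ : n + l = l * 2 + (n - l))%N; last by lia.
rewrite exprD; field; by rewrite expf_neq0// gt_eqF.
Qed.

Let w (x : int * int) : bool := [forall i, (p%:Z ^+ mu i %| lform L i x)%Z].
(** [F] is the exact normalised count and [G] its truncated divisor sum. The default 0 is never met
    under [w], because lambda_i <= mu_i. *)
Let F n i (x : int * int) : R :=
  if (p%:Z ^+ lam i %| lform L i x)%Z then
    circle_ratio R p (n - lam i) (lform L i x %/ p%:Z ^+ lam i)%Z else 0.
Let G n i (x : int * int) : R :=
  circle_series R p (n - m0) (lform L i x %/ p%:Z ^+ lam i)%Z.

Let w_lam x i : w x -> (p%:Z ^+ lam i %| lform L i x)%Z.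
Proof. by move=> /forallP/(_ i); apply: dvdz_trans; apply: dvdz_exp2l. Qed.

Let N_oddE n : (m0 <= n)%N -> omega_odd_seq R L lam mu p n =
  sumZ2 (p ^ n) (fun x => (w x)%:R * \prod_i F n i x) / p%:R ^+ (2 * n).
Proof.
move=> mn; rewrite /omega_odd_seq /N_odd.
rewrite (card_point10 R (c := fun x => w (vec2 x)) (A := fun i x a b =>
   (p%:Z ^+ n %| lform L i (vec2 x) - p%:Z ^+ lam i * sq2 (vec2 (a, b)))%Z)); last first.
  move=> x s t; split=> [h|[/forallP wx h] i].
    split; first by apply/forallP => i; have [] := h i.
    by move=> i; have [/eqP + _] := h i; rewrite eqz_mod_dvd.
  by split=> //; apply/eqP; rewrite eqz_mod_dvd; exact: h.
have -> : (6 * n + \sum_i lam i = 2 * n + \sum_i (n + lam i))%N.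
  by rewrite big_split/= sum_nat_const card_ord; lia.
have P0 : \prod_i p%:R ^+ (n + lam i) != 0 :> R.
  by apply/prodf_neq0 => i _; rewrite expf_neq0// gt_eqF.
rewrite (_ : \sum_x _ = sumZ2 (p ^ n) (fun x => (w x)%:R * \prod_i F n i x) *
    \prod_i p%:R ^+ (n + lam i)); last first.
  rewrite /sumZ2 mulr_suml; apply: eq_bigr => x _.
  case wx : (w (vec2 x)); last by rewrite !mul0r.
  rewrite !mul1r -big_split/=; apply: eq_bigr => i _.
  rewrite /F (w_lam i wx) mulrC -count_scaled_circle ?(w_lam i wx)//.
  exact: leq_trans (lam_le i) mn.
rewrite exprD.
have -> : p%:R ^+ (\sum_i (n + lam i)) = \prod_i p%:R ^+ (n + lam i) :> R.
  exact: (big_morph _ (exprD _) (expr0 _)).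
by field; rewrite P0 expf_neq0// gt_eqF.
Qed.

Let F_le n i x : `|F n i x| <= 8 * (5 / 4) ^+ n.
Proof.
rewrite /F; case: ifP => _; last by rewrite normr0 mulr_ge0// exprn_ge0.
rewrite ger0_norm ?circle_ratio_ge0//; apply: le_trans (circle_ratio_le _ pp p2 _ _) _.
apply: ler_pM; rewrite ?exprn_ge0//; first by lra.
by apply: ler_weXn2l; [lra|exact: leq_subr].
Qed.

Let G_le n i x : `|G n i x| <= 8 * (5 / 4) ^+ n.
Proof.
apply: le_trans (circle_series_norm_le _ pp p2 _ _) _.
by rewrite ler_wpM2l//; apply: ler_weXn2l; [lra|exact: leq_subr].
Qed.

Let bad n i (x : int * int) : bool := ((p ^ (n - m0))%N%:Z %| lform L i x)%Z.

Let FG n i x : w x -> ~~ bad n i x -> F n i x = G n i x.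
Proof.
move=> wx nb; rewrite /F (w_lam i wx) /G; apply: circle_ratioE => //.
  by apply: leq_sub2l; exact: lam_le.
apply: contraNN nb => h; rewrite /bad Posz_exp.
move: h; have /dvdzP[A ->] := w_lam i wx; rewrite mulzK ?expf_neq0 ?eqz_nat -?lt0n//.
by move=> h; rewrite dvdz_mulr.
Qed.

Let main_term n : (m0 <= n)%N ->
  sumZ2 (p ^ n) (fun x => (w x)%:R * \prod_i G n i x) / p%:R ^+ (2 * n) =
  (1 - chi / p%:R) ^+ 4 * box_sum (n - m0) (sigma_term R d D L p) /
  (det (fun i => p ^ mu i)%N)%:R.
Proof.
move=> mn; set N := (n - m0)%N.
have pn0 : (0 < p ^ n)%N by rewrite expn_gt0 p0.
(* The maximum in [lcm_expo] joins the condition p^mu_i | L_i(x) from [w] to p^(lambda_i + e_i) |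
   L_i(x) from the series. *)
pose H e (x : int * int) : R :=
  (in_Gamma L (fun i => p ^ lcm_expo d D p e i)%N x)%:R * chi ^+ esize e.
have expand x : (w x)%:R * \prod_i G n i x =
    (1 - chi / p%:R) ^+ 4 * box_sum N (fun e => H e x).
  case wx : (w x); last first.
    rewrite mul0r (_ : box_sum _ _ = 0) ?mulr0//.
    do 4 (apply: big1 => ? _); rewrite /H.
    rewrite (_ : in_Gamma _ _ _ = false) ?mul0r//; apply: contraFF wx => /forallP h.
    apply/forallP => i; apply: dvdz_trans (h i); rewrite Posz_exp.
    by apply: dvdz_exp2l; rewrite leq_maxl.
  rewrite mul1r /G /circle_series big_split/= prodr_const card_ord; congr (_ * _).
  pose T i (a : 'I_N) : R :=
    (p%:Z ^+ a %| (lform L i x %/ p%:Z ^+ lam i)%Z)%Z%:R * chi ^+ a.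
  transitivity (\prod_i \sum_(a < N) T i a); first by [].
  rewrite !big_ord_recl big_ord0 mulr1.
  set i0 : 'I_4 := ord0; set i1 : 'I_4 := lift _ _; set i2 : 'I_4 := lift _ _.
  set i3 : 'I_4 := lift _ _.
  rewrite /box_sum mulr_suml; apply: eq_bigr => a _.
  rewrite mulr_suml mulr_sumr; apply: eq_bigr => b _.
  rewrite mulr_suml !mulr_sumr; apply: eq_bigr => c _.
  rewrite !mulr_sumr; apply: eq_bigr => f _.
  rewrite /T /H /esize/= !exprD.
  have dvdE e : (in_Gamma L (fun i => p ^ lcm_expo d D p e i)%N x) =
      [forall i, (p%:Z ^+ expo e i %| (lform L i x %/ p%:Z ^+ lam i)%Z)%Z].
    apply: eq_forallb => k; have /dvdzP[A AE] := w_lam k wx.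
    rewrite AE mulzK ?expf_neq0 ?eqz_nat -?lt0n// Posz_exp /lcm_expo.
    have pz : p%:Z ^+ lam k != 0 by rewrite expf_neq0 ?eqz_nat -?lt0n.
    rewrite (_ : (p%:Z ^+ expo e k %| A)%Z =
      (p%:Z ^+ (lam k + expo e k) %| A * p%:Z ^+ lam k)%Z); last first.
      by rewrite addnC exprD dvdz_mul2r.
    apply/idP/idP => h; first by apply: dvdz_trans h; apply: dvdz_exp2l; rewrite leq_maxr.
    case: (leqP (mu k) (lam k + expo e k)) => [//|lt].
    by rewrite -AE; move: wx => /forallP/(_ k).
  rewrite dvdE natr_forall !big_ord_recl big_ord0 -/i0 -/i1 -/i2 -/i3.
  rewrite (_ : expo _ i0 = a)// (_ : expo _ i1 = b)// (_ : expo _ i2 = c)//.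
  by rewrite (_ : expo _ i3 = f)//; ring.
rewrite {1}/sumZ2; under eq_bigr do rewrite expand.
rewrite -mulr_sumr -[LHS]mulrA -[RHS]mulrA; congr (_ * _).
(* All moduli divide p^n, so the lattice has density exactly the inverse of its index modulo p^n. *)
have sumH e : (forall i, expo e i <= N)%N -> sumZ2 (p ^ n) (H e) =
    chi ^+ esize e * p%:R ^+ (2 * n) / (det (fun i => p ^ lcm_expo d D p e i)%N)%:R.
  move=> eN.
  have hM i : (p ^ lcm_expo d D p e i %| p ^ n)%N.
    rewrite dvdn_exp2l// geq_max (leq_trans (mu_le i) mn)/=.
    by rewrite -(subnKC mn) leq_add// lam_le.
  have cnt := lattice_det_count L R pn0 hM.
  have det0 : (det (fun i => p ^ lcm_expo d D p e i)%N)%:R != 0 :> R.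
    rewrite pnatr_eq0 -lt0n; apply: det_gt0 => // i.
    by rewrite expn_gt0 p0.
  have -> : p%:R ^+ (2 * n) = (p ^ n * p ^ n)%:R :> R.
    by rewrite natrM natrX -exprD addnn mul2n.
  rewrite -cnt (_ : sumZ2 _ _ =
    Gamma_count L R (fun i => p ^ lcm_expo d D p e i)%N (p ^ n) * chi ^+ esize e).
    by field.
  by rewrite /Gamma_count /sumZ2 mulr_suml.
transitivity ((\sum_(a < N) \sum_(b < N) \sum_(c < N) \sum_(f < N)
    sumZ2 (p ^ n) (H (val a, val b, val c, val f))) / p%:R ^+ (2 * n)).
  congr (_ / _); rewrite /sumZ2 /box_sum exchange_big/=; apply: eq_bigr => a _.
  rewrite exchange_big/=; apply: eq_bigr => b _.
  rewrite exchange_big/=; apply: eq_bigr => c _.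
  by rewrite exchange_big.
rewrite /box_sum !mulr_suml; apply: eq_bigr => a _.
rewrite !mulr_suml; apply: eq_bigr => b _.
rewrite !mulr_suml; apply: eq_bigr => c _.
rewrite !mulr_suml; apply: eq_bigr => f _.
rewrite sumH; last first.
  by case=> -[|[|[|[|//]]]] ? /=; rewrite /expo/= ltnW.
rewrite sigma_term_expo//.
have det0 : (det (fun i => p ^ lcm_expo d D p (val a, val b, val c, val f) i)%N)%:R != 0 :> R.
  by rewrite pnatr_eq0 -lt0n; apply: det_gt0 => // i; rewrite expn_gt0 p0.
have det1 : (det (fun i => p ^ mu i)%N)%:R != 0 :> R.
  by rewrite pnatr_eq0 -lt0n; apply: det_gt0 => // i; rewrite expn_gt0 p0.
have pn : p%:R ^+ (2 * n) != 0 :> R by rewrite expf_neq0// gt_eqF.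
by field; rewrite det0 det1 pn.
Qed.

Lemma omega_odd_cvg : omega_odd_seq R L lam mu p n @[n --> \oo] -->
  sigma R d D L p / (det (fun i => p ^ mu i)%N)%:R.
Proof.
pose main n := (1 - chi / p%:R) ^+ 4 * box_sum (n - m0) (sigma_term R d D L p) /
  (det (fun i => p ^ mu i)%N)%:R.
have main_cvg : main n @[n --> \oo] --> sigma R d D L p / (det (fun i => p ^ mu i)%N)%:R.
  apply: cvgM; last exact: cvg_cst.
  apply: cvgM; first exact: cvg_cst.
  rewrite -(cvg_shiftn m0) /=.
  rewrite (_ : (fun n => _) = (fun N => box_sum N (sigma_term R d D L p))); last first.
    by apply/funext => n; rewrite addnK.
  exact: (sigma_series_cvg d0 D0 indep pp p2).
(* Four factors of size at most 8 (5/4)^n meet bad sets of density O(p^-(n - m0)) for each of the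
   four forms; this gives the ratio [r] and the constant [K]. *)
pose r : R := (5 / 4) ^+ 4 / p%:R.
pose K : R := 2 * 8 ^+ 4 * (4 * (minors_bound L)%:R * p%:R ^+ m0).
have p3 : 3 <= p%:R :> R by rewrite (ler_nat _ 3).
have r01 : `|r| < 1.
  rewrite ger0_norm ?divr_ge0 ?exprn_ge0 ?ler0n// /r ltr_pdivrMr// mul1r.
  by apply: lt_le_trans p3; lra.
have err n : (m0 <= n)%N -> `|omega_odd_seq R L lam mu p n - main n| <= K * r ^+ n.
  move=> mn; rewrite N_oddE// /main -main_term// -mulrBl normrM normfV.
  have pn : 0 < p%:R ^+ (2 * n) :> R by rewrite exprn_gt0.
  rewrite (gtr0_norm pn) ler_pdivrMr//.
  apply: le_trans (@sum_prod4_diff_le R (p ^ n) w (bad n) (F n) (G n)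
    (8 * (5 / 4) ^+ n) _ (F_le n) (G_le n) (@FG n)) _; first by rewrite mulr_ge0// exprn_ge0.
  apply: (@le_trans _ _ (2 * (8 * (5 / 4) ^+ n) ^+ 4 *
    \sum_(i < 4) ((minors_bound L)%:R * p%:R ^+ (2 * n) / p%:R ^+ (n - m0)))).
    rewrite ler_wpM2l ?mulr_ge0 ?exprn_ge0 ?mulr_ge0 ?exprn_ge0//.
    by apply: ler_sum => i _; apply: count_dvd_lform_le => //; exact: leq_subr.
  have rn : r ^+ n = ((5 / 4) ^+ n) ^+ 4 / p%:R ^+ n.
    by rewrite /r; move: (5 / 4) => b; rewrite expr_div_n -!exprM mulnC.
  rewrite sumr_const card_ord -mulr_natl /K rn.
  have pm : p%:R ^+ n = p%:R ^+ m0 * p%:R ^+ (n - m0) :> R by rewrite -exprD subnKC.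
  rewrite pm; move: ((5 / 4) ^+ n) => b.
  have pnm : p%:R ^+ (n - m0) != 0 :> R by rewrite expf_neq0// gt_eqF.
  have pm0 : p%:R ^+ m0 != 0 :> R by rewrite expf_neq0// gt_eqF.
  rewrite le_eqVlt; apply/orP; left; apply/eqP; field.
  by rewrite pnm pm0.
exact: (cvgn_geometric_close r01 err main_cvg).
Qed.

End odd_local_density.

(** * The density at 2 *)

Section dyadic_density.
Context (R : realType).
Variables (d : 'I_4 -> nat) (L : 'M[int]_(4, 2)) (j : option 'I_2).
Hypothesis (d_odd : forall i, odd (d i)).
Hypothesis (indep : forall i k, i != k -> minor2 L i k != 0).

Let cond (x : int * int) : bool :=
  `[< (x.1 = 1 %[mod 4])%Z /\ cond_j j x.2 >].

Let in_dE n i (x : int * int) : bool := `[< dEset (d i) n (lform L i x) >].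

Lemma Eset_congr n A B : (2 ^+ n %| A - B)%Z -> Eset n A <-> Eset n B.
Proof.
rewrite -eqz_mod_dvd => /eqP AB; split=> -[nu [m [m1 e]]]; exists nu, m; split=> //.
  by rewrite -AB.
by rewrite AB.
Qed.

Lemma dEset_congr c n A B : (2 ^+ n %| A - B)%Z -> dEset c n A <-> dEset c n B.
Proof.
by rewrite -eqz_mod_dvd => /eqP AB; split=> -[x Ex e]; exists x => //; rewrite -e AB.
Qed.

Lemma dEsetS c n A : dEset c n.+1 A -> dEset c n A.
Proof.
have mod_le (a b : int) : (a = b %[mod 2 ^+ n.+1])%Z -> (a = b %[mod 2 ^+ n])%Z.
  move=> /eqP ab; apply/eqP; move: ab; rewrite !eqz_mod_dvd.
  by apply: dvdz_trans; apply: dvdz_exp2l.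
by case=> x [nu [m [m1 e]]] eA; exists x; [exists nu, m; split=> //|]; exact: mod_le.
Qed.

Lemma odd_inverse_mod (c n : nat) : odd c ->
  exists c' : int, (2 ^+ n %| c%:Z * c' - 1)%Z.
Proof.
move=> oc; have : coprimez c%:Z (2 ^+ n).
  by apply: coprimezXr; rewrite coprimezE/= coprimen2.
move=> /coprimezP[[u v] /= uv]; exists u.
by rewrite -[X in _ - X]uv (_ : _ - _ = - v * 2 ^+ n) ?dvdz_mull//; ring.
Qed.

Lemma dEsetE (c n : nat) (c' : int) (A : int) : (2 ^+ n %| c%:Z * c' - 1)%Z ->
  dEset c n A <-> Eset n (c' * A).
Proof.
move=> cc'; split=> [[x Ex /eqP]|Ex].
  rewrite eqz_mod_dvd => Ax; have h : (2 ^+ n %| c' * A - x)%Z.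
    rewrite (_ : _ - _ = c' * (A - c%:Z * x) + x * (c%:Z * c' - 1)); last by ring.
    by rewrite rpredD// dvdz_mull.
  exact/(Eset_congr h).
exists (c' * A) => //; apply/eqP; rewrite eqz_mod_dvd.
rewrite (_ : _ - _ = - A * (c%:Z * c' - 1)); last by ring.
by rewrite dvdz_mull.
Qed.

(** The 2^4 of the definition is spread over the four forms: 2 = 2^(n+1) / 2^n is the normalised
    number of (s_i, t_i) above an admissible value. *)
Let delta_seqE n : delta_seq R d L j n =
  sumZ2 (2 ^ n) (fun x => (cond x)%:R * \prod_i (2 * (in_dE n i x)%:R)) / 2 ^+ (2 * n).
Proof.
rewrite /delta_seq mulrAC; congr (_ / _).
rewrite -sum1_card natr_sum big_mkcond mulr_sumr; apply: eq_bigr => x _.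
rewrite inE big_split/= prodr_const card_ord -natr_forall mulrCA; congr (_ * _).
rewrite -natrM mulnb; case: asboolP => [[h1 h2 h3]|nh].
  rewrite /cond asboolT//= (_ : [forall i, _] = true)//.
  by apply/forallP => i; apply/asboolP.
rewrite (_ : _ && _ = false)//; apply/negP => /andP[/asboolP[h1 h2] /forallP h3].
by apply: nh; split=> // i; apply/asboolP; exact: h3.
Qed.

Let F n i (x : int * int) : R :=
  sumZ2 (2 ^ n) (fun z => (2 ^+ n %| lform L i x - (d i)%:Z * sq2 z)%Z%:R) / 2 ^+ n.

Let omega_twoE n : omega_two_seq R d L j n =
  sumZ2 (2 ^ n) (fun x => (cond x)%:R * \prod_i F n i x) / 2 ^+ (2 * n).
Proof.
rewrite /omega_two_seq /N_two.
rewrite (card_point10 R (c := fun x => cond (vec2 x)) (A := fun i x a b =>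
   (2 ^+ n %| lform L i (vec2 x) - (d i)%:Z * sq2 (vec2 (a, b)))%Z)); last first.
  move=> x s t; split=> [[h1 h2 h3]|[/asboolP[h2 h3] h1]].
    split; first by apply/asboolP.
    by move=> i; rewrite -eqz_mod_dvd; apply/eqP; exact: h1.
  by split=> // i; apply/eqP; rewrite eqz_mod_dvd; exact: h1.
rewrite (_ : 6 * n = 4 * n + 2 * n)%N; last by lia.
rewrite exprD invfM mulrA; congr (_ / _).
rewrite /sumZ2 mulr_suml; apply: eq_bigr => x _; rewrite -mulrA; congr (_ * _).
rewrite /F big_split/= prodfV prodr_const card_ord -exprM mulnC; congr (_ / _).
Qed.

(** The odd factor d_i is inverted modulo 2^n, which leaves a plain sum of two squares. *)
Let F_circle n i x (c' : int) : (2 ^+ n %| (d i)%:Z * c' - 1)%Z ->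
  F n i x = circle_count R (2 ^ n) (c' * lform L i x) / 2 ^+ n.
Proof.
move=> cc'; congr (_ / _); apply: eq_bigr => z _; congr (_%:R); congr nat_of_bool.
rewrite Posz_exp; apply/idP/idP => h.
  rewrite (_ : _ - _ = - (c' * (lform L i x - (d i)%:Z * sq2 (vec2 z)) +
    sq2 (vec2 z) * ((d i)%:Z * c' - 1))); last by ring.
  by rewrite rpredN rpredD// dvdz_mull.
rewrite (_ : _ - _ = - (lform L i x * ((d i)%:Z * c' - 1) +
    (d i)%:Z * (sq2 (vec2 z) - c' * lform L i x))); last by ring.
by rewrite rpredN rpredD// dvdz_mull.
Qed.

Let bad n i (x : int * int) : bool := ((2 ^ (n - 2))%N%:Z %| lform L i x)%Z.

Let F_le n i x : (3 <= n)%N -> `|F n i x| <= 8.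
Proof.
move=> n3; have [c' cc'] := odd_inverse_mod n (d_odd i); rewrite (F_circle _ cc').
rewrite ger0_norm ?divr_ge0 ?circle_count_ge0 ?exprn_ge0//.
by rewrite ler_pdivrMr ?exprn_gt0// circle_count2_le.
Qed.

Let FG n i x : (3 <= n)%N -> ~~ bad n i x -> F n i x = 2 * (in_dE n i x)%:R.
Proof.
move=> n3 nb; have [c' cc'] := odd_inverse_mod n (d_odd i).
rewrite (F_circle _ cc') circle_count2E//; last first.
  apply: contraNN nb; rewrite /bad Posz_exp => h.
  have d2 : (2 ^+ (n - 2) %| 2 ^+ n)%Z by apply: dvdz_exp2l; rewrite leq_subr.
  rewrite (_ : lform L i x = (d i)%:Z * (c' * lform L i x) -
    lform L i x * ((d i)%:Z * c' - 1)); last by ring.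
  apply: rpredB; first exact: dvdz_mull.
  by apply: dvdz_mull; exact: dvdz_trans d2 cc'.
rewrite (_ : in_dE n i x = `[< Eset n (c' * lform L i x) >]).
  by rewrite exprS; field; rewrite expf_neq0.
by apply: asbool_equiv_eq; exact: dEsetE.
Qed.

(** The classes of E_(n+1) reduce into E_n, so the densities are non-increasing and bounded
    below. *)
Lemma delta_cvg : cvgn (delta_seq R d L j).
Proof.
(* The condition x_1 = 1 mod 4 depends only on classes modulo 2^n once n >= 2. *)
pose u n := delta_seq R d L j n.+2.
suff : cvgn u.
  move=> /cvg_ex[l ul]; apply/cvg_ex; exists l.
  rewrite -(cvg_shiftn 2) (_ : (fun n => _) = u)//.
  by apply/funext => n; rewrite /u addn2.
apply: nonincreasing_is_cvgn; last first.
  by exists 0 => _ [n _ <-]; rewrite /u /delta_seq mulr_ge0// divr_ge0 ?exprn_ge0.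
apply/nonincreasing_seqP => n; rewrite /u !delta_seqE; set m := n.+2.
pose f k x : R := (cond x)%:R * \prod_i (2 * (in_dE k i x)%:R).
have per : periodic2 (2 ^ m) (f m).
  move=> x y xy1 xy2; rewrite /f.
  have q4 : (4 %| (2 ^ m)%N%:Z)%Z by rewrite Posz_exp (dvdz_exp2l 2 (isT : 2 <= m)%N).
  have -> : cond x = cond y.
    have e1 : ((x.1 = 1 %[mod 4])%Z <-> (y.1 = 1 %[mod 4])%Z).
      have /eqP -> : (x.1 == y.1 %[mod 4])%Z by rewrite eqz_mod_dvd (dvdz_trans q4).
      by [].
    have e2 : cond_j j x.2 <-> cond_j j y.2.
      rewrite /cond_j; case: j => [j0|//].
      have /eqP -> : (x.2 == y.2 %[mod 2])%Z.
        by rewrite eqz_mod_dvd; apply: dvdz_trans (dvdz_trans q4 xy2).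
      by [].
    by apply: asbool_equiv_eq; tauto.
  congr (_ * _); apply: eq_bigr => i _; congr (_ * _%:R); congr nat_of_bool.
  apply: asbool_equiv_eq; apply: dEset_congr.
  rewrite -lformB /lform -Posz_exp.
  by rewrite rpredD// dvdz_mull.
apply: (@le_trans _ _ (sumZ2 (2 ^ m.+1) (f m) / 2 ^+ (2 * m.+1))).
  rewrite ler_wpM2r ?invr_ge0 ?exprn_ge0//; apply: ler_sum => x _.
  rewrite /f ler_wpM2l//; apply: ler_prod => i _; rewrite mulr_ge0//=.
  rewrite ler_wpM2l// ler_nat.
  have : in_dE m.+1 i (vec2 x) -> in_dE m i (vec2 x).
    by move=> /asboolP h; apply/asboolP; exact: dEsetS.
  by case: (in_dE m.+1 i _) => // ->.
rewrite expnSr sumZ2_refine ?expn_gt0// -(mulr_natr (sumZ2 _ _)).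
rewrite (_ : 2 * m.+1 = 2 * m + 2)%N; last by lia.
rewrite exprD (_ : (2 ^ 2)%N%:R = 2 ^+ 2 :> R); last by rewrite natrX.
rewrite le_eqVlt; apply/orP; left; apply/eqP; field.
by rewrite expf_neq0.
Qed.

Lemma omega_two_cvg : omega_two_seq R d L j n @[n --> \oo] --> delta R d L j.
Proof.
have half : `|2^-1| < 1 :> R by rewrite ger0_norm ?invr_ge0// invf_lt1// ltr1n.
(* Here the factors are bounded by 8 uniformly in n, so the error is of the order of the bad density
   2^-(n-2). *)
pose K : R := 2 * 8 ^+ 4 * (4 * (minors_bound L)%:R * 2 ^+ 2).
apply: (cvgn_geometric_close (v := delta_seq R d L j) (K := K) (n0 := 3) half _ delta_cvg).
move=> n n3.
rewrite omega_twoE delta_seqE -mulrBl normrM normfV.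
have pn : 0 < 2 ^+ (2 * n) :> R by rewrite exprn_gt0.
rewrite (gtr0_norm pn) ler_pdivrMr//.
have G_le i x : `|2 * (in_dE n i x)%:R| <= 8 :> R.
  by rewrite normrM; case: (in_dE _ _ _); rewrite ?normr1 ?normr0 ger0_norm//; lra.
apply: le_trans (@sum_prod4_diff_le R (2 ^ n) cond (bad n) (F n)
  (fun i x => 2 * (in_dE n i x)%:R) 8 _ _ G_le _) _ => //.
- by move=> i x; exact: F_le.
- by move=> i x _; exact: FG.
apply: (@le_trans _ _ (2 * 8 ^+ 4 *
    \sum_(i < 4) ((minors_bound L)%:R * 2 ^+ (2 * n) / 2 ^+ (n - 2)))).
  rewrite ler_wpM2l ?mulr_ge0 ?exprn_ge0//.
  by apply: ler_sum => i _; apply: count_dvd_lform_le => //; exact: leq_subr.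
rewrite sumr_const card_ord -(mulr_natl _ 4) /K.
have pm : 2 ^+ n = 2 ^+ 2 * 2 ^+ (n - 2) :> R by rewrite -exprD subnKC// ltnW.
rewrite exprVn pm le_eqVlt; apply/orP; left; apply/eqP; field.
by rewrite expf_neq0.
Qed.

End dyadic_density.

(** * The archimedean density *)

Section open_measurable2.
Context (R : realType).

(** Openness refers to the product topology, measurability to the product sigma-algebra. The link is
    that U is a countable union of squares with rational centres and radii 1/(n+1). *)
Lemma open_measurable2 (U : set (R * R)) : open U ->
  measurable (U : set (measurableTypeR R * measurableTypeR R)).
Proof.
move=> oU.
pose box (z : rat * rat * nat) : set (R * R) :=
  ball (ratr z.1.1 : R) z.2.+1%:R^-1 `*` ball (ratr z.1.2 : R) z.2.+1%:R^-1.
have -> : U = \bigcup_z (if `[< box z `<=` U >] then box z else set0).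
  apply/seteqP; split => [x Ux|x [z _]]; last first.
    by case: asboolP => // zU xz; exact: zU.
  have /nbhs_ballP[e /= e0 xeU] : nbhs x U by apply: open_nbhs_nbhs.
  have e20 : 0 < e / 2 by rewrite divr_gt0.
  pose n := Num.truncn (e / 2)^-1; pose r : R := n.+1%:R^-1.
  have ne : r < e / 2 by rewrite invf_plt ?posrE//; exact: truncnS_gt.
  have n0 : 0 < r by rewrite invr_gt0.
  have rat_near (y : R) : exists q : rat, ball (ratr q : R) r y.
    have /rat_in_itvoo[q] : y < y + r by rewrite ltrDl.
    rewrite in_itv/= => /andP[yq qy]; exists q; clearbody r.
    by rewrite /ball/= ltr_norml; move: (ratr q : R) yq qy => t yq qy; apply/andP; split; lra.
  have [[q1 xq1] [q2 xq2]] := (rat_near x.1, rat_near x.2).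
  exists (q1, q2, n) => //; case: asboolP => [_|]; first by split.
  case=> y [/= yq1 yq2]; apply: xeU; split => /=.
  - exact: ball_splitr (le_ball (ltW ne) xq1) (le_ball (ltW ne) yq1).
  - exact: ball_splitr (le_ball (ltW ne) xq2) (le_ball (ltW ne) yq2).
apply: countable_bigcupT_measurable; first exact: countableP.
move=> z; case: asboolP => _ //.
by apply: measurableX; exact: measurable_ball.
Qed.

Lemma measurable_invr : measurable_fun setT (fun x : R => x^-1).
Proof.
rewrite -(setvU [set 0 : R]); apply/measurable_funU => //.
  exact: measurableC.
split; last exact: measurable_fun_set1.
apply: open_continuous_measurable_fun.
  exact/closed_openC/accessible_closed_set1/hausdorff_accessible/norm_hausdorff.
by move=> x; rewrite inE /= => /eqP x0; apply: inv_continuous.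
Qed.

End open_measurable2.

(** * The integral over one variable s_i *)

Section circle_density.
Context (R : realType).
Implicit Types c s r : R.

(* [s |-> (2 sqrt (c - s^2))^-1], extended by 0 outside [s^2 < c] by the
   conventions [sqrt x = 0] for [x <= 0] and [0^-1 = 0]. *)
Definition circle_density c s : R := (2 * Num.sqrt (c - s ^+ 2))^-1.

Lemma circle_density_ge0 c s : 0 <= circle_density c s.
Proof. by rewrite invr_ge0 mulr_ge0// sqrtr_ge0. Qed.

Lemma measurable_circle_density d (T : measurableType d) (f g : T -> R) :
  measurable_fun setT f -> measurable_fun setT g ->
  measurable_fun setT (fun x => circle_density (f x) (g x)).
Proof.
move=> mf mg; apply: (measurableT_comp (@measurable_invr R)).
apply: measurable_funM => //.
apply: (measurableT_comp (continuous_measurable_fun (@sqrt_continuous R))).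
by apply: measurable_funB => //; exact: measurable_funX.
Qed.

Lemma circle_density_continuous c s : s ^+ 2 < c ->
  {for s, continuous (circle_density c)}.
Proof.
move=> sc; apply: continuous_comp => /=.
  apply: continuousM; first exact: cvg_cst.
  apply: continuous_comp; last exact: sqrt_continuous.
  apply: continuousB; first exact: cvg_cst.
  exact: exprn_continuous.
apply: inv_continuous.
by rewrite mulf_neq0// sqrtr_eq0 -ltNge subr_gt0.
Qed.

Lemma is_derive_circle_primitive c s : 0 < c -> s ^+ 2 < c ->
  is_derive s 1 (fun x => asin (x / Num.sqrt c) / 2) (circle_density c s).
Proof.
move=> c0 sc; set k : R := Num.sqrt c.
have k0 : 0 < k by rewrite sqrtr_gt0.
have kc : k ^+ 2 = c by rewrite sqr_sqrtr// ltW.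
have sk : -1 < k^-1 * s < 1.
  rewrite -ltr_norml normrM normfV (gtr0_norm k0) mulrC ltr_pdivrMr// mul1r.
  by rewrite -(ltr_pXn2r (n:=2)) ?nnegrE ?normr_ge0 ?(ltW k0)// kc real_normK ?num_real.
have Hd := is_derive1_asin sk.
have -> : (fun x => asin (x / k) / 2) = 2^-1 *: (@asin R \o (k^-1 *: id)).
  by apply/funext => x /=; rewrite [RHS]mulrC; congr (asin _ / _); rewrite mulrC.
apply: is_derive_eq.
rewrite /circle_density /GRing.scale/= mulr1 invfM; congr (_ * _).
rewrite -invfM; congr (_^-1).
rewrite -[X in _ * X](gtr0_norm k0) -sqrtr_sqr -sqrtrM; last first.
  by rewrite subr_ge0 -real_normK ?num_real// expr_le1// ltW// ltr_norml.
by congr Num.sqrt; rewrite kc; field: kc; rewrite ?gt_eqF.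
Qed.

(** The integrand is unbounded at the ends of ]-k, k[, so the fundamental theorem is applied on
    compact intervals exhausting it. Taking r_n = k sin(th_n) makes each integral exactly th_n,
    which tends to pi / 2. *)
Lemma integral_circle_density c : 0 < c ->
  (\int[@lebesgue_measure R]_s (circle_density c s)%:E = (pi / 2)%:E)%E.
Proof.
move=> c0; set k : R := Num.sqrt c.
have k0 : 0 < k by rewrite sqrtr_gt0.
have kc : k ^+ 2 = c by rewrite sqr_sqrtr// ltW.
pose F s := asin (s / k) / 2.
pose th n : R := pi / 2 * (1 - n.+2%:R^-1).
have pi0 := pi_gt0 R.
have th_itv n : 0 < th n < pi / 2.
  have n0 : 0 < n.+2%:R^-1 :> R by rewrite invr_gt0.
  have n1 : n.+2%:R^-1 < 1 :> R by rewrite invf_lt1// ltr1n.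
  rewrite /th; move: (n.+2%:R^-1) n0 n1 (pi : R) pi0 => t t0 t1 p p0.
  by apply/andP; split; nra.
have th_in n : th n \in `[- (pi / 2), pi / 2].
  by have /andP[t0 t1] := th_itv n; rewrite in_itv/=; apply/andP; split; lra.
have thN_in n : - th n \in `[- (pi / 2), pi / 2].
  by have /andP[t0 t1] := th_itv n; rewrite in_itv/=; apply/andP; split; lra.
pose r n : R := k * sin (th n).
have r_lt n : 0 < r n < k.
  have /andP[t0 t1] := th_itv n.
  rewrite /r mulr_gt0//= ?sin_gt0_pihalf ?t0//.
  rewrite -[ltRHS]mulr1 ltr_pM2l// -sin_pihalf ltr_sin//.
  by rewrite in_itv/=; apply/andP; split; lra.
have Fr n : F (r n) - F (- r n) = th n.
  rewrite /F /r (_ : - (k * sin (th n)) = k * sin (- th n)); last by rewrite sinN mulrN.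
  rewrite ![k * _]mulrC !mulfK ?gt_eqF//.
  by rewrite !sinK//; field.
have sq_lt s : -k < s < k -> s ^+ 2 < c.
  by rewrite -ltr_norml -kc -[s ^+ 2]real_normK ?num_real// ltr_pXn2r ?nnegrE// ltW.
have Ir n : (\int[@lebesgue_measure R]_(s in `[(- r n)%R, r n]) (circle_density c s)%:E
    = (th n)%:E)%E.
  have /andP[r0 rk] := r_lt n.
  have rsq s : - r n <= s <= r n -> s ^+ 2 < c.
    by move=> /andP[s1 s2]; apply: sq_lt; apply/andP; split; lra.
  have dF s : - r n <= s <= r n -> is_derive s 1 F (circle_density c s).
    by move=> /rsq; exact: is_derive_circle_primitive.
  have cF s : - r n <= s <= r n -> {for s, continuous F}.
    by move=> /dF ?; apply: differentiable_continuous; apply/derivable1_diffP.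
  have r2 : - r n < r n by lra.
  rewrite (continuous_FTC2 (F := F) r2) ?Fr//.
  - by rewrite -EFinB Fr.
  - apply: continuous_in_subspaceT => s; rewrite inE/= in_itv/= => /rsq.
    exact: circle_density_continuous.
  - split.
    + move=> s; rewrite in_itv/= => /andP[s1 s2].
      by have : is_derive s 1 F (circle_density c s) by apply: dF; rewrite !ltW.
    + by apply: cvg_at_right_filter; apply: cF; rewrite lexx/=; lra.
    + by apply: cvg_at_left_filter; apply: cF; rewrite lexx andbT; lra.
  - move=> s; rewrite in_itv/= => /andP[s1 s2].
    have ? : is_derive s 1 F (circle_density c s) by apply: dF; rewrite !ltW.
    by rewrite derive1E; apply: derive_val.
have U : \bigcup_n `[- r n, r n]%classic = `]-k, k[%classic.
  apply/seteqP; split=> [s [n _]|s] /=; rewrite !in_itv/=.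
    by have /andP[r0 rk] := r_lt n; move=> /andP[s1 s2]; apply/andP; split; lra.
  move=> sk.
  have xk : -1 < s / k < 1.
    by rewrite -ltr_norml normrM normfV (gtr0_norm k0) ltr_pdivrMr// mul1r ltr_norml.
  have /andP[xk1 xk2] := xk.
  pose a := asin (s / k).
  have a1 : a < pi / 2 by apply: asin_ltpi2; rewrite ltW.
  have a2 : - (pi / 2) < a by apply: asin_gtNpi2; rewrite xk1 ltW.
  have sE : s = k * sin a.
    by rewrite asinK ?in_itv/= ?ltW// mulrC divfK// gt_eqF.
  have /andP[a3 a4] : - (pi / 2) < a < pi / 2 by apply/andP.
  have d0 : 0 < pi / 2 - `|a| by rewrite subr_gt0 ltr_norml a2.
  (* Chosen so that pi / 2 < (n + 1) (pi / 2 - |a|), which gives |a| <= th_n. *)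
  pose n := Num.truncn (pi / 2 / (pi / 2 - `|a|)).
  have an : `|a| <= th n.
    have := truncnS_gt (pi / 2 / (pi / 2 - `|a|)); rewrite -/n ltr_pdivrMr// => nP.
    rewrite /th mulrBr mulr1 lerBrDl -lerBrDr ler_pdivrMr//.
    apply: (le_trans (ltW nP)); rewrite mulrC ler_wpM2l ?ler_nat//; exact: ltW.
  exists n => //=; rewrite in_itv/= /r sE -mulrN -sinN !ler_pM2l//.
  move: an; rewrite ler_norml => /andP[an1 an2].
  have ain : a \in `[- (pi / 2), pi / 2] by rewrite in_itv/= !ltW.
  by rewrite !leNgt !ltr_sin// -!leNgt an1.
have mf : measurable_fun setT (EFin \o circle_density c).
  by apply/measurable_EFinP; exact: measurable_circle_density.
transitivity (\int[@lebesgue_measure R]_(s in `](- k)%R, k[) (circle_density c s)%:E)%E.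
  rewrite [RHS]integral_mkcond; apply: eq_integral => s _.
  rewrite patchE; case: ifPn => //; rewrite notin_setE/= in_itv/= => /negP sk.
  rewrite /circle_density ler0_sqrtr ?mulr0 ?invr0//.
  rewrite subr_le0 -kc -[leRHS]real_normK ?num_real// ler_pXn2r ?nnegrE ?(ltW k0)//.
  by rewrite leNgt ltr_norml.
rewrite -U.
have rth m n : (m <= n)%N -> r m <= r n.
  move=> mn; rewrite ler_pM2l// leNgt ltr_sin// -leNgt ler_pM2l ?divr_gt0//.
  by rewrite lerD2l lerN2 lef_pV2 ?posrE// ler_nat.
have C := @ge0_nondecreasing_set_cvg_integral _ (measurableTypeR R) R
  (fun n => `[- r n, r n]%classic) (EFin \o circle_density c)
  (@lebesgue_measure R : {measure set (measurableTypeR R) -> \bar R}).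
apply: (cvg_unique _ (C _ _ _ _)) => //.
- move=> m n mn; rewrite subsetEset => s /=; rewrite !in_itv/= => /andP[s1 s2].
  have := rth _ _ mn; move=> ?; apply/andP; split; lra.
- by move=> i; apply: measurable_funTS.
- by move=> i s _; rewrite lee_fin circle_density_ge0.
- rewrite /= (_ : (fun i => _) = EFin \o th); last by apply/funext => i; exact: Ir.
  apply: cvg_EFin; first by apply: nearW.
  have : th n @[n --> \oo] --> pi / 2 * (1 - 0).
    apply: cvgM; first exact: cvg_cst.
    apply: cvgB; first exact: cvg_cst.
    by have := @cvg_harmonic R; rewrite -cvg_shiftS.
  by rewrite subr0 mulr1.
Qed.

End circle_density.

Lemma product_sigma_finite (R : realType) d1 d2
    (S1 : measurableType d1) (S2 : measurableType d2)
    (m1 : {sigma_finite_measure set S1 -> \bar R})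
    (m2 : {sigma_finite_measure set S2 -> \bar R}) :
  sigma_finite setT (m1 \x m2)%E.
Proof.
have [F TF Foo] := sigma_finiteT m1.
have [G TG Goo] := sigma_finiteT m2.
pose H (n : nat) :=
  if @choice.unpickle (nat * nat)%type n is Some p then F p.1 `*` G p.2 else set0.
exists H => [|n].
  apply/esym; rewrite -subTset => -[x y] _.
  have [i _ Fix] : (\bigcup_i F i) x by rewrite -TF.
  have [k _ Gky] : (\bigcup_i G i) y by rewrite -TG.
  by exists (choice.pickle (i, k)) => //; rewrite /H choice.pickleK.
rewrite /H; case: choice.unpickle => [[i k]|]; last by rewrite measure0 ltry.
have [[? ?] [? ?]] := (Foo i, Goo k); split; first exact: measurableX.
by rewrite product_measure1E// lte_mul_pinfty// ge0_fin_numE.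
Qed.

(* The library only makes products of probability measures canonically
   sigma-finite, so the structure is given to [lebesgue2] and [lebesgue4]. *)
HB.instance Definition _ (R : realType) :=
  Measure.copy (@lebesgue2 R) (@lebesgue_measure R \x @lebesgue_measure R)%E.
HB.instance Definition _ (R : realType) :=
  @Measure_isSigmaFinite.Build _ _ _ (@lebesgue2 R)
    (@product_sigma_finite R _ _ _ _ (@lebesgue_measure R) (@lebesgue_measure R)).
HB.instance Definition _ (R : realType) :=
  Measure.copy (@lebesgue4 R) (@lebesgue2 R \x @lebesgue2 R)%E.
HB.instance Definition _ (R : realType) :=
  @Measure_isSigmaFinite.Build _ _ _ (@lebesgue4 R)
    (@product_sigma_finite R _ _ _ _ (@lebesgue2 R) (@lebesgue2 R)).

Section omega_inf_value.
Context (R : realType).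
Notation mu := (@lebesgue_measure R).
Notation mu2 := (@lebesgue2 R).
Notation mu4 := (@lebesgue4 R).

Lemma ge0_integral_mulX d1 d2 (S1 : measurableType d1) (S2 : measurableType d2)
    (m1 : {sigma_finite_measure set S1 -> \bar R})
    (m2 : {sigma_finite_measure set S2 -> \bar R}) (f : S1 -> R) (g : S2 -> R) :
  measurable_fun setT f -> measurable_fun setT g ->
  (forall x, 0 <= f x) -> (forall y, 0 <= g y) ->
  (\int[m1 \x m2]_z (f z.1 * g z.2)%:E =
   \int[m1]_x (f x)%:E * \int[m2]_y (g y)%:E)%E.
Proof.
move=> mf mg f0 g0; rewrite fubini_tonelli1; last 2 first.
- apply/measurable_EFinP; apply: measurable_funM.
  + exact: measurableT_comp.
  + exact: measurableT_comp.
- by move=> z; rewrite lee_fin mulr_ge0.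
rewrite -ge0_integralZr//; last 3 first.
- exact/measurable_EFinP.
- by move=> x _; rewrite lee_fin.
- by apply: integral_ge0 => y _; rewrite lee_fin.
apply: eq_integral => x _; rewrite /fubini_F.
under eq_integral do rewrite EFinM /=.
rewrite ge0_integralZl//.
- exact/measurable_EFinP.
- by move=> y _; rewrite lee_fin.
- by rewrite lee_fin.
Qed.

Lemma integral_circle_density4 (c : 'I_4 -> R) : (forall i, 0 < c i) ->
  (\int[@lebesgue4 R]_s (\prod_i circle_density (c i) (coord4 s i))%:E =
   ((pi / 2) ^+ 4)%:E)%E.
Proof.
move=> c0.
pose g i s := circle_density (c i) s.
have mg i : measurable_fun setT (g i) by apply: measurable_circle_density.
have g0 i s : 0 <= g i s by apply: circle_density_ge0.
pose g2 i j (s : R * R) := g i s.1 * g j s.2.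
have mg2 i j : measurable_fun setT (g2 i j).
  by apply: measurable_funM; exact: measurableT_comp.
have g20 i j s : 0 <= g2 i j s by apply: mulr_ge0.
have I2 i j : (\int[@lebesgue2 R]_s (g2 i j s)%:E = ((pi / 2) ^+ 2)%:E)%E.
  by rewrite (ge0_integral_mulX mu mu (mg i) (mg j))// /g
    !integral_circle_density// -EFinM -expr2.
under eq_integral => s _.
  rewrite !big_ord_recl big_ord0 mulr1 mulrA /coord4 /=.
  over.
rewrite (ge0_integral_mulX mu2 mu2 (mg2 _ _) (mg2 _ _))//.
by rewrite !I2 -EFinM -exprD.
Qed.

Lemma omega_infE (d : 'I_4 -> nat) (L : 'M[int]_(4, 2)) (U : set (R * R)) :
  open U -> (forall i, (0 < d i)%N) ->
  (forall x, U x -> forall i, 0 < lformR L i x) ->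
  omega_inf d L U = ((pi ^+ 4)%:E * lebesgue2 U)%E.
Proof.
move=> oU d0 L0.
have mU := open_measurable2 oU.
rewrite /omega_inf.
pose c (x : R * R) i := lformR L i x / (d i)%:R.
pose G (z : (R * R) * ((R * R) * (R * R))) :=
  \prod_i circle_density (c z.1 i) (coord4 z.2 i).
have G0 z : 0 <= G z by apply: prodr_ge0 => i _; exact: circle_density_ge0.
have mlform i : measurable_fun setT (lformR L i : R * R -> R).
  by rewrite /lformR; apply: measurable_funD; apply: measurable_funM => //.
have mcoord i : measurable_fun setT (coord4 (R:=R) ^~ i).
  rewrite /coord4; case: i => -[|[|[|[|//]]]] /= _;
  by apply: measurableT_comp => //; apply: measurableT_comp.
have mG : measurable_fun setT G.
  apply: measurable_prod => i _; apply: measurable_circle_density.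
    by apply: measurable_funM => //; apply: (measurableT_comp (mlform i)).
  by apply: (measurableT_comp (mcoord i)).
have GE (eps : {ffun 'I_4 -> bool}) z :
    (2 ^+ 4 * `|\prod_i t_coord d L eps z i|)^-1 = G z.
  have -> : 2 ^+ 4 = \prod_(i < 4) 2 :> R by rewrite prodr_const card_ord.
  rewrite /G normr_prod -big_split/= -prodfV.
  apply: eq_bigr => i _; rewrite /circle_density /t_coord normrM normr_sign mul1r.
  by rewrite ger0_norm ?sqrtr_ge0.
have step (eps : {ffun 'I_4 -> bool}) :
    (\int[mu2 \x mu4]_(z in chart d L U)
      ((2 ^+ 4 * `|\prod_i t_coord d L eps z i|)^-1)%:E
     = ((pi / 2) ^+ 4)%:E * lebesgue2 U)%E.
  under eq_integral do rewrite GE.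
  transitivity (\int[mu2 \x mu4]_z ((\1_U z.1 * G z)%:E))%E.
    rewrite integral_mkcond; apply: eq_integral => z _; rewrite patchE indicE.
    have [zU|zU] := boolP (z \in _); rewrite ?inE ?notin_setE in zU.
      by rewrite mem_set ?mul1r//; case: zU.
    have [zU1|zU1] := boolP (z.1 \in U); last by rewrite mul0r.
    rewrite mul1r /G; have /existsNP[i zi] : ~ forall i,
        coord4 z.2 i ^+ 2 < lformR L i z.1 / (d i)%:R.
      by move=> zi; apply: zU; split => //; rewrite inE in zU1.
    rewrite (bigD1 i)//= /circle_density ler0_sqrtr ?mulr0 ?invr0 ?mul0r//.
    by rewrite subr_le0 leNgt; exact/negP.
  rewrite fubini_tonelli1; last 2 first.
  - apply/measurable_EFinP; apply: measurable_funM => //.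
    have mU1 : measurable_fun setT
        (\1_U : (measurableTypeR R * measurableTypeR R)%type -> R).
      exact: measurable_indic.
    exact: (measurableT_comp mU1).
  - by move=> z; rewrite lee_fin mulr_ge0.
  transitivity (\int[mu2]_(x in U) ((pi / 2) ^+ 4)%:E)%E; last first.
    by rewrite integral_cst.
  rewrite [RHS]integral_mkcond; apply: eq_integral => x _; rewrite patchE /fubini_F.
  rewrite /= indicE; case: ifPn => [xU|xU].
    transitivity (\int[mu4]_s (\prod_i circle_density (c x i) (coord4 s i))%:E)%E.
      by apply: eq_integral => s _; rewrite mul1r.
    apply: integral_circle_density4 => i.
    by rewrite divr_gt0 ?ltr0n//; apply: L0; rewrite inE in xU.
  by rewrite integral0_eq//= => y _; rewrite mul0r.
rewrite (eq_bigr (fun=> (((pi / 2) ^+ 4)%:E * mu2 U)%E)); last first.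
  by move=> eps _; exact: step.
rewrite -ge0_sume_distrl; last by move=> _ _; rewrite lee_fin exprn_ge0// divr_ge0// pi_ge0.
congr (_ * _)%E; rewrite sumEFin sumr_const card_ffun card_bool card_ord.
by congr (_%:E); rewrite -mulr_natr /=; field.
Qed.
End omega_inf_value.

(** * The theorem *)

Lemma not_proportional_minor2 (L : 'M[int]_(4, 2)) i j :
  ~ proportional (row i L) (row j L) -> minor2 L i j != 0.
Proof.
move=> np; apply/eqP => m0; apply: np.
have m1 : L i 0 * L j 1 = L i 1 * L j 0 by apply/eqP; rewrite -subr_eq0; apply/eqP.
have ord2 (k : 'I_2) : k = 0 \/ k = 1.
  by case: k => -[|[|//]] ?; [left|right]; apply: val_inj.
(* The entries of a non-zero column serve as multipliers; if both columns vanish, both forms are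
   zero. *)
have [|nz] := eqVneq (L j 0, L i 0) (0, 0); last first.
  exists (L j 0), (L i 0); split=> //; apply/rowP => k; rewrite !mxE.
  by case: (ord2 k) => ->; rewrite ?m1 mulrC.
case=> j0 i0; have [|nz] := eqVneq (L j 1, L i 1) (0, 0); last first.
  exists (L j 1), (L i 1); split=> //; apply/rowP => k; rewrite !mxE.
  by case: (ord2 k) => ->; [rewrite j0 i0 !mulr0|rewrite mulrC].
case=> j1 i1; exists 1, 1; split=> //; apply/rowP => k; rewrite !mxE.
by case: (ord2 k) => ->; rewrite ?j0 ?i0 ?j1 ?i1.
Qed.

Lemma NH_commonW (R : realType) (d : 'I_4 -> nat) (L : 'M[int]_(4, 2))
  (U : set (R * R)) (k : 'I_3) : NH d L U k -> NH_common L U.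
Proof. by case: k => -[|[|[|//]]] ?; case. Qed.

(** * The Euler product of the indices *)

Section euler_product.
Variables (D : 'I_4 -> nat) (L : 'M[int]_(4, 2)).
Hypotheses (D0 : forall i, (0 < D i)%N) (D_odd : forall i, odd (D i)).
Notation det h := (lattice_det (Gamma h L)).

Let part N i : nat := (\prod_(0 <= p < N | prime p && (2 < p)) p ^ logn p (D i))%N.

Let part_gt0 N i : (0 < part N i)%N.
Proof.
rewrite /part; apply: prodn_cond_gt0 => p /andP[/prime_gt0 p0 _].
by rewrite expn_gt0 p0.
Qed.

(** Induction on N: each new odd prime is coprime to the part already collected, and
    [lattice_det_mul] adjoins its power. *)
Lemma det_euler N : (\prod_(0 <= p < N | prime p && (2 < p))
  det (fun i => p ^ valuations D p i) = det (part N))%N.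
Proof.
elim: N => [|N IH].
  by rewrite big_geq// lattice_det_one// => i; rewrite /part big_geq.
rewrite big_mkcond big_nat_recr//= -big_mkcond IH.
have partS i : part N.+1 i =
    (part N i * if prime N && (2 < N) then N ^ valuations D N i else 1)%N.
  by rewrite /part big_mkcond big_nat_recr//= -big_mkcond.
case: ifPn partS => [/andP[pN N2] partS|_ partS]; last first.
  by rewrite muln1; congr (lattice_det (Gamma _ L)); apply/funext => i; rewrite partS muln1.
apply/esym.
apply: (@lattice_det_mul _ _ _ _ (\prod_i part N i) (\prod_i N ^ valuations D N i)).
- by apply: prodn_gt0 => i; exact: part_gt0.
- by apply: prodn_gt0 => i; rewrite expn_gt0 prime_gt0.
- apply: (big_ind (fun m => coprime m _)) => [|x y hx hy|i _].
  + exact: coprime1n.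
  + by rewrite coprimeMl hx.
  apply: (big_ind (fun m => coprime _ m)) => [|x y hx hy|k _].
  + exact: coprimen1.
  + by rewrite coprimeMr hx.
  apply: coprimeXr; rewrite /part big_nat_cond.
  apply: (big_ind (fun m => coprime m N)) => [|x y hx hy|p /andP[/andP[_ pN'] /andP[pp _]]].
  + exact: coprime1n.
  + by rewrite coprimeMl hx.
  by apply: coprimeXl; rewrite prime_coprime// dvdn_prime2// ltn_eqF.
- by move=> i; rewrite (bigD1 i)//= dvdn_mulr.
- by move=> i; rewrite (bigD1 i)//= dvdn_mulr.
- exact: partS.
Qed.

Lemma euler_partE N i : (D i < N)%N -> part N i = D i.
Proof.
move=> DN; rewrite -[RHS](partnT (D0 i)) /partn /part.
have drop M : (\prod_(0 <= p < M | prime p && (2 < p)) p ^ logn p (D i) =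
    \prod_(0 <= p < M) p ^ logn p (D i))%N.
  rewrite big_mkcond; apply: eq_bigr => p _; case: ifPn => // np.
  have [pp|npp] := boolP (prime p); last by rewrite lognE (negbTE npp).
  have p2 : p = 2 by move: np; rewrite pp/= -leqNgt; have := prime_gt1 pp; lia.
  by rewrite p2 lognE/= dvdn2 D_odd andbF.
rewrite drop (@big_cat_nat _ _ _ (D i).+1)//= -[RHS]muln1; congr (_ * _)%N.
rewrite big_nat_cond big1// => p /andP[/andP[Dp _] _].
by rewrite lognE (_ : (p %| D i)%N = false) ?andbF//; apply/negP => /(dvdn_leq (D0 i)); lia.
Qed.

End euler_product.

(** [limn] also returns a value on divergent sequences, so convergence is asserted along with the
    identity. The identity lives in [\bar R], where the two measures take their values. *)
Theorem theorem4 (R : realType) (d D : 'I_4 -> nat) (L : 'M[int]_(4, 2))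
    (U : set (R * R)) (k : 'I_3) (j : option 'I_2)
    (hpos : forall i, (0 < d i)%N /\ (0 < D i)%N)
    (hodd : forall i, odd (d i * D i))
    (hdvd : forall i, (d i %| D i)%N)
    (hNH : NH d L U k) :
  let omega_p (p : nat) : R :=
    omega_odd R L (valuations d p) (valuations D p) p in
  let c : \bar R :=
    ((delta R d L j)%:E *
     ((pi ^+ 4)%:E * lebesgue2 U * ((lattice_det (Gamma D L))%:R^-1)%:E) *
     (odd_prime_product (sigma R d D L))%:E)%E in
  [/\ (* all the limits, series and products involved converge *)
      [/\ cvgn (delta_seq R d L j), cvgn (omega_two_seq R d L j) &
          forall p : nat, prime p -> (2 < p)%N ->
            cvgn (omega_odd_seq R L (valuations d p) (valuations D p) p)],
      [/\ forall p : nat, prime p -> (2 < p)%N ->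
            summable [set: nat * nat * nat * nat]
              (fun e => (sigma_term R d D L p e)%:E),
          cvgn (odd_prime_product_seq (sigma R d D L)) &
          cvgn (odd_prime_product_seq omega_p)] &
      c = (omega_inf d L U * (omega_two R d L j)%:E *
           (odd_prime_product omega_p)%:E)%E].
Proof.
move=> omega_p c.
have [[oU _ _ _] np L0] := NH_commonW hNH.
have indep i i' : i != i' -> minor2 L i i' != 0.
  by move=> ii'; apply: not_proportional_minor2; exact: np.
have d0 i : (0 < d i)%N by have [] := hpos i.
have D0 i : (0 < D i)%N by have [] := hpos i.
have d_odd i : odd (d i) by have := hodd i; rewrite oddM => /andP[].
have D_odd i : odd (D i) by have := hodd i; rewrite oddM => /andP[].
have dcvg := @delta_cvg R d L j.
have tcvg := @omega_two_cvg R d L j d_odd indep.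
have ocvg p : prime p -> (2 < p)%N -> _ := @omega_odd_cvg R d D L d0 D0 hdvd indep p.
have scvg := @sigma_product_cvg R d D L d0 D0 hdvd indep.
have omegaE p : prime p -> (2 < p)%N -> omega_p p =
    sigma R d D L p / (lattice_det (Gamma (fun i => p ^ valuations D p i)%N L))%:R.
  by move=> pp p2; apply: (cvg_lim _ (ocvg p pp p2)).
(* From this index on all prime factors of the D_i have been used, so the product of the indices is
   stationary at det Gamma_D. *)
pose N0 := (\sum_i D i).+1%N.
have prodE N : (N0 <= N)%N -> odd_prime_product_seq omega_p N =
    odd_prime_product_seq (sigma R d D L) N / (lattice_det (Gamma D L))%:R.
  move=> NN; rewrite /odd_prime_product_seq.
  rewrite (eq_bigr (fun p => sigma R d D L p *
    (lattice_det (Gamma (fun i => p ^ valuations D p i)%N L))%:R^-1)); last first.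
    by move=> p /andP[pp p2]; exact: omegaE.
  rewrite big_split/= prodfV -natr_prod det_euler//.
  congr (_ / (lattice_det (Gamma _ L))%:R); apply/funext => i.
  apply: euler_partE => //; apply: leq_trans NN.
  by rewrite ltnS (bigD1 i)//= leq_addr.
have pcvg : odd_prime_product_seq omega_p N @[N --> \oo] -->
    odd_prime_product (sigma R d D L) / (lattice_det (Gamma D L))%:R.
  have : odd_prime_product_seq (sigma R d D L) N / (lattice_det (Gamma D L))%:R
      @[N --> \oo] --> odd_prime_product (sigma R d D L) / (lattice_det (Gamma D L))%:R.
    by apply: cvgM; [exact: scvg|exact: cvg_cst].
  apply: cvg_trans; apply: near_eq_cvg; near=> N; apply/esym; apply: prodE.
  by near: N; exact: nbhs_infty_ge.
split.
- split; [exact: dcvg|exact: cvgP tcvg|].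
  by move=> p pp p2; exact: cvgP (ocvg p pp p2).
- split; [|exact: scvg|exact: cvgP pcvg].
  by move=> p pp p2; exact: sigma_summable.
rewrite /c (omega_infE oU d0 L0).
rewrite (_ : omega_two R d L j = delta R d L j); last exact: (cvg_lim _ tcvg).
have -> : odd_prime_product omega_p =
    odd_prime_product (sigma R d D L) / (lattice_det (Gamma D L))%:R.
  exact: (cvg_lim _ pcvg).
rewrite EFinM; set X := (_ * lebesgue2 U)%E.
by rewrite muleA [(_ * X)%E]muleC -muleA [(_%:E * (odd_prime_product _)%:E)%E]muleC.
Unshelve. all: by end_near. Qed.
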